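(* For every pair of integers $i,j\ge 1$ there is an integer $N_{ij}$ such that for $n>N_{ij}$ the OPE ${}^nU_i(z)\,{}^nU_j(w)$ in $\mathcal{W}_n(\hbar)$ is polynomial in $n$: for every $s\ge 0$, the coefficients of $({}^nU_i)_{(s)}({}^nU_j)$ with respect to the basis of $\mathcal{W}_n(\hbar)$ consisting of ordered normally ordered monomials in the ${}^nU_k^{(m)}$ are given, for all $n>N_{ij}$, by polynomials in $n$ with coefficients in $\mathbb{C}[\hbar]$. Consequently, replacing ${}^nU_k$ by $U_k$ and $n$ by a formal variable $\nu$ in these OPEs defines a vertex $\mathbb{C}[\nu,\hbar]$-algebra structure on $\mathbb{C}[\nu]\otimes\lim_{n\to\infty}\mathcal{W}_n(\hbar)$, where $U_k$ denotes the class of ${}^nU_k$.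
   Context: For a commutative algebra $A$, a vertex $A$-algebra is a vertex algebra with $A$-linear structure (i.e. equipped with a vertex algebra morphism from $A$, where $A$ carries the zero derivation). $\partial$ is the translation operator, $x^{(m)}=\partial^m x$, and $x_{(s)}y$ is the $s$-th product. $\mathcal{H}(\hbar)$ is the Heisenberg vertex $\mathbb{C}[\hbar]$-algebra whose underlying space is the algebra of differential polynomials over $\mathbb{C}[\hbar]$ in $I_1,\dots,I_n$, with OPEs $I_i(z)I_j(w)=\delta_{i,j}\frac{\hbar}{(z-w)^2}+\cdots$ (the remaining terms regular). Fields ${}^nU_j(z)$, $1\le j\le n$, are defined by $$(\partial_z+I_1(z))(\partial_z+I_2(z))\cdots(\partial_z+I_n(z))=\partial_z^n+\sum_{j=1}^n{}^nU_j(z)\,\partial_z^{n-j},$$ expanded using $\partial_z f=f\partial_z+f'$. $\mathcal{W}_n(\hbar)\subset\mathcal{H}(\hbar)$ is the vertex subalgebra over $\mathbb{C}[\hbar]$ generated by ${}^nU_1(z),\dots,{}^nU_n(z)$. By a theorem of Lukyanov (which may be taken as known), the OPEs ${}^nU_i(z)\,{}^nU_j(w)$ involve only normally ordered products of the ${}^nU_k$ and their derivatives, and the ordered normally ordered monomials in ${}^nU_k^{(m)}$, $1\le k\le n$, $m\ge 0$, form a $\mathbb{C}[\hbar]$-basis of $\mathcal{W}_n(\hbar)$. $\lim_{n\to\infty}\mathcal{W}_n(\hbar)$ is the direct limit of $\mathbb{C}[\hbar]$-modules (not of vertex algebras) along the maps $\mathcal{W}_m(\hbar)\to\mathcal{W}_n(\hbar)$,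 $m\le n$, sending each ordered normally ordered monomial in the ${}^mU_k$ and their derivatives to the same monomial in the ${}^nU_k$ and their derivatives. In the resulting vertex algebra, the elements of the limit basis are the corresponding normally ordered monomials in the $U_k^{(m)}$. *)

(* Defs.v *)
(* The complex numbers are R[i] with R : realType, and {malg A[K]} is the module
   of finitely supported functions K -> A. *)
From HB Require Import structures.
From mathcomp Require Import all_boot all_order all_algebra.
From mathcomp Require Import finmap monalg complex boolp reals.

Set Implicit Arguments.
Unset Strict Implicit.
Unset Printing Implicit Defensive.

Import GRing.Theory.
Local Open Scope ring_scope.

(* A vertex A-algebra structure on the A-module V, with
   Y(x, z) = \sum_s x_(s) z^(-s-1) and [x_(s) y = vprod s x y].  A vertex algebra
   morphism A -> V, where A carries the zero derivation, amounts to an A-module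
   structure on V for which the products are bilinear and the translation is
   linear. *)
Record vertex_structure (A : comNzRingType) (V : lmodType A) := VertexStructure {
  vac : V;
  vder : V -> V;
  vprod : int -> V -> V -> V;
  vder_linear : linear vder;
  vprod_linearl : forall s y, linear (fun x => vprod s x y);
  vprod_linearr : forall s x, linear (vprod s x);
  vprod_field : forall x y, exists N : nat,
    forall s : nat, (N <= s)%N -> vprod s x y = 0;
  vprod_vacl : forall s x, vprod s vac x = if s == -1 then x else 0;
  vprod_vacr : forall x, vprod (-1) x vac = x;
  vprod_vacr_ge0 : forall (s : nat) x, vprod s x vac = 0;
  vder_vac : vder vac = 0;
  (* [vder, Y(x, z)] = \partial_z Y(x, z) *)
  vder_prod : forall s x y,
    vder (vprod s x y) - vprod s x (vder y) = vprod (s - 1) x y *~ (- s);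
  (* (z - w)^N [Y(x, z), Y(y, w)] = 0, coefficient by coefficient *)
  vprod_local : forall x y, exists N : nat, forall (p q : int) t,
    \sum_(i < N.+1) ((-1) ^+ i * 'C(N, i)%:R) *:
       (vprod (p + N%:Z - i%:Z) x (vprod (q + i%:Z) y t)
        - vprod (q + i%:Z) y (vprod (p + N%:Z - i%:Z) x t)) = 0
}.

Definition same_structure (A : comNzRingType) (V : lmodType A)
    (S S' : vertex_structure V) : Prop :=
  [/\ vac S = vac S', vder S =1 vder S'
    & forall s x y, vprod S s x y = vprod S' s x y].

Section GeneratedSubalgebra.

Variables (A : comNzRingType) (V : lmodType A) (S : vertex_structure V).
Variable G : V -> Prop.

(* No closure under vder is needed: vder x = x_(-2) vac. *)
Inductive generated : V -> Prop :=
  | gen_vac : generated (vac S)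
  | gen_mem x of G x : generated x
  | gen_lin a x y of generated x & generated y : generated (a *: x + y)
  | gen_prod s x y of generated x & generated y : generated (vprod S s x y).

Definition gen_pred : {pred V} := fun x => `[< generated x >].

Lemma generated0 : generated 0.
Proof.
have := gen_lin (-1) gen_vac gen_vac.
by rewrite scaleN1r addNr.
Qed.

Fact gen_pred_submod : submod_closed gen_pred.
Proof.
split; first by apply/asboolP; exact: generated0.
move=> a x y /asboolP gx /asboolP gy; apply/asboolP; exact: gen_lin.
Qed.

HB.instance Definition _ :=
  GRing.isSubmodClosed.Build A V gen_pred gen_pred_submod.

Record subva := Subva { subva_val :> V; subva_valP : subva_val \in gen_pred }.

HB.instance Definition _ := [isSub for subva_val].
HB.instance Definition _ := [Choice of subva by <:].
HB.instance Definition _ := [SubChoice_isSubLmodule of subva by <:].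

Lemma vderE x : vder S x = vprod S (-2) x (vac S).
Proof.
have := vder_prod S (-1) x (vac S).
rewrite vprod_vacr vder_vac.
have -> : vprod S (-1) x 0 = 0.
  by rewrite -[in LHS](subrr 0) -scaleN1r addrC (vprod_linearr S) scaleN1r addNr.
by rewrite subr0 => ->; rewrite opprK mulr1z.
Qed.

Fact subva_vac_subproof : vac S \in gen_pred.
Proof. by apply/asboolP; exact: gen_vac. Qed.

Fact subva_prod_subproof s (x y : subva) : vprod S s x y \in gen_pred.
Proof.
have /asboolP gx := subva_valP x; have /asboolP gy := subva_valP y.
apply/asboolP; exact: gen_prod.
Qed.

Fact subva_der_subproof (x : subva) : vder S x \in gen_pred.
Proof.
rewrite vderE; exact: (subva_prod_subproof _ x (Subva subva_vac_subproof)).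
Qed.

Definition subva_vac := Subva subva_vac_subproof.
Definition subva_der x := Subva (subva_der_subproof x).
Definition subva_prod s x y := Subva (subva_prod_subproof s x y).

Let valI := @val_inj _ _ subva.

Let valL : linear subva_val.
Proof. exact: (linearP (val : {linear subva -> V})). Qed.

Fact subva_der_linear : linear subva_der.
Proof. by move=> a x y; apply: valI; apply: etrans (esym (valL _ _ _)); rewrite /= ?valL; exact: vder_linear. Qed.

Fact subva_prod_linearl s y : linear (fun x => subva_prod s x y).
Proof.
by move=> a x x'; apply: valI; apply: etrans (esym (valL _ _ _)); rewrite /= ?valL; exact: (vprod_linearl S).
Qed.

Fact subva_prod_linearr s x : linear (subva_prod s x).
Proof.
by move=> a y y'; apply: valI; apply: etrans (esym (valL _ _ _)); rewrite /= ?valL; exact: (vprod_linearr S).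
Qed.

Fact subva_prod_field x y : exists N : nat,
  forall s : nat, (N <= s)%N -> subva_prod s x y = 0.
Proof.
have [N hN] := vprod_field S x y; exists N => s /hN h; exact: valI.
Qed.

Fact subva_prod_vacl s x :
  subva_prod s subva_vac x = if s == -1 then x else 0.
Proof. by apply: valI; rewrite /= vprod_vacl; case: ifP. Qed.

Fact subva_prod_vacr x : subva_prod (-1) x subva_vac = x.
Proof. by apply: valI; rewrite /= vprod_vacr. Qed.

Fact subva_prod_vacr_ge0 (s : nat) x : subva_prod s x subva_vac = 0.
Proof. by apply: valI; rewrite /= vprod_vacr_ge0. Qed.

Fact subva_der_vac : subva_der subva_vac = 0.
Proof. by apply: valI; rewrite /= vder_vac. Qed.

Fact subva_der_prod s x y :
  subva_der (subva_prod s x y) - subva_prod s x (subva_der y)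
    = subva_prod (s - 1) x y *~ (- s).
Proof.
apply: valI; apply: etrans (esym (raddfMz (val : {additive subva -> V}) _ _)).
by rewrite raddfB /= vder_prod.
Qed.

Fact subva_prod_local x y : exists N : nat, forall (p q : int) t,
  \sum_(i < N.+1) ((-1) ^+ i * 'C(N, i)%:R) *:
     (subva_prod (p + N%:Z - i%:Z) x (subva_prod (q + i%:Z) y t)
      - subva_prod (q + i%:Z) y (subva_prod (p + N%:Z - i%:Z) x t)) = 0.
Proof.
have [N hN] := vprod_local S x y; exists N => p q t; apply: valI.
rewrite raddf0 -[RHS](hN p q t) raddf_sum; apply: eq_bigr => i _.
apply: (etrans (linearZ_LR (val : {linear subva -> V}) _ _)).
by rewrite raddfB.
Qed.

Definition subva_structure : vertex_structure subva :=
  @VertexStructure A subva subva_vac subva_der subva_prod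
    subva_der_linear subva_prod_linearl subva_prod_linearr subva_prod_field
    subva_prod_vacl subva_prod_vacr subva_prod_vacr_ge0 subva_der_vac
    subva_der_prod subva_prod_local.

End GeneratedSubalgebra.

(* The word [:: (k_1, m_1); ...; (k_r, m_r)] encodes the monomial
   u_{k_1}^(m_1) ... u_{k_r}^(m_r). *)
Definition monomial : Type := seq (nat * nat).

(* Monomials are ordered by the lexicographic order on the pairs (k, m). *)
Definition lex_le (a b : nat * nat) : bool :=
  (a.1 < b.1)%N || ((a.1 == b.1) && (a.2 <= b.2)%N).

(* Ordered monomials in u_k^(m), 1 <= k <= n. *)
Definition ordered (n : nat) : pred monomial :=
  fun mu => sorted lex_le mu && all (fun km => (1 <= km.1 <= n)%N) mu.

(* The normally ordered product :a_1 a_2 ... a_r: is nested to the right,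
   a_1_(-1) (a_2_(-1) ( ... (a_r_(-1) vac))). *)
Definition nomon (A : comNzRingType) (V : lmodType A) (S : vertex_structure V)
    (u : nat -> V) (mu : monomial) : V :=
  foldr (fun km y => vprod S (-1) (iter km.2 (vder S) (u km.1)) y) (vac S) mu.

Definition lincomb (A : comNzRingType) (V : lmodType A) (e : monomial -> V)
    (c : {malg A[seq (nat * nat)]}) : V :=
  \sum_(mu <- msupp c) c@_mu *: e mu.

Definition is_basis (A : comNzRingType) (V : lmodType A) (P : pred monomial)
    (e : monomial -> V) : Prop :=
  forall v : V, exists! c : {malg A[seq (nat * nat)]},
    {subset msupp c <= P} /\ v = lincomb e c.

(* C[hbar] *)
Notation Chbar R := {poly R[i]}.
(* C[nu, hbar], as polynomials in nu over C[hbar] *)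
Notation Cnuhbar R := {poly {poly R[i]}}.

(* H(hbar) in rank n.  The last axiom says that its underlying module is the
   algebra of differential polynomials over C[hbar] in I_1, ..., I_n, a
   differential monomial being read as a normally ordered product.  The values
   of heisI outside 1..n are irrelevant. *)
Record heisenberg (R : realType) (n : nat) := Heisenberg {
  heis : lmodType (Chbar R);
  heisS : vertex_structure heis;
  heisI : nat -> heis;
  heis_ope : forall i j, (1 <= i <= n)%N -> (1 <= j <= n)%N -> forall s : nat,
    vprod heisS s (heisI i) (heisI j)
      = if (i == j) && (s == 1%N) then 'X *: vac heisS else 0;
  heis_basis : is_basis (ordered n) (nomon heisS heisI)
}.

Section Miura.

Variables (A : comNzRingType) (V : lmodType A) (S : vertex_structure V).

(* A differential operator \sum_k a_k(z) \partial_z^k whose coefficients are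
   fields a_k(z) = Y(a k, z) is represented by a : nat -> V. *)
Definition dop_one : nat -> V := fun k => if k == 0%N then vac S else 0.

(* (\partial_z + f(z)) o a, using \partial_z g = g \partial_z + g'.  In the Miura
   product f = I_i only meets coefficients a_k in the I_j with j != i; there
   f(z) a_k(w) is regular at z = w and f(z) a_k(z) is the field of f_(-1) a_k. *)
Definition dop_mul (f : V) (a : nat -> V) : nat -> V := fun k =>
  (if k is k'.+1 then a k' else 0) + vder S (a k) + vprod S (-1) f (a k).

(* (\partial_z + f 1(z)) ... (\partial_z + f n(z)) *)
Definition miura (f : nat -> V) (n : nat) : nat -> V :=
  foldr (fun i a => dop_mul (f i) a) dop_one (iota 1 n).

End Miura.

Section WAlgebra.

Variables (R : realType) (n : nat) (H : heisenberg R n).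

(* The U_k, 1 <= k <= n, extended by 0 to all indices. *)
Definition heisU (k : nat) : heis H :=
  if (1 <= k <= n)%N then miura (heisS H) (heisI H) n (n - k) else 0.

Definition Ugen (x : heis H) : Prop := exists2 k, (1 <= k <= n)%N & x = heisU k.

Definition W : lmodType (Chbar R) := subva (heisS H) Ugen.

Definition WS : vertex_structure W := subva_structure (heisS H) Ugen.

Fact WU_subproof k : heisU k \in gen_pred (heisS H) Ugen.
Proof.
apply/asboolP; case: (boolP (1 <= k <= n)%N) => hk.
  by apply: gen_mem; exists k.
by rewrite /heisU (negPf hk); exact: generated0.
Qed.

Definition WU (k : nat) : W := Subva (WU_subproof k).

Definition Wmon : monomial -> W := nomon WS WU.

End WAlgebra.

Section Limit.

Variables (R : realType) (H : forall n, heisenberg R n).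

Definition transition_maps (phi : forall m n, {linear W (H m) -> W (H n)}) : Prop :=
  forall m n, (m <= n)%N -> forall mu, ordered m mu ->
    phi m n (Wmon (H m) mu) = Wmon (H n) mu.

Definition cocone (phi : forall m n, {linear W (H m) -> W (H n)})
    (M : lmodType (Chbar R)) (g : forall n, {linear W (H n) -> M}) : Prop :=
  forall m n, (m <= n)%N -> forall w, g n (phi m n w) = g m w.

Definition direct_limit (phi : forall m n, {linear W (H m) -> W (H n)})
    (L : lmodType (Chbar R)) (iota : forall n, {linear W (H n) -> L}) : Prop :=
  cocone phi iota /\
  forall (M : lmodType (Chbar R)) (g : forall n, {linear W (H n) -> M}),
    cocone phi g ->
    exists h : {linear L -> M}, (forall n w, h (iota n w) = g n w) /\
      (forall h' : {linear L -> M}, (forall n w, h' (iota n w) = g n w) -> h' =1 h).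

End Limit.

Definition Chbar_linear (R : realType) (L : lmodType (Chbar R))
    (M : lmodType (Cnuhbar R)) (g : L -> M) : Prop :=
  forall (a : Chbar R) x y, g (a *: x + y) = a%:P *: g x + g y.

(* (V, j) is C[nu] (x)_C L with j x = 1 (x) x.  Since C[nu, hbar] is
   C[nu] (x)_C C[hbar], the C[nu, hbar]-module C[nu] (x)_C L is the extension of
   scalars of L along C[hbar] -> C[nu, hbar]. *)
Definition scalar_extension (R : realType) (L : lmodType (Chbar R))
    (V : lmodType (Cnuhbar R)) (j : L -> V) : Prop :=
  Chbar_linear j /\
  forall (M : lmodType (Cnuhbar R)) (g : L -> M), Chbar_linear g ->
    exists h : {linear V -> M}, h \o j =1 g /\
      (forall h' : {linear V -> M}, h' \o j =1 g -> h' =1 h).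

(* Setting nu = n in the coefficients. *)
Definition specialize (R : realType) (n : nat)
    (P : {malg (Cnuhbar R)[seq (nat * nat)]}) (V : lmodType (Chbar R))
    (e : monomial -> V) : V :=
  \sum_(mu <- msupp P) (P@_mu).[n%:R] *: e mu.

(* Main.v *)
(* Give U_k^(m) degree k.  In a vertex algebra generated by the U_k in which U_k (s) U_l has
   degree < k + l for s >= 0, the Borcherds identity shows that the span of the ordered
   words is closed under all products, and that words commute up to lower degree.

   Polynomiality is proved by induction on i + j.  Splitting off the first factor of the
   Miura product gives U'_k = U_k + (\partial + I_1) U_(k-1), where U' has rank n + 1 and U is
   formed from I_2, ..., I_(n+1).  The projection killing I_1 maps U'_i (s) U'_j to U_i (s) U_j plus
   products of smaller index sum, and a word in the U'_k to the same word in the U_k plus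
   words of lower degree with coefficients polynomial in n.  Hence the difference c(n + 1) - c(n)
   of a coefficient c of U_i (s) U_j is, by downward induction on the degree of the word, a
   polynomial in n, and so is c.  The weight grading makes the set of words finite.

   The sequences (x_n) of bounded weight form a vertex algebra over C[nu, hbar], nu acting as n
   in rank n.  The sequences that are eventually a fixed polynomial combination of ordered words
   form a subalgebra of it, whose quotient by the eventually zero sequences is the required
   structure.  For uniqueness, the span of the ordered words in the pairs (U_k, U_k) is closed
   under the products of two given structures, hence these agree on the diagonal. *)
Require Import Defs.
From HB Require Import structures.
From mathcomp Require Import all_boot all_order all_algebra.
From mathcomp Require Import finmap monalg complex boolp reals.
From mathcomp Require Import zify ring.

Set Implicit Arguments.
Unset Strict Implicit.
Unset Printing Implicit Defensive.

Import Order.TTheory GRing.Theory Num.Theory.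
Local Open Scope ring_scope.

(** * The Borcherds identity *)

(** The axioms contain locality but not the Borcherds identity, which is therefore derived from
    Dong's lemma and Goddard's uniqueness argument. The translation axiom determines the modes of a
    field on the vacuum only up to integer factors, hence the standing assumption [natinv].

    Two gradings cooperate. The degree ignores derivatives and drops under every product of
    non-negative index, so that straightening terminates; but infinitely many words share a degree.
    The weight counts derivatives, is respected exactly, bounds the degree of words in the U_k with
    k >= 1, and leaves finitely many such words.

    The obstacle is circularity: straightening uses the very OPEs whose polynomiality is at stake.
    The closure properties of the filtration hence carry a bound d on the total degree of the OPEs
    assumed known, and the step to i + j = d + 1 straightens only expressions within that bound.
    Working modulo eventually zero sequences turns a claim for all large n into membership in a span
    over C[nu, hbar]. The projection killing I_1 is not a homomorphism: contracting I_1 with itself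
    leaves hbar U_(i-1) (s-2) U_(j-1), again of smaller index sum. *)

Definition natinv (A : comNzRingType) := forall n : nat, exists a : A, a * n.+1%:R = 1.

Lemma natinv_mulrn_eq0 (A : comNzRingType) (V : lmodType A) (v : V) (n : nat) :
  natinv A -> v *+ n.+1 = 0 -> v = 0.
Proof.
move=> hA; have [a ha] := hA n; move=> h.
by rewrite -[v]scale1r -ha -scalerA scaler_nat h scaler0.
Qed.

(* C(-m-1, i) = (-1)^i C(m+i, i). *)
Definition binz (r : int) (i : nat) : int :=
  match r with
  | Posz n => 'C(n, i)%:Z
  | Negz m => (-1) ^+ i * 'C(m + i, i)%:Z
  end.

Lemma binz0 r : binz r 0 = 1.
Proof. by case: r => n /=; rewrite bin0 ?mul1r. Qed.

Lemma binz0S i : binz 0 i.+1 = 0.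
Proof. by []. Qed.

Lemma binz1 r : binz r 1 = r.
Proof.
case: r => n /=; first by rewrite bin1.
by rewrite addn1 bin1 expr1 mulN1r.
Qed.

Lemma binzN1 i : binz (-1) i = (-1) ^+ i.
Proof. by rewrite -[-1]/(Negz 0) /= add0n binn mulr1. Qed.

Lemma binzS r i : binz (r + 1) i.+1 = binz r i.+1 + binz r i.
Proof.
case: r => [n|[|m]].
- have -> : Posz n + 1 = n.+1 by lia.
  by rewrite /= binS PoszD.
- have -> : Negz 0 + 1 = 0 by [].
  by rewrite /= !add0n !binn exprS mulN1r mulNr addNr.
- have -> : Negz m.+1 + 1 = Negz m by lia.
  rewrite /= [in 'C(m.+1 + i.+1, _)]addSn binS addSnnS.
  rewrite exprS PoszD; ring.
Qed.

Lemma binz_absorb r i : i.+1%:Z * binz r i.+1 = (r - i%:Z) * binz r i.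
Proof.
case: r => [n|m].
- rewrite /=.
  case: (leqP i n) => h.
    rewrite subzn // -!PoszM; congr Posz.
    have := mul_bin_left n i; lia.
  by rewrite !bin_small ?mulr0 // ltnW.
- rewrite /= exprS NegzE.
  have := mul_bin_diag (m + i.+1) i.
  have := mul_bin_left (m + i.+1) i.
  have := mul_bin_diag (m + i) i.
  have -> : (m + i.+1 = (m + i).+1)%N by lia.
  rewrite /= => _ _ h.
  have h' : i.+1%:Z * 'C((m + i).+1, i.+1)%:Z = (m + i).+1%:Z * 'C(m + i, i)%:Z.
    by rewrite -!PoszM h.
  rewrite mulN1r mulNr mulrN mulrCA h'.
  by have -> : (m + i).+1%:Z = m.+1%:Z + i%:Z; [lia|ring].
Qed.

Definition signz (r : int) : int := (-1) ^+ absz r.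

Lemma signzS r : signz (r + 1) = - signz r.
Proof.
rewrite /signz; case: r => [n|[|m]] //.
- by rewrite addrC -intS exprS mulN1r.
- have -> : Negz m.+1 + 1 = Negz m by lia.
  by rewrite /= [in RHS]exprS mulN1r opprK.
Qed.

Section VSum.
Variable V : zmodType.
Implicit Types f g : nat -> V.

Definition evz f N := forall i, (N <= i)%N -> f i = 0.

(** A total operator with junk value 0 lets expansions be written without carrying a bound; [vsumE]
    accepts any bound that works. *)
Definition vsum f : V :=
  match pselect (exists N, evz f N) with
  | left h => \sum_(i < projT1 (cid h)) f i
  | right _ => 0
  end.

Lemma evz_sum f M N : evz f M -> evz f N -> \sum_(i < M) f i = \sum_(i < N) f i.
Proof.
wlog le : M N / (M <= N)%N => [hw hM hN|hM _].
  by case: (leqP M N) => [|/ltnW] h; [|symmetry]; exact: hw.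
rewrite (big_ord_widen N f le) big_mkcond; apply: eq_bigr => i _.
by case: ltnP => // /hM ->.
Qed.

Lemma vsumE N f : evz f N -> vsum f = \sum_(i < N) f i.
Proof.
move=> h; rewrite /vsum; case: pselect => [h'|[]]; last by exists N.
by case: cid => M hM /=; exact: evz_sum.
Qed.

Lemma eq_vsum f g : f =1 g -> vsum f = vsum g.
Proof. by move=> /funext ->. Qed.

Lemma vsum0 f : (forall i, f i = 0) -> vsum f = 0.
Proof. by move=> h; rewrite (@vsumE 0) ?big_ord0. Qed.

End VSum.

Section Shift.
Variable V : zmodType.
Implicit Types F G : int -> int -> V.

(* The coefficient of [z^p w^q (z-w)^r F(z,w)], expanded in the domain |z| > |w|. *)
Definition vexpand (r : int) F (p q : int) : V :=
  vsum (fun i => F (p + r - i%:Z) (q + i%:Z) *~ ((-1) ^+ i * binz r i)).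

(** Multiplication by z - w on arrays of modes, so that locality of order N says that
    [iter N shiftB] kills the commutator. *)
Definition shiftB F : int -> int -> V := fun p q => F (p + 1) q - F p (q + 1).

Definition vtrunc (B : nat) F := forall a b : int, B%:Z <= b -> F a b = 0.

Lemma vexpand0 F p q : vexpand 0 F p q = F p q.
Proof.
rewrite /vexpand (@vsumE _ 1) ?big_ord1 /=.
  by rewrite addr0 subr0 addr0 mulr1.
by case=> // i _; rewrite ?binz0S ?bin0n /= mulr0.
Qed.

Lemma vexpand_sum B r F p q N : vtrunc B F -> (`|q| + B <= N)%N ->
  vexpand r F p q = \sum_(i < N) F (p + r - i%:Z) (q + i%:Z) *~ ((-1) ^+ i * binz r i).
Proof.
by move=> h hN; apply: vsumE => i hi; rewrite h ?mul0rz //; lia.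
Qed.

Lemma vexpand_nat_sum F n p q :
  vexpand n%:Z F p q = \sum_(i < n.+1) F (p + n%:Z - i%:Z) (q + i%:Z) *~ ((-1) ^+ i * 'C(n, i)%:Z).
Proof.
by apply: vsumE => i hi; rewrite /= bin_small // mulr0 mulr0z.
Qed.

(** This is (z-w)^(r+1) = z (z-w)^r - w (z-w)^r, by Pascal's rule. The sums are finite for one of
    two reasons: [F] is truncated, or r is a natural number and the binomials vanish. *)
Lemma vexpand_rec_gen (r : int) F p q (K : nat) :
  (forall i, (K <= i)%N -> F (p + 1 + r - i%:Z) (q + i%:Z) = 0) \/
  (forall i, (K <= i)%N -> binz r i = 0) ->
  vexpand (r + 1) F p q = vexpand r F (p + 1) q - vexpand r F p (q + 1).
Proof.
move=> h.
pose G i := F (p + 1 + r - i%:Z) (q + i%:Z).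
have e1 : vexpand (r + 1) F p q = \sum_(i < K.+1) G i *~ ((-1) ^+ i * binz (r + 1) i).
  rewrite /vexpand (@vsumE _ K.+1) => [|[//|i] hi].
    by apply: eq_bigr => i _; congr (F _ _ *~ _); ring.
  case: h => h; last by rewrite binzS !h ?addr0 ?mulr0 // ltnW.
  have -> : p + (r + 1) - i.+1%:Z = p + 1 + r - i.+1%:Z by ring.
  by rewrite h ?mul0rz // ltnW.
have e2 : vexpand r F (p + 1) q = \sum_(i < K.+1) G i *~ ((-1) ^+ i * binz r i).
  rewrite /vexpand (@vsumE _ K.+1) => // i hi.
  by case: h => h; rewrite h ?mul0rz ?mulr0 ?mulr0z // ltnW.
have e3 : vexpand r F p (q + 1) = \sum_(i < K) G i.+1 *~ ((-1) ^+ i * binz r i).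
  rewrite /vexpand (@vsumE _ K) => [|i hi].
    by apply: eq_bigr => i _; congr (F _ _ *~ _); lia.
  case: h => h; last by rewrite h ?mulr0.
  have -> : p + r - i%:Z = p + 1 + r - i.+1%:Z by lia.
  have -> : q + 1 + i%:Z = q + i.+1%:Z by lia.
  by rewrite h ?mul0rz // ltnW.
rewrite e1 e2 e3 !big_ord_recl /= !binz0 -addrA; congr (_ + _).
rewrite -sumrB; apply: eq_bigr => i _.
rewrite /bump /= add1n binzS -mulrzBr; congr (_ *~ _).
by rewrite exprS; ring.
Qed.

Lemma vexpand_rec B r F p q : vtrunc B F ->
  vexpand (r + 1) F p q = vexpand r F (p + 1) q - vexpand r F p (q + 1).
Proof.
move=> h; apply: (@vexpand_rec_gen _ _ _ _ (`|q| + B)%N); left=> i hi.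
by apply: h; lia.
Qed.

Lemma iter_shiftB n F p q : iter n shiftB F p q = vexpand n%:Z F p q.
Proof.
elim: n p q => [|n IH] p q; first by rewrite vexpand0.
rewrite iterS /shiftB !IH.
have -> : n.+1%:Z = n%:Z + 1 by lia.
rewrite (@vexpand_rec_gen _ _ _ _ n.+1) //; right => i hi.
by rewrite /= bin_small.
Qed.

Lemma vexpandB B r F G p q : vtrunc B F -> vtrunc B G ->
  vexpand r (fun a b => F a b - G a b) p q = vexpand r F p q - vexpand r G p q.
Proof.
move=> hF hG.
rewrite !(@vexpand_sum B _ _ _ _ (`|q| + B)%N) //.
  by rewrite -sumrB; apply: eq_bigr => i _; rewrite mulrzBl.
by move=> a b h; rewrite hF // hG // subr0.
Qed.

Lemma vexpand_eq0 r F p q : (forall a b, F a b = 0) -> vexpand r F p q = 0.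
Proof. by move=> h; apply: vsum0 => i; rewrite h mul0rz. Qed.

End Shift.

Lemma subrACA (V : zmodType) (a b c d : V) : (a - b) - (c - d) = (a - c) - (b - d).
Proof. by rewrite opprD addrACA -opprD. Qed.

(** * Dong's lemma for arrays of modes *)

Section Dong.
Variable V : zmodType.

(* In this section the arguments of [f] are the exponents [p], [q], [r], [m] in
   z^p w^q (z-w)^r u^m, and those of [T] the exponents of z, w, u. *)
Implicit Types (f : int -> int -> int -> int -> V) (T : int -> int -> int -> V).

(** Multiplication by z - u and w - u, on arrays containing (z-w)^r ([dZU], [dWU]) and before that
    factor is expanded ([eZU], [eWU]). *)
Definition dZU f := fun p q r m => f (p + 1) q r m - f p q r (m + 1).
Definition dWU f := fun p q r m => f p (q + 1) r m - f p q r (m + 1).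
Definition eZU T := fun a b m => T (a + 1) b m - T a b (m + 1).
Definition eWU T := fun a b m => T a (b + 1) m - T a b (m + 1).

Definition relZW f := forall p q r m, f p q (r + 1) m = f (p + 1) q r m - f p (q + 1) r m.

Lemma dZWU f : dZU (dWU f) = dWU (dZU f).
Proof. by do 4!apply: funext => ?; exact: subrACA. Qed.

Lemma eZWU T : eZU (eWU T) = eWU (eZU T).
Proof. by do 3!apply: funext => ?; exact: subrACA. Qed.

Lemma iter_comm (X : Type) (F G : X -> X) : (forall x, F (G x) = G (F x)) ->
  forall a b x, iter a F (iter b G x) = iter b G (iter a F x).
Proof.
move=> h a b x.
have h1 : forall x, F (iter b G x) = iter b G (F x).
  by elim: b {x} => //= b IH x; rewrite h IH.
by elim: a => //= a ->; rewrite h1.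
Qed.

Lemma relZW_dZU f : relZW f -> relZW (dZU f).
Proof. by move=> h p q r m; rewrite /dZU !h subrACA. Qed.

Lemma relZW_dWU f : relZW f -> relZW (dWU f).
Proof. by move=> h p q r m; rewrite /dWU !h subrACA. Qed.

Definition zero4 : int -> int -> int -> int -> V := fun _ _ _ _ => 0.

Lemma iter_dZU0 n : iter n dZU zero4 = zero4.
Proof. by elim: n => //= n ->; do 4!apply: funext => ?; exact: subr0. Qed.

Lemma iter_dWU0 n : iter n dWU zero4 = zero4.
Proof. by elim: n => //= n ->; do 4!apply: funext => ?; exact: subr0. Qed.

(* On [f] the operator W - U is (Z - U) - (Z - W), and each term of a large power of this
   difference contains a power of Z - U or of Z - W that kills [f]. *)
Lemma dong_kill f (N : nat) (N1 : int) : relZW f ->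
  (forall p q r m, N1 <= r -> f p q r m = 0) ->
  iter N dZU (iter N dWU f) = zero4 ->
  forall k a s, N%:Z - a%:Z + (N1 - s) <= k%:Z ->
  forall p q m, iter a dZU (iter (N + k) dWU f) p q s m = 0.
Proof.
move=> hrel h0 hN.
have rel_iter a' b : relZW (iter a' dZU (iter b dWU f)).
  elim: a' => [|a' IH] /=; last exact: relZW_dZU.
  by elim: b => [|b IH] //=; exact: relZW_dWU.
have kill_r a' b p q r m : N1 <= r -> iter a' dZU (iter b dWU f) p q r m = 0.
  move=> hr.
  elim: a' p q m => [|a' IH] p q m /=; last by rewrite /dZU !IH subr0.
  elim: b p q m => [|b IH] p q m /=; first exact: h0.
  by rewrite /dWU !IH subr0.
have kill_a a' b : (N <= a')%N -> iter a' dZU (iter (N + b) dWU f) = zero4.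
  move=> ha.
  rewrite -(subnK ha) iterD addnC iterD (iter_comm (F := dZU) (G := dWU)).
    by rewrite hN iter_dWU0 iter_dZU0.
  exact: dZWU.
(* The hypothesis bounds the deficit (N - a) + (N1 - s). Rewriting one factor w - u as (z - u) - (z
   - w) raises [a] in one term and [s] in the other, so each has a smaller deficit. *)
elim=> [|k IH] a s hk p q m; have [ha|ha] := leqP N a; try by rewrite kill_a.
  by rewrite kill_r //; lia.
have [hs|hs] := lerP N1 s; first by rewrite kill_r.
have hs1 : iter a dZU (iter (N + k) dWU f) p q (s + 1) m = 0 by apply: IH; lia.
have ha1 : iter a.+1 dZU (iter (N + k) dWU f) p q s m = 0 by apply: IH; lia.
rewrite addnS iterS -[dWU _]/(iter 1 dWU _) (iter_comm (F := dZU)); last exact: dZWU.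
rewrite /= /dWU.
by move: hs1; rewrite rel_iter => /subr0_eq <-.
Qed.

End Dong.

Section Borcherds.
Variables (A : comNzRingType) (V : lmodType A) (S : vertex_structure V).
Implicit Types (x y z c t v : V) (p q r s : int).

Local Notation pr := (vprod S).

HB.instance Definition _ s x := GRing.isLinear.Build A V V _ (pr s x) (vprod_linearr S s x).

Definition vprodl s y x := pr s x y.

HB.instance Definition _ s y := GRing.isLinear.Build A V V _ (vprodl s y) (vprod_linearl S s y).

HB.instance Definition _ := GRing.isLinear.Build A V V _ (vder S) (vder_linear S).

Lemma vprod0l s y : pr s 0 y = 0. Proof. exact: (raddf0 (vprodl s y)). Qed.
Lemma vprodDl s x x' y : pr s (x + x') y = pr s x y + pr s x' y.
Proof. exact: (raddfD (vprodl s y)). Qed.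
Lemma vprodBl s x x' y : pr s (x - x') y = pr s x y - pr s x' y.
Proof. exact: (raddfB (vprodl s y)). Qed.
Lemma vprodZl s a x y : pr s (a *: x) y = a *: pr s x y.
Proof. exact: (linearZ_LR (vprodl s y)). Qed.
Lemma vprod0r s x : pr s x 0 = 0. Proof. exact: raddf0. Qed.
Lemma vprodDr s x y y' : pr s x (y + y') = pr s x y + pr s x y'.
Proof. exact: raddfD. Qed.
Lemma vprodBr s x y y' : pr s x (y - y') = pr s x y - pr s x y'.
Proof. exact: raddfB. Qed.
Lemma vprodZr s a x y : pr s x (a *: y) = a *: pr s x y.
Proof. exact: linearZ_LR. Qed.
Lemma vprodMzr s n x y : pr s x (y *~ n) = pr s x y *~ n.
Proof. exact: raddfMz. Qed.
Lemma vprod_trunc x y : exists B : nat, forall s : int, B%:Z <= s -> pr s x y = 0.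
Proof.
have [B hB] := vprod_field S x y; exists B => -[s|s] // h.
by apply: hB; lia.
Qed.

Lemma vder_prodE s x y : vder S (pr s x y) = pr s x (vder S y) - pr (s - 1) x y *~ s.
Proof. by rewrite -mulrNz -vder_prod addrC subrK. Qed.

(** The mode of z^p w^q (z-w)^r against Y(x,z)Y(y,w) expanded in |z| > |w|, minus Y(y,w)Y(x,z)
    expanded in |w| > |z|; [signz] turns (w-z)^r into (z-w)^r. *)
Definition jac x y p q r t : V :=
  vexpand r (fun a b => pr a x (pr b y t)) p q
  - vexpand r (fun b a => pr b y (pr a x t)) q p *~ signz r.

Lemma jac_rec x y p q r t :
  jac x y p q (r + 1) t = jac x y (p + 1) q r t - jac x y p (q + 1) r t.
Proof.
have [B1 h1] := vprod_trunc y t; have [B2 h2] := vprod_trunc x t.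
rewrite /jac (@vexpand_rec _ B1) => [|a b h]; last by rewrite h1 ?vprod0r.
rewrite (@vexpand_rec _ B2) => [|a b h]; last by rewrite h2 ?vprod0r.
by rewrite signzS mulrNz -mulNrz opprB subrACA mulrzBl.
Qed.

Definition vcomm x y t a b := pr a x (pr b y t) - pr b y (pr a x t).

(** For r >= 0 both expansions are the same polynomial (z-w)^r; reversing the second binomial sum
    absorbs the sign. *)
Lemma jac_comm x y p q (n : nat) t :
  jac x y p q n t = iter n (@shiftB V) (vcomm x y t) p q.
Proof.
rewrite iter_shiftB /jac !vexpand_nat_sum.
rewrite [X in _ - X *~ _](reindex_inj rev_ord_inj) mulrz_suml -sumrB.
apply: eq_bigr => i _; have hi := ltn_ord i; rewrite /= subSS.
rewrite /vcomm mulrzBl -mulrzA bin_sub; last by lia.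
have -> : q + n%:Z - (n - i)%N%:Z = q + i%:Z by lia.
have -> : p + (n - i)%N%:Z = p + n%:Z - i%:Z by lia.
congr (_ - _ *~ _); rewrite mulrAC /signz -exprD; congr (_ * _).
have -> : (n - i + absz n = i + (n - i).*2)%N by rewrite /=; lia.
by rewrite exprD -mul2n exprM sqrrN !expr1n mulr1.
Qed.

Lemma iter_vcomm N x y p q t : iter N (@shiftB V) (vcomm x y t) p q =
  \sum_(i < N.+1) ((-1) ^+ i * 'C(N, i)%:R) *:
     (pr (p + N%:Z - i%:Z) x (pr (q + i%:Z) y t)
      - pr (q + i%:Z) y (pr (p + N%:Z - i%:Z) x t)).
Proof.
rewrite iter_shiftB vexpand_nat_sum; apply: eq_bigr => i _.
by rewrite -scaler_int intrM rmorphXn /= mulrN1z.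
Qed.

Lemma locality x y : exists N : nat, forall p q t, iter N (@shiftB V) (vcomm x y t) p q = 0.
Proof.
by have [N hN] := vprod_local S x y; exists N => p q t; rewrite iter_vcomm hN.
Qed.

Lemma jac_eq0 x y : exists N : nat, forall r p q t, N%:Z <= r -> jac x y p q r t = 0.
Proof.
have [N hN] := locality x y; exists N => r p q t h.
have -> : r = N%:Z + (absz (r - N%:Z))%:Z by lia.
elim: absz p q => [|k IH] p q; first by rewrite addr0 jac_comm hN.
have -> : N%:Z + k.+1%:Z = N%:Z + k%:Z + 1 by lia.
by rewrite jac_rec !IH subr0.
Qed.

End Borcherds.

Lemma vtrunc_le (V : zmodType) B B' (F : int -> int -> V) :
  (B <= B')%N -> vtrunc B F -> vtrunc B' F.
Proof. by move=> le h a b hb; apply: h; lia. Qed.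

Lemma vexpandB2 (V : zmodType) B B' r (F G : int -> int -> V) p q :
  vtrunc B F -> vtrunc B' G ->
  vexpand r (fun a b => F a b - G a b) p q = vexpand r F p q - vexpand r G p q.
Proof.
move=> hF hG; apply: (@vexpandB _ (maxn B B')).
  by apply: vtrunc_le hF; exact: leq_maxl.
by apply: vtrunc_le hG; exact: leq_maxr.
Qed.

Lemma vexpand_raddf (V V' : zmodType) (f : {additive V -> V'}) B r F p q :
  vtrunc B F -> f (vexpand r F p q) = vexpand r (fun a b => f (F a b)) p q.
Proof.
move=> h; rewrite (vexpand_sum _ _ h (leqnn _)).
rewrite (@vexpand_sum _ B r (fun a b => f (F a b)) p q _ _ (leqnn _)).
  by rewrite raddf_sum; apply: eq_bigr => i _; rewrite raddfMz.
by move=> a b hb; rewrite h ?raddf0.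
Qed.

Section DongExpand.
Variable V : zmodType.
Implicit Types (f g : int -> int -> int -> int -> V) (T : int -> int -> int -> V).

Definition truncT T := forall m, exists B, vtrunc B (fun a b => T a b m).

Lemma truncT_eZU T : truncT T -> truncT (eZU T).
Proof.
move=> h m; have [B hB] := h m; have [B' hB'] := h (m + 1).
exists (maxn B B') => a b hb; rewrite /eZU hB ?hB' ?subr0 //; lia.
Qed.

Lemma truncT_eWU T : truncT T -> truncT (eWU T).
Proof.
move=> h m; have [B hB] := h m; have [B' hB'] := h (m + 1).
exists (maxn B B') => a b hb; rewrite /eWU hB ?hB' ?subr0 //; lia.
Qed.

Definition expandT T := fun p q r m => vexpand r (fun a b => T a b m) p q.
(** Here the first argument of [T] is the exponent of w, so z - u and w - u trade places in the
    intertwining lemmas below. *)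
Definition expandTop T := fun p q r m => vexpand r (fun a b => T a b m) q p *~ signz r.

Lemma vexpandBT T T' r m m' p q : truncT T -> truncT T' ->
  vexpand r (fun a b => T a b m - T' a b m') p q =
  vexpand r (fun a b => T a b m) p q - vexpand r (fun a b => T' a b m') p q.
Proof.
move=> h h'; have [B hB] := h m; have [B' hB'] := h' m'.
exact: (@vexpandB2 _ _ _ r (fun a b => T a b m) (fun a b => T' a b m') p q hB hB').
Qed.

Lemma vexpand_shift1 r (F : int -> int -> V) p q :
  vexpand r (fun a b => F (a + 1) b) p q = vexpand r F (p + 1) q.
Proof. by apply: eq_vsum => i; congr (F _ _ *~ _); lia. Qed.

Lemma vexpand_shift2 r (F : int -> int -> V) p q :
  vexpand r (fun a b => F a (b + 1)) p q = vexpand r F p (q + 1).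
Proof. by apply: eq_vsum => i; congr (F _ _ *~ _); lia. Qed.

Lemma truncT_shift1 T : truncT T -> truncT (fun a b m => T (a + 1) b m).
Proof. by move=> h m; have [B hB] := h m; exists B => a b hb; apply: hB. Qed.

Lemma truncT_shift2 T : truncT T -> truncT (fun a b m => T a (b + 1) m).
Proof. by move=> h m; have [B hB] := h m; exists B => a b hb; apply: hB; lia. Qed.

Lemma expandT_eZU T : truncT T -> dZU (expandT T) = expandT (eZU T).
Proof.
move=> h; do 4!apply: funext => ?; rewrite /dZU /expandT /eZU.
by rewrite (vexpandBT _ _ _ _ _ (truncT_shift1 h) h) -(vexpand_shift1 _ (fun a b => T a b _)).
Qed.

Lemma expandT_eWU T : truncT T -> dWU (expandT T) = expandT (eWU T).
Proof.
move=> h; do 4!apply: funext => ?; rewrite /dWU /expandT /eWU.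
by rewrite (vexpandBT _ _ _ _ _ (truncT_shift2 h) h) -(vexpand_shift2 _ (fun a b => T a b _)).
Qed.

Lemma expandTop_eZU T : truncT T -> dWU (expandTop T) = expandTop (eZU T).
Proof.
move=> h; do 4!apply: funext => ?; rewrite /dWU /expandTop /eZU -mulrzBl.
by rewrite (vexpandBT _ _ _ _ _ (truncT_shift1 h) h) -(vexpand_shift1 _ (fun a b => T a b _)).
Qed.

Lemma expandTop_eWU T : truncT T -> dZU (expandTop T) = expandTop (eWU T).
Proof.
move=> h; do 4!apply: funext => ?; rewrite /dZU /expandTop /eWU -mulrzBl.
by rewrite (vexpandBT _ _ _ _ _ (truncT_shift2 h) h) -(vexpand_shift2 _ (fun a b => T a b _)).
Qed.

Definition zero3 : int -> int -> int -> V := fun _ _ _ => 0.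

Lemma iter_intertwine (X Y : Type) (P : X -> Prop) (h : X -> Y) F G n x :
  (forall x, P x -> P (F x)) -> (forall x, P x -> G (h x) = h (F x)) ->
  P x -> P (iter n F x) /\ iter n G (h x) = h (iter n F x).
Proof.
move=> hP hG px; elim: n => //= n [IH1 IH2]; split; first exact: hP.
by rewrite IH2 hG.
Qed.

Lemma expandT_kill T N : truncT T -> iter N (@eZU V) (iter N (@eWU V) T) = zero3 ->
  iter N (@dZU V) (iter N (@dWU V) (expandT T)) = @zero4 V.
Proof.
move=> h h0.
have [h1 ->] := iter_intertwine N truncT_eWU expandT_eWU h.
have [_ ->] := iter_intertwine N truncT_eZU expandT_eZU h1.
by rewrite h0; do 4!apply: funext => ?; exact: vexpand_eq0.
Qed.

Lemma expandTop_kill T N : truncT T -> iter N (@eZU V) (iter N (@eWU V) T) = zero3 ->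
  iter N (@dZU V) (iter N (@dWU V) (expandTop T)) = @zero4 V.
Proof.
move=> h; rewrite (iter_comm (@eZWU V)) => h0.
have [h1 ->] := iter_intertwine N truncT_eZU expandTop_eZU h.
have [_ ->] := iter_intertwine N truncT_eWU expandTop_eWU h1.
by rewrite h0; do 4!apply: funext => ?; rewrite /expandTop vexpand_eq0 // mul0rz.
Qed.

Definition sub4 f g := fun p q r m => f p q r m - g p q r m.
Definition add3 (T T' : int -> int -> int -> V) := fun a b m => T a b m + T' a b m.

Lemma sub4_dZU f g : dZU (sub4 f g) = sub4 (dZU f) (dZU g).
Proof. by do 4!apply: funext => ?; exact: subrACA. Qed.
Lemma sub4_dWU f g : dWU (sub4 f g) = sub4 (dWU f) (dWU g).
Proof. by do 4!apply: funext => ?; exact: subrACA. Qed.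
Lemma iter_sub4_dZU n f g :
  iter n (@dZU V) (sub4 f g) = sub4 (iter n (@dZU V) f) (iter n (@dZU V) g).
Proof. by elim: n => //= n ->; rewrite sub4_dZU. Qed.
Lemma iter_sub4_dWU n f g :
  iter n (@dWU V) (sub4 f g) = sub4 (iter n (@dWU V) f) (iter n (@dWU V) g).
Proof. by elim: n => //= n ->; rewrite sub4_dWU. Qed.

Lemma add3_eZU T T' : eZU (add3 T T') = add3 (eZU T) (eZU T').
Proof. by do 3!apply: funext => ?; rewrite /eZU /add3 opprD addrACA. Qed.
Lemma add3_eWU T T' : eWU (add3 T T') = add3 (eWU T) (eWU T').
Proof. by do 3!apply: funext => ?; rewrite /eWU /add3 opprD addrACA. Qed.
Lemma iter_add3_eZU n T T' :
  iter n (@eZU V) (add3 T T') = add3 (iter n (@eZU V) T) (iter n (@eZU V) T').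
Proof. by elim: n => //= n ->; rewrite add3_eZU. Qed.
Lemma iter_add3_eWU n T T' :
  iter n (@eWU V) (add3 T T') = add3 (iter n (@eWU V) T) (iter n (@eWU V) T').
Proof. by elim: n => //= n ->; rewrite add3_eWU. Qed.
Lemma iter_eZU0 n : iter n (@eZU V) zero3 = zero3.
Proof. by elim: n => //= n ->; do 3!apply: funext => ?; exact: subr0. Qed.
Lemma iter_eWU0 n : iter n (@eWU V) zero3 = zero3.
Proof. by elim: n => //= n ->; do 3!apply: funext => ?; exact: subr0. Qed.

Lemma shiftB_dWU n f p r q m :
  iter n (@dWU V) f p q r m = iter n (@shiftB V) (fun q m => f p q r m) q m.
Proof. by elim: n q m => //= n IH q m; rewrite /dWU /shiftB !IH. Qed.

Lemma iter_shiftB0 n : iter n (@shiftB V) (fun _ _ => 0) = (fun _ _ => 0).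
Proof. by elim: n => //= n ->; do 2!apply: funext => ?; exact: subr0. Qed.

Lemma iter_shiftB_sub n (F G : int -> int -> V) :
  iter n (@shiftB V) (fun a b => F a b - G a b)
  = (fun a b => iter n (@shiftB V) F a b - iter n (@shiftB V) G a b).
Proof. by elim: n => //= n ->; do 2!apply: funext => ?; exact: subrACA. Qed.

Lemma iter_shiftB_ge n N (F : int -> int -> V) : (N <= n)%N ->
  iter N (@shiftB V) F = (fun _ _ => 0) -> iter n (@shiftB V) F = (fun _ _ => 0).
Proof. by move=> /subnK <- h; rewrite iterD h iter_shiftB0. Qed.

End DongExpand.

(** * Associativity and the Borcherds identity *)

Section Associativity.
Variables (A : comNzRingType) (V : lmodType A) (S : vertex_structure V).
Implicit Types (x y z c t v : V) (p q r s m : int).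
Local Notation pr := (vprod S).

Lemma locality_ge x y : exists N : nat, forall n t, (N <= n)%N ->
  iter n (@shiftB V) (vcomm S x y t) = (fun _ _ => 0).
Proof.
have [N hN] := locality S x y; exists N => n t h.
by apply: iter_shiftB_ge h _; do 2!apply: funext => ?; exact: hN.
Qed.

Definition triple x y c v a b m := pr a x (pr b y (pr m c v)) - pr m c (pr a x (pr b y v)).

(** Telescoping: the bracket of Y(x)Y(y) with Y(c) is Y(x)[Y(y), Y(c)] + [Y(x), Y(c)]Y(y). The first
    term dies under (w-u)^n, the second under (z-u)^n. *)
Lemma triple_kill x y c v n :
  (forall t, iter n (@shiftB V) (vcomm S x c t) = (fun _ _ => 0)) ->
  (forall t, iter n (@shiftB V) (vcomm S y c t) = (fun _ _ => 0)) ->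
  iter n (@eZU V) (iter n (@eWU V) (triple x y c v)) = @zero3 V.
Proof.
move=> hx hy.
pose T1 a b m := pr a x (vcomm S y c v b m).
pose T2 a b m := vcomm S x c (pr b y v) a m.
have -> : triple x y c v = add3 T1 T2.
  do 3!apply: funext => ?; rewrite /add3 /T1 /T2 /vcomm vprodBr.
  by rewrite addrA subrK.
have e1 k : iter k (@eWU V) T1 = fun a b m => pr a x (iter k (@shiftB V) (vcomm S y c v) b m).
  by elim: k => //= k ->; do 3!apply: funext => ?; rewrite /eWU /shiftB vprodBr.
have e2 k : iter k (@eZU V) T2 = fun a b m => iter k (@shiftB V) (vcomm S x c (pr b y v)) a m.
  by elim: k => //= k ->.
rewrite iter_add3_eWU iter_add3_eZU (iter_comm (@eZWU V) n n T2) e1 e2 hy.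
have -> : (fun a b m => iter n (@shiftB V) (vcomm S x c (pr b y v)) a m) = @zero3 V.
  by do 3!apply: funext => ?; rewrite hx.
have -> : (fun a (_ _ : int) => pr a x 0) = @zero3 V.
  by do 3!apply: funext => ?; rewrite vprod0r.
by rewrite iter_eZU0 iter_eWU0; do 3!apply: funext => ?; exact: addr0.
Qed.

Lemma triple_trunc x y c v : truncT (triple x y c v).
Proof.
move=> m; have [B hB] := vprod_trunc S y (pr m c v).
have [B' hB'] := vprod_trunc S y v.
exists (maxn B B') => a b hb; rewrite /triple hB ?hB' ?vprod0r ?subr0 //; lia.
Qed.

Definition jac_bracket x y c v p q r m :=
  jac S x y p q r (pr m c v) - pr m c (jac S x y p q r v).

Lemma jac_bracketE x y c v :
  jac_bracket x y c v = sub4 (expandT (triple x y c v)) (expandTop (triple y x c v)).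
Proof.
apply: funext => p; apply: funext => q; apply: funext => r; apply: funext => m.
rewrite /jac_bracket /sub4 /expandT /expandTop /jac.
have [B hB] := vprod_trunc S y v; have [B' hB'] := vprod_trunc S x v.
have [C hC] := vprod_trunc S y (pr m c v); have [C' hC'] := vprod_trunc S x (pr m c v).
rewrite vprodBr vprodMzr.
have tr (s t : V) B0 : (forall b : int, B0%:Z <= b -> pr b t s = 0) -> forall w,
    vtrunc B0 (fun a b => pr a w (pr b t s)).
  by move=> h w a b hb; rewrite h ?vprod0r.
have trm (s t : V) B0 : (forall b : int, B0%:Z <= b -> pr b t s = 0) -> forall w,
    vtrunc B0 (fun a b => pr m c (pr a w (pr b t s))).
  by move=> h w a b hb; rewrite h ?vprod0r.
rewrite (vexpand_raddf (pr m c) _ _ _ (tr _ _ _ hB x)).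
rewrite (vexpand_raddf (pr m c) _ _ _ (tr _ _ _ hB' y)).
rewrite subrACA -mulrzBl.
rewrite -(vexpandB2 _ _ _ (tr _ _ _ hC x) (trm _ _ _ hB x)).
by rewrite -(vexpandB2 _ _ _ (tr _ _ _ hC' y) (trm _ _ _ hB' y)).
Qed.

(** At p = 0 the expression [jac] is the r-th product of the fields Y(x) and Y(y); the lemma makes
    it local with Y(c). The exponent comes from [dong_kill] at a = 0 and s = r. *)
Lemma dong x y c r : exists M, forall v n q m, (M <= n)%N ->
  iter n (@shiftB V) (fun q m => jac_bracket x y c v 0 q r m) q m = 0.
Proof.
have [N1 h1] := locality_ge x c; have [N2 h2] := locality_ge y c.
have [N3 h3] := jac_eq0 S x y.
pose N := maxn N1 N2.
exists (N + (N + absz (N3%:Z - r)%R))%N => v n q m hn.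
rewrite (iter_shiftB_ge hn) // {q m n hn}.
do 2!apply: funext => ?; rewrite -shiftB_dWU.
apply: (@dong_kill _ (jac_bracket x y c v) N N3 _ _ _ _ 0 r) => //.
- by move=> p q r' m; rewrite /jac_bracket !jac_rec vprodBr subrACA.
- by move=> p q r' m h; rewrite /jac_bracket !h3 // vprod0r subr0.
- rewrite jac_bracketE iter_sub4_dWU iter_sub4_dZU expandT_kill ?expandTop_kill.
  + by do 4!apply: funext => ?; exact: subr0.
  + exact: triple_trunc.
  + by apply: triple_kill => t; [apply: h2|apply: h1]; rewrite /N; lia.
  + exact: triple_trunc.
  + by apply: triple_kill => t; [apply: h1|apply: h2]; rewrite /N; lia.
- lia.
Qed.

Hypothesis hA : natinv A.

Definition assoc_defect x y r q t := jac S x y 0 q r t - pr q (pr r x y) t.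

Lemma vprod_vacr_int (s : int) x : 0 <= s -> pr s x (vac S) = 0.
Proof. by case: s => // s _; exact: vprod_vacr_ge0. Qed.

(** The defect D_q on the vacuum is 0 for q >= 0 and for q = -1, and translation gives [vder] D_q =
    - q D_(q-1). The remaining modes vanish by dividing by positive integers. *)
Lemma assoc_defect_vac x y r q : assoc_defect x y r q (vac S) = 0.
Proof.
pose F a b := pr a x (pr b y (vac S)).
have tF : vtrunc 0 F by move=> a b hb; rewrite /F vprod_vacr_int ?vprod0r.
have e0 q' : assoc_defect x y r q' (vac S) = vexpand r F 0 q' - pr q' (pr r x y) (vac S).
  rewrite /assoc_defect /jac -/F [X in _ - X *~ _ - _](_ : _ = 0) ?mul0rz ?subr0 //.
  by apply: vsum0 => i; rewrite vprod_vacr_int ?vprod0r ?mul0rz //; lia.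
have hge q' : 0 <= q' -> assoc_defect x y r q' (vac S) = 0.
  move=> hq; rewrite e0 vprod_vacr_int // subr0; apply: vsum0 => i.
  by rewrite /F vprod_vacr_int ?vprod0r ?mul0rz //; lia.
have der q' : vder S (assoc_defect x y r q' (vac S))
    = - (assoc_defect x y r (q' - 1) (vac S) *~ q').
  rewrite !e0 mulrzBl opprB raddfB /= [RHS]addrC; congr (_ + _); last first.
    by rewrite vder_prodE vder_vac vprod0r sub0r opprK.
  pose N := (`|q'| + `|q' - 1|)%N.
  rewrite (@vexpand_sum _ 0 _ _ _ _ N.+1) //; last by rewrite /N; lia.
  rewrite [in RHS](@vexpand_sum _ 0 _ _ _ _ N.+1) //; last by rewrite /N; lia.
  pose G j := F (0 + r - j%:Z) (q' - 1 + j%:Z).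
  pose c j : int := (-1) ^+ j * binz r j.
  have tG j : (N < j)%N -> G j = 0 by move=> hj; rewrite /G tF //; lia.
  rewrite raddf_sum.
  (* Differentiation lowers either exponent. By [binz_absorb], the terms lowering that of z cancel
     the summand i in q' + i, which leaves the constant factor q'. *)
  have hi (i : nat) : vder S (F (0 + r - i%:Z) (q' + i%:Z) *~ ((-1) ^+ i * binz r i))
     = - (G i *~ (c i * (q' + i%:Z))) + G i.+1 *~ (i.+1%:Z * c i.+1).
    rewrite raddfMz /= vder_prodE vder_prodE vder_vac vprod0r sub0r raddfN /= vprodMzr.
    have -> : pr (0 + r - i%:Z) x (pr (q' + i%:Z - 1) y (vac S)) = G i.
      by congr (pr _ _ (pr _ _ _)); ring.
    have -> : pr (0 + r - i%:Z - 1) x (pr (q' + i%:Z) y (vac S)) = G i.+1.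
      by congr (pr _ _ (pr _ _ _)); lia.
    rewrite mulrzBl mulNrz -!mulrzA; congr (_ + _).
      by congr (- (_ *~ _)); rewrite /c; ring.
    rewrite -mulrNz; congr (_ *~ _); rewrite /c exprS.
    transitivity (- ((-1) ^+ i * ((r - i%:Z) * binz r i))); first by ring.
    by rewrite -binz_absorb; ring.
  rewrite (eq_bigr _ (fun (i : 'I_N.+1) _ => hi i)) big_split /=.
  (* Index shift: the new term at 0 carries the factor 0, and the last one is cut off by [tG]. *)
  have -> : \sum_(i < N.+1) G i.+1 *~ (i.+1%:Z * c i.+1) = \sum_(i < N.+1) G i *~ (i%:Z * c i).
    transitivity (\sum_(i < N.+2) G i *~ (i%:Z * c i)).
      by rewrite [RHS]big_ord_recl mul0r mulr0z add0r.
    by rewrite big_ord_recr /= tG // mul0rz addr0.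
  rewrite -big_split mulrz_suml -sumrN; apply: eq_bigr => i _ /=.
  rewrite -mulrzA -!mulrNz -mulrzDr; congr (_ *~ _); rewrite /c; ring.
have [hq|hq] := lerP 0 q; first exact: hge.
have -> : q = -1 - (absz (-1 - q)%R)%:Z by lia.
elim: absz => [|k IH].
  rewrite subr0 e0 vprod_vacr (@vexpand_sum _ 0 _ _ _ _ 1) // big_ord1 /=.
  rewrite binz0 !mulr1 mulr1z /F.
  have -> : 0 + r - Posz 0 = r by lia.
  have -> : -1 + Posz 0 = -1 by lia.
  by rewrite vprod_vacr subrr.
have := der (-1 - k%:Z); rewrite IH raddf0.
have -> : -1 - k%:Z - 1 = -1 - k.+1%:Z by lia.
have -> : -1 - k%:Z = - k.+1%:Z by lia.
rewrite mulrNz opprK => /esym h.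
exact: natinv_mulrn_eq0 hA h.
Qed.

(* Goddard's uniqueness argument: the two sides are modes of fields local with Y(t) that
   agree on the vacuum, and t is the (-1)-mode of Y(t) applied to the vacuum. *)
Lemma vprod_assoc x y r q t : jac S x y 0 q r t = pr q (pr r x y) t.
Proof.
apply: subr0_eq; rewrite -/(assoc_defect x y r q t).
have [M1 h1] := dong x y t r; have [M2 h2] := locality_ge (pr r x y) t.
pose M := maxn M1 M2.
pose f q m := assoc_defect x y r q (pr m t (vac S)).
have hf : iter M (@shiftB V) f = (fun _ _ => 0).
  pose f1 := fun q m => jac_bracket x y t (vac S) 0 q r m.
  have -> : f = fun q m => f1 q m - vcomm S (pr r x y) t (vac S) q m.
    apply: funext => q'; apply: funext => m'.
    rewrite /f /f1 /jac_bracket /vcomm subrACA -/(assoc_defect _ _ _ _ _).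
    by rewrite -vprodBr -/(assoc_defect _ _ _ _ _) assoc_defect_vac vprod0r subr0.
  rewrite iter_shiftB_sub h2 ?leq_maxr //.
  by do 2!apply: funext => ?; rewrite h1 ?leq_maxl // subr0.
have f0 q' m : 0 <= m -> f q' m = 0.
  move=> hm; rewrite /f vprod_vacr_int // /assoc_defect vprod0r subr0 /jac.
  by rewrite !vexpand_eq0 ?mul0rz ?subr0 // => a b; rewrite !vprod0r.
have fk k q' m : 0 <= m -> iter k (@shiftB V) f q' m = 0.
  elim: k q' m => [|k IH] q' m hm; first exact: f0.
  by rewrite iterS /shiftB !IH ?subrr //; lia.
(* At u-exponent -1 only the w-term of each factor w - u survives, because the other one has
   u-exponent 0, where [fk] applies. *)
have f1 k q' : iter k (@shiftB V) f q' (-1) = f (q' + k%:Z) (-1).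
  elim: k q' => [|k IH] q'; first by rewrite addr0.
  by rewrite iterS /shiftB IH fk // subr0; congr f; lia.
have := f1 M (q - M%:Z); rewrite hf subrK /f vprod_vacr => <-.
by [].
Qed.

(** The third side of the Borcherds identity: z^p = (w + (z-w))^p expanded in |w| > |z-w|. *)
Definition jac_lhs x y p q r t :=
  vsum (fun i => pr (p + q - i%:Z) (pr (r + i%:Z) x y) t *~ binz p i).

Lemma jac_lhs_rec x y p q r t :
  jac_lhs x y p q (r + 1) t = jac_lhs x y (p + 1) q r t - jac_lhs x y p (q + 1) r t.
Proof.
have [B hB] := vprod_trunc S x y; pose N := (`|r| + B)%N.
have h0 i : (N <= i)%N -> pr (r + i%:Z) x y = 0 by move=> hi; apply: hB; lia.
rewrite /jac_lhs (@vsumE _ N) => [|i hi]; last first.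
  have -> : r + 1 + i%:Z = r + i.+1%:Z by lia.
  by rewrite h0 ?vprod0l ?mul0rz // ltnW.
rewrite (@vsumE _ N.+1) => [|i hi]; last by rewrite h0 ?vprod0l ?mul0rz // ltnW.
rewrite (@vsumE _ N.+1) => [|i hi]; last by rewrite h0 ?vprod0l ?mul0rz // ltnW.
rewrite -sumrB big_ord_recl !binz0.
have -> : p + 1 + q = p + (q + 1) by ring.
rewrite subrr add0r; apply: eq_bigr => i _.
rewrite !lift0 -mulrzBr binzS [binz p i.+1 + _]addrC addrK.
by congr (pr _ (pr _ _ _) _ *~ _); lia.
Qed.

(* Both sides satisfy the same recurrence (z-w) f = z f - w f, so the case p = 0
   gives the case p >= 0, and locality gives the case p < 0. *)
Lemma borcherds x y p q r t : jac S x y p q r t = jac_lhs x y p q r t.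
Proof.
pose P p := forall q r, jac S x y p q r t = jac_lhs x y p q r t.
have P0 : P 0.
  move=> q' r'; rewrite vprod_assoc /jac_lhs (@vsumE _ 1) ?big_ord1 /=.
    by rewrite subr0 add0r addr0.
  by case=> // i _; rewrite ?binz0S ?bin0n.
have Ppos (k : nat) : P k%:Z.
  elim: k => // k IH q' r'.
  have := jac_lhs_rec x y k q' r' t; have := jac_rec S x y k q' r' t.
  rewrite !IH => -> /addIr; rewrite -PoszD addn1.
  by move=> ->.
have [B hB] := vprod_trunc S x y; have [B' hB'] := jac_eq0 S x y.
pose N := maxn B B'.
have hN p' q' r' : N%:Z <= r' -> jac S x y p' q' r' t = jac_lhs x y p' q' r' t.
  move=> hr; rewrite hB'; last by lia.
  by apply/esym/vsum0 => i; rewrite hB ?vprod0l ?mul0rz //; lia.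
have Pneg (k : nat) : P (- k%:Z).
  elim: k => // k IH q' r'.
  suff H (d : nat) : forall r'' q'', N%:Z - d%:Z <= r'' ->
      jac S x y (- k.+1%:Z) q'' r'' t = jac_lhs x y (- k.+1%:Z) q'' r'' t.
    by apply: (H (absz (N%:Z - r')%R)); lia.
  elim: d => [|d IHd] r'' q'' hd; first by apply: hN; lia.
  have := jac_lhs_rec x y (- k.+1%:Z) (q'' - 1) r'' t.
  have := jac_rec S x y (- k.+1%:Z) (q'' - 1) r'' t.
  have -> : - k.+1%:Z + 1 = - k%:Z by lia.
  rewrite IH (IHd (r'' + 1)); last by lia.
  by rewrite subrK => -> /addrI /oppr_inj.
by case: p => [k|k]; [exact: Ppos|rewrite NegzE; exact: Pneg].
Qed.

End Associativity.

(** * Commutator, iterate and derivative formulas *)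

Section Formulas.
Variables (A : comNzRingType) (V : lmodType A) (S : vertex_structure V).
Implicit Types (x y z c t v : V) (p q r s m : int).
Local Notation pr := (vprod S).
Hypothesis hA : natinv A.

Lemma vprod_commutator x y p q t K : (forall i : nat, (K <= i)%N -> pr i%:Z x y = 0) ->
  pr p x (pr q y t) - pr q y (pr p x t)
  = \sum_(i < K) pr (p + q - i%:Z) (pr i%:Z x y) t *~ binz p i.
Proof.
move=> h; have := borcherds S hA x y p q 0 t.
rewrite (jac_comm S x y p q 0 t) /= /vcomm => ->.
rewrite /jac_lhs (@vsumE _ K) => [|i hi]; last by rewrite add0r h ?vprod0l ?mul0rz.
by apply: eq_bigr => i _; rewrite add0r.
Qed.

Lemma vprod_iterate x y s t K :
  (forall i : nat, (K <= i)%N -> pr (s + i%:Z) y t = 0) ->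
  (forall i : nat, (K <= i)%N -> pr i%:Z x t = 0) ->
  pr s (pr (-1) x y) t
  = \sum_(i < K) (pr (-1 - i%:Z) x (pr (s + i%:Z) y t) + pr (s - 1 - i%:Z) y (pr i%:Z x t)).
Proof.
move=> h1 h2; rewrite -(vprod_assoc S hA) /jac.
have sg i : (-1) ^+ i * binz (-1) i = 1.
  by rewrite binzN1 -exprMn mulrNN mulr1 expr1n.
rewrite {1}/vexpand (@vsumE _ K) => [|i hi]; last by rewrite h1 ?vprod0r ?mul0rz.
rewrite {1}/vexpand (@vsumE _ K) => [|i hi]; last by rewrite add0r h2 ?vprod0r ?mul0rz.
rewrite big_split /= /signz /= expr1 mulrN1z opprK; congr (_ + _).
  by apply: eq_bigr => i _; rewrite sg mulr1z add0r.
by apply: eq_bigr => i _; rewrite sg mulr1z add0r.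
Qed.

Lemma vprod_vacl_neq s x : s != -1 -> pr s (vac S) x = 0.
Proof. by rewrite vprod_vacl => /negPf ->. Qed.

Lemma vprod_derl s x y : pr s (vder S x) y = pr (s - 1) x y *~ (- s).
Proof.
rewrite vderE -(vprod_assoc S hA) /jac.
have sg i : (-1) ^+ i * binz (-2) i = i.+1%:Z.
  rewrite -[-2]/(Negz 1) /= mulrA -exprMn mulrNN mulr1 expr1n mul1r.
  by rewrite add1n binSn.
rewrite /vexpand [signz _]/= mulr1z.
case: (leP 0 s) => hs.
- rewrite vsum0 => [|i]; last by rewrite vprod_vacl_neq ?vprod0r ?mul0rz //; lia.
  case: s hs => // -[|k] _.
    rewrite vsum0 => [|i]; last by rewrite vprod_vacl_neq ?mul0rz //; lia.
    by rewrite subr0 oppr0.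
  rewrite sub0r mulrNz; congr (- _).
  rewrite (@vsumE _ k.+1) => [|i hi]; last by rewrite vprod_vacl_neq ?mul0rz //; lia.
  rewrite big_ord_recr /= big1 ?add0r => [|i _]; last first.
    by have := ltn_ord i => hi; rewrite vprod_vacl_neq ?mul0rz //; lia.
  rewrite sg vprod_vacl.
  have -> : (k.+1%:Z - 2 - k%:Z == -1) = true by apply/eqP; lia.
  by congr (pr _ _ _ *~ _); lia.
- rewrite [X in _ - X]vsum0 => [|i]; last by rewrite vprod_vacl_neq ?mul0rz //; lia.
  rewrite subr0.
  have -> : s = -1 - (absz (-1 - s)%R)%:Z by lia.
  move: (absz _) => k.
  rewrite (@vsumE _ k.+1) => [|i hi]; last first.
    by rewrite vprod_vacl_neq ?vprod0r ?mul0rz //; lia.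
  rewrite big_ord_recr /= big1 ?add0r => [|i _]; last first.
    by have := ltn_ord i => hi; rewrite vprod_vacl_neq ?vprod0r ?mul0rz //; lia.
  rewrite sg vprod_vacl.
  have -> : (-1 - k%:Z + k%:Z == -1) = true by apply/eqP; lia.
  by congr (pr _ _ _ *~ _); lia.
Qed.

Lemma vder_leibniz s x y : vder S (pr s x y) = pr s (vder S x) y + pr s x (vder S y).
Proof. by rewrite vder_prodE vprod_derl mulrNz addrC. Qed.

(** The signed falling factorial (-1)^n s (s-1) ... (s-n+1): zero for 0 <= s < n, positive for s <
    0. *)
Fixpoint dcoef (s : int) (n : nat) : int :=
  if n is n'.+1 then - s * dcoef (s - 1) n' else 1.

Lemma vprod_iter_derl n s x y : pr s (iter n (vder S) x) y = pr (s - n%:Z) x y *~ dcoef s n.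
Proof.
elim: n s => [|n IH] s /=; first by rewrite subr0.
rewrite vprod_derl IH -mulrzA mulrC.
by congr (pr _ _ _ *~ _); lia.
Qed.

Lemma dcoef_eq0 n (s : nat) : (s < n)%N -> dcoef s n = 0.
Proof.
elim: n s => // n IH [|s] /= h; first by rewrite mul0r.
by rewrite -addn1 PoszD addrK IH ?mulr0.
Qed.

Lemma dcoef_neg n k : exists e : nat, dcoef (- k.+1%:Z) n = e.+1.
Proof.
elim: n k => [|n IH] k /=; first by exists 0%N.
have -> : - k.+1%:Z - 1 = - k.+2%:Z by lia.
have [e ->] := IH k.+1.
by exists (k + e + k * e)%N; rewrite opprK -PoszM; congr Posz; lia.
Qed.

(** Since n! is invertible, a negative mode of a generator does no more than prepend a letter to a
    word, up to a scalar. *)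
Lemma vprod_neg_scale x y n :
  exists a : A, pr (- n.+1%:Z) x y = a *: pr (-1) (iter n (vder S) x) y.
Proof.
have [e he] := dcoef_neg n 0; have [a ha] := hA e.
exists a; rewrite vprod_iter_derl he -scaler_int scalerA.
rewrite -pmulrn ha scale1r; congr (pr _ _ _); lia.
Qed.

End Formulas.

(** * The filtration by degree *)

(* Derivatives do not contribute to the degree.  The letter 0 has degree 1: it stands for
   0 in [seqU] and for I_1 in [seqT]. *)
Definition degl (k : nat) : nat := maxn k 1.

Definition deg (mu : monomial) : nat := sumn [seq degl a.1 | a <- mu].

Lemma deg_cons a mu : deg (a :: mu) = (degl a.1 + deg mu)%N.
Proof. by []. Qed.

Lemma deg_cat mu nu : deg (mu ++ nu) = (deg mu + deg nu)%N.
Proof. by rewrite /deg map_cat sumn_cat. Qed.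

Lemma degl_gt0 k : (0 < degl k)%N.
Proof. by rewrite /degl leq_max orbT. Qed.

Lemma perm_deg mu nu : perm_eq mu nu -> deg mu = deg nu.
Proof. by move=> h; apply/perm_sumn/perm_map. Qed.

Lemma lex_le_total : total lex_le.
Proof. by move=> [a b] [c d]; rewrite /lex_le /=; lia. Qed.

Lemma lex_le_trans : transitive lex_le.
Proof. by move=> [a b] [c d] [e f]; rewrite /lex_le /=; lia. Qed.

Section Closure.
Variables (A : comNzRingType) (V : lmodType A) (S : vertex_structure V).
Implicit Types (x y z c t v : V) (s : int) (mu nu : monomial).
Local Notation pr := (vprod S).
Hypothesis hA : natinv A.

Variable u : nat -> V.
Local Notation w := (nomon S u).
Local Notation lt a := (iter a.2 (vder S) (u a.1)).

Variable Z : V -> Prop.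

(** Spans are taken modulo an ideal [Z]: the zero ideal in a single algebra, the eventually zero
    sequences in families indexed by the rank. *)
Definition vertex_ideal :=
  [/\ Z 0, forall a x y, Z x -> Z y -> Z (a *: x + y),
      forall s x y, Z x -> Z (pr s x y) & forall s x y, Z y -> Z (pr s x y)].

Hypothesis hZ : vertex_ideal.

Inductive spn (Q : monomial -> Prop) : V -> Prop :=
  | spn_ideal x of Z x : spn Q x
  | spn_lin a x y of spn Q x & spn Q y : spn Q (a *: x + y)
  | spn_word mu of Q mu : spn Q (w mu).

Lemma spn0 Q : spn Q 0.
Proof. by apply: spn_ideal; case: hZ. Qed.

Lemma spnZ Q a x : spn Q x -> spn Q (a *: x).
Proof. by move=> h; rewrite -[_ *: _]addr0; apply: spn_lin => //; exact: spn0. Qed.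

Lemma spnD Q x y : spn Q x -> spn Q y -> spn Q (x + y).
Proof. by move=> hx hy; rewrite -[x]scale1r; exact: spn_lin. Qed.

Lemma spnMz Q x n : spn Q x -> spn Q (x *~ n).
Proof. by move=> h; rewrite -scaler_int; exact: spnZ. Qed.

Lemma spn_sum Q (I : eqType) (r : seq I) (F : I -> V) :
  (forall i, i \in r -> spn Q (F i)) -> spn Q (\sum_(i <- r) F i).
Proof.
elim: r => [|i r IH] h; first by rewrite big_nil; exact: spn0.
rewrite big_cons; apply: spnD; first by apply: h; rewrite mem_head.
by apply: IH => j hj; apply: h; rewrite inE hj orbT.
Qed.

Lemma spn_sum_ord Q n (F : 'I_n -> V) :
  (forall i, spn Q (F i)) -> spn Q (\sum_(i < n) F i).
Proof. by move=> h; apply: big_ind => // [|x y]; [exact: spn0|exact: spnD]. Qed.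

Lemma spn_mono (Q Q' : monomial -> Prop) x : (forall mu, Q mu -> Q' mu) -> spn Q x -> spn Q' x.
Proof.
move=> h; elim=> [y hy|a y y' _ hy _ hy'|mu hmu]; first exact: spn_ideal.
  exact: spn_lin.
by apply: spn_word; exact: h.
Qed.

Lemma spn_map (Q Q' : monomial -> Prop) (f : {linear V -> V}) x :
  (forall y, Z y -> spn Q' (f y)) -> (forall mu, Q mu -> spn Q' (f (w mu))) ->
  spn Q x -> spn Q' (f x).
Proof.
move=> h0 h1; elim=> [y hy|a y y' _ hy _ hy'|mu hmu]; [exact: h0| |exact: h1].
by rewrite linearP; exact: spn_lin.
Qed.

Lemma spn_prod (Q1 Q2 Q : monomial -> Prop) s x y :
  (forall mu nu, Q1 mu -> Q2 nu -> spn Q (pr s (w mu) (w nu))) ->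
  spn Q1 x -> spn Q2 y -> spn Q (pr s x y).
Proof.
case: hZ => _ _ hl hr h hx hy.
apply: (@spn_map Q1 _ (vprodl S s y)) hx => [z hz|mu hmu].
  by apply: spn_ideal; exact: hl.
apply: (@spn_map Q2 _ (pr s (w mu))) hy => [z hz|nu hnu].
  by apply: spn_ideal; exact: hr.
exact: h.
Qed.

(** The strict inequality makes [fil 0] the ideal itself. It also accounts for the predecessors in
    the product rules: degrees < a and < b have sum < a + b - 1. *)
Definition fil (p : nat) := spn (fun mu => (deg mu < p)%N).

Lemma fil_mono p q x : (p <= q)%N -> fil p x -> fil q x.
Proof. by move=> le; apply: spn_mono => mu h; exact: leq_trans le. Qed.

Lemma fil_word mu : fil (deg mu).+1 (w mu).
Proof. exact: spn_word. Qed.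

Lemma fil_neg p k m s y : s < 0 -> fil p y -> fil (degl k + p) (pr s (iter m (vder S) (u k)) y).
Proof.
case: hZ => _ _ _ hr hs; rewrite vprod_iter_derl //.
have -> : s - m%:Z = - (absz (s + 1 - m%:Z)%R).+1%:Z by lia.
have [a ->] := vprod_neg_scale S hA (u k) y (absz (s + 1 - m%:Z)%R).
move=> hy; apply/spnMz/spnZ.
apply: spn_map hy => [z hz|mu hmu]; first by apply: spn_ideal; exact: hr.
apply: (@spn_word _ ((k, absz (s + 1 - m%:Z)%R) :: mu)).
by rewrite deg_cons /= ltn_add2l.
Qed.

Lemma ideal_der x : Z x -> Z (vder S x).
Proof. by case: hZ => _ _ hl _ h; rewrite vderE; exact: hl. Qed.

Lemma fil_der_word mu : fil (deg mu).+1 (vder S (w mu)).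
Proof.
elim: mu => [|[k m] mu IH] /=; first by rewrite vder_vac; exact: spn0.
rewrite vder_leibniz //; apply: spnD.
  exact: (@spn_word _ ((k, m.+1) :: mu)).
by rewrite deg_cons -addnS; exact: fil_neg.
Qed.

Lemma fil_der p x : fil p x -> fil p (vder S x).
Proof.
apply: spn_map => [y hy|mu hmu]; first by apply: spn_ideal; exact: ideal_der.
by apply: fil_mono (fil_der_word mu).
Qed.

(* Everything is bounded by [d] because the operator product expansions of the U_k are
   themselves established by induction on the degree. *)
Variable d : nat.
Hypothesis hope : forall k l (s : nat), (degl k + degl l <= d)%N ->
  fil (degl k + degl l) (pr s (u k) (u l)).

Lemma fil_ope_der k l m (s : nat) : (degl k + degl l <= d)%N ->
  fil (degl k + degl l) (pr s (u k) (iter m (vder S) (u l))).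
Proof.
move=> h; elim: m s => [|m IH] s /=; first exact: hope.
have -> : pr s (u k) (vder S (iter m (vder S) (u l)))
    = vder S (pr s (u k) (iter m (vder S) (u l)))
      + pr (s%:Z - 1) (u k) (iter m (vder S) (u l)) *~ s%:Z.
  by rewrite vder_prodE subrK.
apply: spnD; first exact: fil_der.
case: s => [|s]; first by rewrite mulr0z; exact: spn0.
have -> : s.+1%:Z - 1 = s by lia.
by apply: spnMz; exact: IH.
Qed.

Lemma fil_ope_letter (a b : nat * nat) (s : nat) : (degl a.1 + degl b.1 <= d)%N ->
  fil (degl a.1 + degl b.1) (pr s (lt a) (lt b)).
Proof.
move=> h; rewrite vprod_iter_derl //.
case: (ltnP s a.2) => hs; first by rewrite dcoef_eq0 // mulr0z; exact: spn0.
have -> : s%:Z - a.2%:Z = (s - a.2)%N%:Z by lia.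
by apply: spnMz; exact: fil_ope_der.
Qed.

(** The two claims proved together by strong induction on the total degree: no product raises it,
    and a product of non-negative index lowers it. *)
Let good p := forall mu nu s, (deg mu + deg nu = p)%N ->
  fil p.+1 (pr s (w mu) (w nu)) /\ (0 <= s -> fil p (pr s (w mu) (w nu))).

Let good_fil p a b x y s : (forall p', (p' < p)%N -> good p') -> (a + b <= p.+1)%N ->
  fil a x -> fil b y -> fil (a + b).-1 (pr s x y).
Proof.
move=> IH le; apply: spn_prod => mu nu hmu hnu.
have [h _] := IH (deg mu + deg nu)%N ltac:(lia) mu nu s erefl.
by apply: fil_mono h; lia.
Qed.

(** The letter is commuted through the word to the vacuum. Each commutator replaces two letters by
    an element of smaller degree, so its product with the rest of the word is covered by the
    induction hypothesis. *)
Let good_letter p a nu (s : nat) : (forall p', (p' < p)%N -> good p') -> (p <= d)%N ->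
  (degl a.1 + deg nu <= p)%N -> fil (degl a.1 + deg nu) (pr s (lt a) (w nu)).
Proof.
move=> IH hd; rewrite vprod_iter_derl //.
case: (ltnP s a.2) => hs; first by rewrite dcoef_eq0 // mulr0z => _; exact: spn0.
have -> : s%:Z - a.2%:Z = (s - a.2)%N%:Z by lia.
move=> h; apply: spnMz; move: (s - a.2)%N {hs} => {}s; move: a.1 h => k {a}.
elim: nu s => [|[l m] nu IHnu] s h /=.
  by rewrite vprod_vacr_ge0; exact: spn0.
set b := iter m _ _.
have [B hB] := vprod_trunc S (u k) b.
have {}hB (i : nat) : (B <= i)%N -> pr i (u k) b = 0 by move=> hi; apply: hB.
rewrite deg_cons /= in h *.
have -> : pr s (u k) (pr (-1) b (w nu)) = pr (-1) b (pr s (u k) (w nu)) +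
    \sum_(i < B) pr (s%:Z + -1 - i%:Z) (pr i%:Z (u k) b) (w nu) *~ binz s i.
  by rewrite -(vprod_commutator hA s (-1) (w nu) hB) addrC subrK.
apply: spnD.
  apply: (@fil_mono (degl l + (degl k + deg nu))); first by lia.
  by apply: fil_neg => //; apply: IHnu; lia.
apply: spn_sum_ord => i; apply: spnMz.
apply: (@fil_mono ((degl k + degl l) + (deg nu).+1).-1); first by lia.
apply: (@good_fil p) => //; [lia| |exact: fil_word].
by apply: fil_ope_der; lia.
Qed.

Lemma vprod_trunc2 x y y' t s : exists K : nat,
  (forall i : nat, (K <= i)%N -> pr (s + i%:Z) y t = 0) /\
  (forall i : nat, (K <= i)%N -> pr i%:Z x y' = 0).
Proof.
have [B hB] := vprod_trunc S y t; have [B' hB'] := vprod_trunc S x y'.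
exists (`|s| + B + B')%N; split=> i hi; [apply: hB|apply: hB']; lia.
Qed.

(** The iterate formula peels off the first letter [a]. Either [a] is prepended to a product of
    smaller total degree, or a non-negative mode of [a] first lowers the degree of the right
    factor. *)
Let all_good p : (p <= d)%N -> good p.
Proof.
elim/ltn_ind: p => p IH0 hd.
have {}IH p' : (p' < p)%N -> good p' by move=> h; apply: IH0 => //; lia.
move=> mu nu s; case: mu => [|a mu] /=.
  move=> h; have {}h : deg nu = p by rewrite -h.
  rewrite vprod_vacl; case: eqP => hs; last by split=> *; exact: spn0.
  by split=> [|hs0]; [rewrite -h; exact: fil_word|lia].
rewrite deg_cons => hp; have da := degl_gt0 a.1.
have [K [hK1 hK2]] := vprod_trunc2 (lt a) (w mu) (w nu) (w nu) s.
rewrite (vprod_iterate hA hK1 hK2).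
have T2 (i : nat) s' : fil p (pr s' (w mu) (pr i%:Z (lt a) (w nu))).
  apply: (@fil_mono ((deg mu).+1 + (degl a.1 + deg nu)).-1); first by lia.
  apply: (@good_fil p) => //; [lia|exact: fil_word|].
  by apply: (@good_letter p) => //; lia.
have [p' hp'] : exists p', (deg mu + deg nu = p')%N by exists (deg mu + deg nu)%N.
have T1 (i : nat) : fil p.+1 (pr (-1 - i%:Z) (lt a) (pr (s + i%:Z) (w mu) (w nu))).
  have -> : p.+1 = (degl a.1 + p'.+1)%N by lia.
  by apply: fil_neg; [lia|have [] := IH p' ltac:(lia) mu nu (s + i%:Z) hp'].
split=> [|hs]; apply: spn_sum_ord => i; apply: spnD.
- exact: T1.
- exact: (fil_mono (leqnSn p) (T2 _ _)).
- have -> : p = (degl a.1 + p')%N by lia.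
  apply: fil_neg; first by lia.
  by have [_] := IH p' ltac:(lia) mu nu (s + i%:Z) hp'; apply; lia.
- exact: T2.
Qed.

Lemma fil_prod a b x y s : (a + b <= d.+2)%N ->
  fil a x -> fil b y -> fil (a + b).-1 (pr s x y).
Proof.
move=> le; apply: spn_prod => mu nu hmu hnu.
have [h _] := @all_good (deg mu + deg nu)%N ltac:(lia) mu nu s erefl.
by apply: fil_mono h; lia.
Qed.

Lemma fil_prod_ge0 a b x y (s : nat) : (a + b <= d.+2)%N ->
  fil a x -> fil b y -> fil (a + b).-2 (pr s x y).
Proof.
move=> le; apply: spn_prod => mu nu hmu hnu.
have [_ h] := @all_good (deg mu + deg nu)%N ltac:(lia) mu nu s erefl.
by apply: fil_mono (h _); lia.
Qed.

Lemma fil_letter a p (s : nat) y : (degl a.1 + p <= d.+1)%N -> fil p y ->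
  fil (degl a.1 + p).-1 (pr s (lt a) y).
Proof.
move=> h hy; have -> : (degl a.1 + p).-1 = ((degl a.1).+1 + p).-2 by lia.
apply: fil_prod_ge0 => //; rewrite -[lt a](vprod_vacr S).
by have := fil_word [:: a]; rewrite deg_cons addn0.
Qed.

Lemma fil_cat mu nu : (deg mu + deg nu <= d)%N ->
  fil (deg mu + deg nu) (pr (-1) (w mu) (w nu) - w (mu ++ nu)).
Proof.
elim: mu => [|a mu IH] h /=.
  by rewrite vprod_vacl eqxx subrr; exact: spn0.
rewrite deg_cons in h *; have da := degl_gt0 a.1.
have [K [hK1 hK2]] := vprod_trunc2 (lt a) (w mu) (w nu) (w nu) (-1).
(* With [K.+1] the term i = 0 is present; it contains the concatenation. All other terms involve a
   product of non-negative index and have lower degree. *)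
rewrite (@vprod_iterate _ _ _ hA _ _ _ _ K.+1); last 2 first.
- by move=> i hi; apply: hK1; lia.
- by move=> i hi; apply: hK2; lia.
have T2 (i : nat) s' : fil (degl a.1 + deg mu + deg nu) (pr s' (w mu) (pr i%:Z (lt a) (w nu))).
  apply: (@fil_mono ((deg mu).+1 + (degl a.1 + (deg nu).+1).-1).-1); first by lia.
  apply: fil_prod; [lia|exact: fil_word|].
  by apply: fil_letter; [lia|exact: fil_word].
rewrite big_ord_recl subr0 addr0 [X in X + _ - _]addrC -addrA -addrA.
apply: spnD; first exact: T2.
rewrite addrC -addrA; apply: spnD; last first.
  rewrite addrC -vprodBr -addnA; apply: fil_neg => //; apply: IH; lia.
apply: spn_sum_ord => i; rewrite lift0; apply: spnD; last exact: T2.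
rewrite -addnA; apply: fil_neg; first by lia.
have -> : -1 + i.+1%:Z = i by lia.
apply: (@fil_mono ((deg mu).+1 + (deg nu).+1).-2); first by lia.
by apply: fil_prod_ge0; [lia|exact: fil_word|exact: fil_word].
Qed.

Lemma fil_swap a b nu : (deg (a :: b :: nu) <= d)%N ->
  fil (deg (a :: b :: nu)) (w (a :: b :: nu) - w (b :: a :: nu)).
Proof.
rewrite !deg_cons /= => h.
have [B hB] := vprod_trunc S (lt a) (lt b).
rewrite (@vprod_commutator _ _ S hA _ _ _ _ _ B) => [|i hi]; last by apply: hB; lia.
apply: spn_sum_ord => i; apply: spnMz.
apply: (@fil_mono ((degl a.1 + degl b.1) + (deg nu).+1).-1); first by lia.
apply: fil_prod; [lia| |exact: fil_word].
by apply: fil_ope_letter; lia.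
Qed.

Lemma fil_perm mu nu : perm_eq mu nu -> (deg mu <= d)%N -> fil (deg mu) (w mu - w nu).
Proof.
have move_front a n1 n2 : (deg (a :: n1 ++ n2) <= d)%N ->
    fil (deg (a :: n1 ++ n2)) (w (a :: n1 ++ n2) - w (n1 ++ a :: n2)).
  elim: n1 => [|b n1 IH] h; first by rewrite subrr; exact: spn0.
  have -> : w (a :: (b :: n1) ++ n2) - w ((b :: n1) ++ a :: n2) =
     (w (a :: b :: n1 ++ n2) - w (b :: a :: n1 ++ n2))
     + pr (-1) (lt b) (w (a :: n1 ++ n2) - w (n1 ++ a :: n2)).
    by rewrite vprodBr addrA subrK.
  apply: spnD; first exact: fil_swap.
  apply: (@fil_mono (degl b.1 + deg (a :: n1 ++ n2))); first by rewrite cat_cons !deg_cons; lia.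
  by apply: fil_neg => //; apply: IH; move: h; rewrite cat_cons !deg_cons; lia.
elim: mu nu => [|a mu IH] nu.
  by move=> /perm_size; case: nu => // _ _; rewrite subrr; exact: spn0.
move=> hp; have /splitPr hin : a \in nu by rewrite -(perm_mem hp) mem_head.
case: hin hp => n1 n2 hp h.
have hp' : perm_eq mu (n1 ++ n2).
  by rewrite -(perm_cons a) (perm_trans hp) // perm_catC /= perm_cons perm_catC.
have -> : w (a :: mu) - w (n1 ++ a :: n2) =
  pr (-1) (lt a) (w mu - w (n1 ++ n2)) + (w (a :: n1 ++ n2) - w (n1 ++ a :: n2)).
  by rewrite vprodBr addrA subrK.
have e : deg (a :: mu) = deg (a :: n1 ++ n2) by rewrite !deg_cons (perm_deg hp').
apply: spnD; last by rewrite e; apply: move_front; rewrite -e.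
by apply: fil_neg => //; apply: IH => //; move: h; rewrite deg_cons; lia.
Qed.

Lemma ideal_word mu a : a \in mu -> Z (u a.1) -> Z (w mu).
Proof.
case: hZ => _ _ hl hr.
elim: mu => //= b mu IH; rewrite inE => /orP[/eqP <- h|h h']; last by apply: hr; exact: IH.
by apply: hl; elim: (a.2) => //= m; exact: ideal_der.
Qed.

Definition reduced mu := sorted lex_le mu /\ forall a, a \in mu -> ~ Z (u a.1).

(** Sorting a word changes it by terms of lower degree, to which the induction on p applies. *)
Lemma fil_reduced p x : (p <= d.+1)%N -> fil p x ->
  spn (fun mu => (deg mu < p)%N /\ reduced mu) x.
Proof.
elim: p x => [|p IH] x h; first by apply: spn_mono.
elim=> [y hy|a y y' _ hy _ hy'|mu hmu]; first exact: spn_ideal.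
  exact: spn_lin.
have hs : perm_eq (sort lex_le mu) mu by exact/permPl/perm_sort.
rewrite -[w mu](subrK (w (sort lex_le mu))); apply: spnD.
  apply: (@spn_mono (fun mu => (deg mu < p)%N /\ reduced mu)) => [nu [h1 h2]|].
    by split=> //; exact: ltnW.
  apply: IH; first by lia.
  apply: (@fil_mono (deg mu)); first by [].
  by apply: fil_perm; [rewrite perm_sym|lia].
case: (pselect (exists2 a, a \in sort lex_le mu & Z (u a.1))) => [[a ha hz]|hn].
  by apply: spn_ideal; exact: ideal_word ha hz.
apply: spn_word; split; first by rewrite (perm_deg hs).
split=> [|a ha hz]; first exact: (sort_sorted lex_le_total).
by apply: hn; exists a.
Qed.

End Closure.

Section Lincomb.
Variables (A : comNzRingType) (V : lmodType A).
Local Notation M := {malg A[seq (nat * nat)]}.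
Implicit Types (c : M) (e : monomial -> V) (P : pred monomial).

Lemma lincombEw e c (D : {fset seq (nat * nat)}) : (msupp c `<=` D)%fset ->
  lincomb e c = \sum_(mu <- D) c@_mu *: e mu.
Proof.
move=> h; apply: (big_fset_incl _ h) => mu _ /mcoeff_outdom ->.
by rewrite scale0r.
Qed.

Lemma lincomb_linear e : linear (lincomb e).
Proof.
move=> a c c'; pose D := (msupp c `|` msupp c')%fset.
rewrite (@lincombEw e _ D); last first.
  apply: fsubset_trans (msuppD_le _ _) _; apply: fsetUSS => //.
  exact: msuppZ_le.
rewrite (@lincombEw e c D) ?fsubsetUl // (@lincombEw e c' D) ?fsubsetUr //.
rewrite scaler_sumr -big_split; apply: eq_bigr => mu _.
by rewrite mcoeffD mcoeffZ scalerDl scalerA.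
Qed.

HB.instance Definition _ e := GRing.isLinear.Build A M V _ (lincomb e) (lincomb_linear e).

Lemma lincombU e (mu : seq (nat * nat)) a : lincomb e << a *g mu >> = a *: e mu.
Proof.
rewrite (@lincombEw e _ [fset mu]%fset) ?msuppU_le // big_seq_fset1.
by rewrite mcoeffUU.
Qed.

Lemma eq_lincomb e e' c : (forall mu, mu \in msupp c -> e mu = e' mu) ->
  lincomb e c = lincomb e' c.
Proof. by move=> h; apply: eq_big_seq => mu hmu; rewrite h. Qed.

Lemma eq_is_basis P e e' : (forall mu, P mu -> e mu = e' mu) ->
  is_basis P e -> is_basis P e'.
Proof.
move=> he hb v; have [c [[hc1 hc2] hc3]] := hb v; exists c; split.
  by split=> //; rewrite hc2; apply: eq_lincomb => mu /hc1 /he.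
move=> c' [hc'1 hc'2]; apply: hc3; split=> //.
by rewrite hc'2; apply: eq_lincomb => mu /hc'1 /he.
Qed.

End Lincomb.

Section Basis.
Variables (A : comNzRingType) (V : lmodType A).
Local Notation M := {malg A[seq (nat * nat)]}.
Implicit Types (c : M).

Variables (P : pred monomial) (e : monomial -> V) (hb : is_basis P e).

Definition bcoord v : M := projT1 (cid (hb v)).

Lemma bcoord_supp v : {subset msupp (bcoord v) <= P}.
Proof. by rewrite /bcoord; case: cid => c [[h _] _] /=. Qed.

Lemma bcoordK v : lincomb e (bcoord v) = v.
Proof. by rewrite /bcoord; case: cid => c [[_ h] _] /=. Qed.

Lemma bcoord_uniq c v : {subset msupp c <= P} -> lincomb e c = v -> bcoord v = c.
Proof.
by move=> h <-; rewrite /bcoord; case: cid => c' [_ h'] /=; apply: h'.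
Qed.

Lemma supp_linear a c c' : {subset msupp c <= P} -> {subset msupp c' <= P} ->
  {subset msupp (a *: c + c') <= P}.
Proof.
move=> h h' mu /(fsubsetP (msuppD_le _ _)); rewrite in_fsetU => /orP[|]; last exact: h'.
by move=> /(fsubsetP (msuppZ_le _ _)); exact: h.
Qed.

Lemma bcoord_linear : linear bcoord.
Proof.
move=> a v v'; apply: bcoord_uniq; first by apply: supp_linear; exact: bcoord_supp.
by rewrite (lincomb_linear e) !bcoordK.
Qed.

HB.instance Definition _ := GRing.isLinear.Build A V M _ bcoord bcoord_linear.

Lemma bcoord_basis mu : P mu -> bcoord (e mu) = << mu >>.
Proof.
move=> h; apply: bcoord_uniq; last by rewrite lincombU scale1r.
by move=> nu /(fsubsetP msuppU_le); rewrite in_fset1 => /eqP ->.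
Qed.

Lemma basis_ind (Q : V -> Prop) :
  Q 0 -> (forall a mu y, P mu -> Q y -> Q (a *: e mu + y)) -> forall v, Q v.
Proof.
move=> h0 h1 v; rewrite -(bcoordK v) /lincomb.
have : forall mu, mu \in enum_fset (msupp (bcoord v)) -> P mu by exact: bcoord_supp.
elim: (enum_fset (msupp (bcoord v))) => [|mu r IH] h.
  by rewrite big_nil.
rewrite big_cons; apply: h1; first by apply: h; rewrite mem_head.
by apply: IH => nu hnu; apply: h; rewrite inE hnu orbT.
Qed.

Variables (V' : lmodType A) (f : monomial -> V').

Definition basis_map v : V' := lincomb f (bcoord v).

Lemma basis_map_linear : linear basis_map.
Proof. by move=> a v v'; rewrite /basis_map bcoord_linear lincomb_linear. Qed.

HB.instance Definition _ := GRing.isLinear.Build A V V' _ basis_map basis_map_linear.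

Lemma basis_mapE mu : P mu -> basis_map (e mu) = f mu.
Proof. by move=> h; rewrite /basis_map bcoord_basis // lincombU scale1r. Qed.

Lemma basis_ext (g h : {linear V -> V'}) :
  (forall mu, P mu -> g (e mu) = h (e mu)) -> g =1 h.
Proof.
move=> H; apply: basis_ind => [|a mu y hmu IH]; first by rewrite !raddf0.
by rewrite !linearP H // IH.
Qed.

End Basis.

Lemma ideal0 (A : comNzRingType) (V : lmodType A) (S : vertex_structure V) :
  vertex_ideal S (fun x => x = 0).
Proof.
split=> // [a x y -> ->|s x y ->|s x y ->].
- by rewrite scaler0 addr0.
- exact: vprod0l.
- exact: vprod0r.
Qed.

(** * Product structures, used to hold the graph of a map *)

Section Product.
Variables (A : comNzRingType) (V V' : lmodType A).
Variables (S : vertex_structure V) (S' : vertex_structure V').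

Let X : lmodType A := (V * V')%type.

Definition pair_vac : X := (vac S, vac S').
Definition pair_der (x : X) : X := (vder S x.1, vder S' x.2).
Definition pair_prod s (x y : X) : X := (vprod S s x.1 y.1, vprod S' s x.2 y.2).

Fact pair_der_linear : linear pair_der.
Proof. by move=> a [x x'] [y y']; rewrite /pair_der /= !linearP. Qed.

Fact pair_prod_linearl s y : linear (fun x => pair_prod s x y).
Proof.
by move=> a [x x'] [z z']; rewrite /pair_prod /= !vprodDl !vprodZl.
Qed.

Fact pair_prod_linearr s x : linear (pair_prod s x).
Proof. by move=> a [y y'] [z z']; rewrite /pair_prod /= !linearP. Qed.

Fact pair_prod_field x y : exists N : nat,
  forall s : nat, (N <= s)%N -> pair_prod s x y = 0.
Proof.
have [N h] := vprod_field S x.1 y.1; have [N' h'] := vprod_field S' x.2 y.2.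
exists (maxn N N') => s; rewrite geq_max => /andP[hs hs'].
by rewrite /pair_prod h // h'.
Qed.

Fact pair_prod_vacl s x : pair_prod s pair_vac x = if s == -1 then x else 0.
Proof. by case: x => x x'; rewrite /pair_prod /= !vprod_vacl; case: ifP. Qed.

Fact pair_prod_vacr x : pair_prod (-1) x pair_vac = x.
Proof. by case: x => x x'; rewrite /pair_prod /= !vprod_vacr. Qed.

Fact pair_prod_vacr_ge0 (s : nat) x : pair_prod s x pair_vac = 0.
Proof. by rewrite /pair_prod /= !vprod_vacr_ge0. Qed.

Fact pair_der_vac : pair_der pair_vac = 0.
Proof. by rewrite /pair_der /= !vder_vac. Qed.

Lemma pair_mulrz (x : X) n : x *~ n = (x.1 *~ n, x.2 *~ n).
Proof.
have h (m : nat) : x *+ m = (x.1 *+ m, x.2 *+ m).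
  by elim: m => // m IH; rewrite !mulrS IH.
by case: n => n; rewrite ?NegzE ?mulrNz -?pmulrn h.
Qed.

Fact pair_der_prod s x y :
  pair_der (pair_prod s x y) - pair_prod s x (pair_der y) = pair_prod (s - 1) x y *~ (- s).
Proof. by rewrite pair_mulrz /= -!vder_prod. Qed.

Fact pair_prod_local x y : exists N : nat, forall (p q : int) t,
  \sum_(i < N.+1) ((-1) ^+ i * 'C(N, i)%:R) *:
     (pair_prod (p + N%:Z - i%:Z) x (pair_prod (q + i%:Z) y t)
      - pair_prod (q + i%:Z) y (pair_prod (p + N%:Z - i%:Z) x t)) = 0.
Proof.
have [N h] := locality_ge S x.1 y.1; have [N' h'] := locality_ge S' x.2 y.2.
exists (maxn N N') => p q t; set M := maxn N N'.
have e1 := iter_vcomm S M x.1 y.1 p q t.1.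
have e2 := iter_vcomm S' M x.2 y.2 p q t.2.
rewrite h ?leq_maxl // in e1; rewrite h' ?leq_maxr // in e2.
rewrite [RHS](_ : 0 = (0, 0)) // {1}e1 e2.
elim/big_rec3: _ => // i a b c _ ->.
by rewrite /pair_prod /=.
Qed.

Definition pair_structure : vertex_structure X :=
  @VertexStructure A X pair_vac pair_der pair_prod pair_der_linear
    pair_prod_linearl pair_prod_linearr pair_prod_field pair_prod_vacl
    pair_prod_vacr pair_prod_vacr_ge0 pair_der_vac pair_der_prod pair_prod_local.

Lemma pair_nomon (u : nat -> V) (u' : nat -> V') mu :
  nomon pair_structure (fun k => (u k, u' k)) mu = (nomon S u mu, nomon S' u' mu).
Proof.
elim: mu => //= a mu ->.
have -> m k : iter m pair_der (u k, u' k) = (iter m (vder S) (u k), iter m (vder S') (u' k)).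
  by elim: m => //= m ->.
by [].
Qed.

End Product.

Section Hom.
Variables (A : comNzRingType) (V V' : lmodType A).
Variables (S : vertex_structure V) (S' : vertex_structure V').
Hypothesis hA : natinv A.
Variables (u : nat -> V) (u' : nat -> V') (P : pred monomial).
Hypothesis hb : is_basis P (nomon S u).
Variable f : {linear V -> V'}.
Hypothesis hf : forall mu, P mu -> f (nomon S u mu) = nomon S' u' mu.

Local Notation SS := (pair_structure S S').
Local Notation uu := (fun k => (u k, u' k)).

Hypothesis hP : forall mu, sorted lex_le mu -> (forall a, a \in mu -> uu a.1 <> 0) -> P mu.
Hypothesis hope : forall k l (s : nat),
  fil SS uu (fun x => x = 0) (degl k + degl l) (vprod SS s (uu k) (uu l)).

(* The graph of f is the span of the ordered words in the pairs (u k, u' k), hence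
   it is closed under the products. *)
Lemma hom_vprod s x y : f (vprod S s x y) = vprod S' s (f x) (f y).
Proof.
have graph z : exists p, fil SS uu (fun x => x = 0) p (z, f z).
  move: z; apply: (basis_ind hb) => [|a mu z hmu [p IH]].
    by exists 0%N; rewrite raddf0; exact: (spn0 _ (ideal0 SS)).
  exists (maxn p (deg mu).+1).
  rewrite linearP hf //.
  have -> : (a *: nomon S u mu + z, a *: nomon S' u' mu + f z)
      = a *: nomon SS uu mu + (z, f z) by rewrite pair_nomon.
  apply: spn_lin; last exact: (fil_mono (leq_maxl _ _) IH).
  by apply: spn_word; exact: leq_maxr.
have [p hx] := graph x; have [q hy] := graph y.
have := fil_prod hA (ideal0 SS) (fun k l s (_ : (_ <= (p + q)%N)%N) => hope k l s)
  s (leq_trans (leqnSn _) (leqnSn _)) hx hy.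
move=> /(fil_reduced hA (ideal0 SS) (fun k l s (_ : (_ <= (p + q)%N)%N) => hope k l s)).
move=> /(_ (leq_trans (leq_pred _) (leqnSn _))).
suff gr z : spn SS uu (fun x => x = 0) (fun mu => (deg mu < (p + q).-1)%N /\
    reduced uu (fun x => x = 0) mu) z -> z.2 = f z.1 by move=> /gr /=.
elim=> {z} [z ->|a z z' _ h _ h'|mu [_ [h1 h2]]] /=; first by rewrite raddf0.
  by rewrite linearP h h'.
by rewrite pair_nomon /= hf //; exact: hP.
Qed.

End Hom.

(** * Heisenberg algebras *)

Lemma natinv_complex (R : realType) (n : nat) : exists a : R[i], a * n.+1%:R = 1.
Proof. by exists (n.+1%:R^-1); rewrite mulVf // pnatr_eq0. Qed.

Lemma natinv_poly (A : comNzRingType) : natinv A -> natinv {poly A}.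
Proof.
by move=> h n; have [a ha] := h n; exists a%:P; rewrite -polyC_natr -polyCM ha.
Qed.

Lemma natinv_Chbar (R : realType) : natinv (Chbar R).
Proof. exact/natinv_poly/natinv_complex. Qed.

Lemma natinv_Cnuhbar (R : realType) : natinv (Cnuhbar R).
Proof. exact/natinv_poly/natinv_Chbar. Qed.

Lemma foldr_perm (T : eqType) (X : Type) (f : T -> X -> X) (x : X) s t :
  (forall a b y, f a (f b y) = f b (f a y)) -> perm_eq s t -> foldr f x s = foldr f x t.
Proof.
move=> hf; have front a n1 n2 : foldr f x (n1 ++ a :: n2) = f a (foldr f x (n1 ++ n2)).
  by elim: n1 => //= b n1 ->.
elim: s t => [|a s IH] t; first by move=> /perm_size; case: t.
move=> hp; have /splitPr hin : a \in t by rewrite -(perm_mem hp) mem_head.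
case: hin hp => n1 n2 hp; rewrite front /= (IH (n1 ++ n2)) //.
by rewrite -(perm_cons a) (perm_trans hp) // perm_catC /= perm_cons perm_catC.
Qed.

Section Words.
Variables (A : comNzRingType) (V : lmodType A) (S : vertex_structure V).

Lemma eq_nomon (u u' : nat -> V) (mu : monomial) :
  (forall a, a \in mu -> u a.1 = u' a.1) -> nomon S u mu = nomon S u' mu.
Proof.
elim: mu => //= a mu IH h; rewrite h ?mem_head // IH // => b hb.
by apply: h; rewrite inE hb orbT.
Qed.

Lemma nomon_reindex (u : nat -> V) (g : nat -> nat) (mu : monomial) :
  nomon S (u \o g) mu = nomon S u [seq (g a.1, a.2) | a <- mu].
Proof. by elim: mu => //= a mu ->. Qed.

Lemma nomon_letter0 (u : nat -> V) (mu : monomial) a :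
  a \in mu -> u a.1 = 0 -> nomon S u mu = 0.
Proof. by move=> h1 h2; exact: (ideal_word (ideal0 S) h1 h2). Qed.

End Words.

Lemma ordered_le m n mu : (m <= n)%N -> ordered m mu -> ordered n mu.
Proof.
move=> h /andP[h1 /allP h2]; rewrite /ordered h1; apply/allP => a /h2; lia.
Qed.

Definition wt1 (mu : monomial) : nat := sumn [seq a.2.+1 | a <- mu].

Section Heisenberg.
Variables (R : realType) (n : nat) (H : heisenberg R n).
Local Notation A := (Chbar R).
Local Notation V := (heis H).
Local Notation S := (heisS H).
Local Notation pr := (vprod S).
Implicit Types (x y t : V) (s p q : int) (mu nu : monomial).
Let hA := @natinv_Chbar R.

(** The axioms leave [heisI] free outside 1..n; the value 0 there gives all words a meaning. *)
Definition hI (k : nat) : V := if (1 <= k <= n)%N then heisI H k else 0.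
Local Notation w := (nomon S hI).

Lemma hI_ope k l (s : nat) :
  pr s (hI k) (hI l) = if [&& k == l, (1 <= k <= n)%N & s == 1%N] then 'X *: vac S else 0.
Proof.
rewrite /hI; case hk: (1 <= k <= n)%N; last by rewrite vprod0l andbF.
case hl: (1 <= l <= n)%N; first by rewrite heis_ope.
by rewrite vprod0r; case: eqP => // e; rewrite e hl in hk.
Qed.

Lemma hI_basis : is_basis (ordered n) w.
Proof.
apply: (eq_is_basis _ (@heis_basis R n H)) => mu /andP[_ /allP h].
by apply: eq_nomon => a /h; rewrite /hI => ->.
Qed.

Lemma hI_comm k l p q t :
  pr p (hI k) (pr q (hI l) t) - pr q (hI l) (pr p (hI k) t)
  = if [&& k == l, (1 <= k <= n)%N & p + q == 0] then ('X *: t) *~ p else 0.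
Proof.
rewrite (@vprod_commutator _ _ S hA _ _ _ _ _ 2); last first.
  by case=> [|[|i]] // _; rewrite hI_ope !andbF.
rewrite !big_ord_recr big_ord0 /= add0r !hI_ope /= !andbF /= vprod0l mul0rz add0r andbT.
rewrite [in RHS]andbA; case: andP => _; last by rewrite vprod0l mul0rz.
rewrite vprodZl vprod_vacl binz1.
have -> : (p + q - 1 == -1) = (p + q == 0) by rewrite -subr_eq0 opprK subrK.
by case: eqP; rewrite ?scaler0 ?mul0rz.
Qed.

Lemma hI_comm_neq k l p q t : (k != l) || (p + q != 0) ->
  pr p (hI k) (pr q (hI l) t) = pr q (hI l) (pr p (hI k) t).
Proof.
move=> h; apply: subr0_eq; rewrite hI_comm.
by case: eqP h => //= _ /negPf ->; rewrite andbF.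
Qed.

(** Letters act by negative modes, whose indices never add up to 0. They commute exactly, without
    terms of lower degree. *)
Lemma hI_word_perm mu nu : perm_eq mu nu -> w mu = w nu.
Proof.
apply: foldr_perm => -[k m] [l m'] y /=.
rewrite !vprod_iter_derl // !vprodMzr -!mulrzA mulrC; congr (_ *~ _).
by apply: hI_comm_neq; apply/orP; right; lia.
Qed.

Lemma hI_word_sort mu : w mu = w (sort lex_le mu).
Proof. by apply: hI_word_perm; rewrite perm_sym; exact/permPl/perm_sort. Qed.

Lemma hI_wordP mu : w mu = 0 \/ ordered n (sort lex_le mu).
Proof.
case: (boolP (all (fun a => (1 <= a.1 <= n)%N) mu)) => h.
  by right; rewrite /ordered (sort_sorted lex_le_total) all_sort.
left; have /allPn[a ha hn] := h.
by apply: (nomon_letter0 _ ha); rewrite /hI (negPf hn).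
Qed.

(** The weight space in which I_k^(m) has weight m + 1 and hbar weight 0. The integer index spares
    case distinctions when a mode lowers the weight below 0; [hw_lt0] disposes of such elements. *)
Definition hw (k : int) : V -> Prop := spn S hI (fun x => x = 0) (fun mu => (wt1 mu)%:Z = k).
Let i0 := ideal0 S.

Lemma hw0 k : hw k 0. Proof. exact: (spn0 _ i0). Qed.
Lemma hwD k x y : hw k x -> hw k y -> hw k (x + y). Proof. exact: spnD. Qed.
Lemma hwMz k x m : hw k x -> hw k (x *~ m). Proof. exact: (spnMz i0). Qed.

Lemma hw_mode_neg k s i y : s < 0 -> hw i y -> hw (i - s) (pr s (hI k) y).
Proof.
move=> hs; have -> : s = - (absz (s + 1)%R).+1%:Z by lia.
move: (absz _) => m; have [a ->] := vprod_neg_scale S hA (hI k) y m.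
move=> hy; apply: (spnZ i0).
apply: spn_map hy => [z ->|mu hmu]; first by rewrite raddf0; exact: hw0.
apply: (@spn_word _ _ _ _ _ _ ((k, m) :: mu)).
by rewrite /wt1 /= -/(wt1 mu) PoszD hmu; lia.
Qed.

(** A mode with s >= 0 is commuted to the vacuum. It contracts with a letter of derivative order m
    only if s = m + 1, the weight of that letter. *)
Lemma hw_mode k s i y : hw i y -> hw (i - s) (pr s (hI k) y).
Proof.
have [hs|hs] := ltrP s 0; first exact: hw_mode_neg.
move=> hy; apply: spn_map hy => [z ->|mu]; first by rewrite raddf0; exact: hw0.
elim: mu i => [|[l m] mu IH] i hmu /=.
  by rewrite vprod_vacr_int //; exact: hw0.
have {}hmu : (wt1 mu)%:Z = i - m.+1%:Z by move: hmu; rewrite /wt1 /=; lia.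
rewrite vprod_iter_derl // vprodMzr; apply: hwMz.
rewrite -[pr s _ _](subrK (pr (-1 - m%:Z) (hI l) (pr s (hI k) (w mu)))) hI_comm.
apply: hwD.
  case: and3P => [[_ _ /eqP h]|_]; last exact: hw0.
  apply: hwMz; apply: (spnZ i0); apply: spn_word; lia.
have -> : i - s = i - m.+1%:Z - s - (-1 - m%:Z) by lia.
by apply: hw_mode_neg; [lia|exact: IH].
Qed.

Lemma hw_letter k m s i y : hw i y -> hw (i - s + m%:Z) (pr s (iter m (vder S) (hI k)) y).
Proof.
move=> hy; rewrite vprod_iter_derl //; apply: hwMz.
by have -> : i - s + m%:Z = i - (s - m%:Z) by [lia]; exact: hw_mode.
Qed.

Lemma hw_prod i j s x y : hw i x -> hw j y -> hw (i + j - s - 1) (pr s x y).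
Proof.
move=> hx hy; apply: (@spn_map _ _ S hI _ _ _ (vprodl S s y)) hx => [z ->|mu hmu].
  by rewrite raddf0; exact: hw0.
change (hw (i + j - s - 1) (pr s (w mu) y)).
elim: mu i j s y hmu hy => [|[k m] mu IH] i j s y hmu hy /=.
  rewrite vprod_vacl; case: eqP => [->|_]; last exact: hw0.
  by have -> : i + j - -1 - 1 = j by [move: hmu; rewrite /wt1 /=; lia].
have {}hmu : (wt1 mu)%:Z = i - m.+1%:Z by move: hmu; rewrite /wt1 /=; lia.
have [K [h1 h2]] := vprod_trunc2 S (iter m (vder S) (hI k)) (w mu) y y s.
rewrite (vprod_iterate hA h1 h2); apply: (spn_sum_ord i0) => a; apply: spnD.
  have -> : i + j - s - 1 = (i - m.+1%:Z + j - (s + a%:Z) - 1) - (-1 - a%:Z) + m%:Z by lia.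
  by apply: hw_letter; exact: IH.
have -> : i + j - s - 1 = (i - m.+1%:Z) + (j - a%:Z + m%:Z) - (s - 1 - a%:Z) - 1 by lia.
by apply: IH => //; exact: hw_letter.
Qed.

Lemma hw_vac : hw 0 (vac S).
Proof. exact: (@spn_word _ _ S hI _ _ [::]). Qed.

Lemma hw_der i x : hw i x -> hw (i + 1) (vder S x).
Proof.
move=> h; rewrite vderE; have -> : i + 1 = i + 0 - (-2) - 1 by lia.
by apply: hw_prod => //; exact: hw_vac.
Qed.

Lemma hw_hI k : hw 1 (hI k).
Proof. by rewrite -[hI k](vprod_vacr S); exact: (@spn_word _ _ S hI _ _ [:: (k, 0%N)]). Qed.

Lemma hw_lt0 i x : i < 0 -> hw i x -> x = 0.
Proof.
move=> hi; elim=> [//|a y z _ -> _ ->|mu]; first by rewrite scaler0 addr0.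
by move=> h; exfalso; lia.
Qed.

(** Used in [vprodU_coord] to discard basis words of the wrong weight. *)
Definition hw_proj (k : int) : V -> V :=
  basis_map hI_basis (fun mu => if (wt1 mu)%:Z == k then w mu else 0).

Lemma hw_proj_linear k : linear (hw_proj k).
Proof. exact: basis_map_linear. Qed.

HB.instance Definition _ k := GRing.isLinear.Build A V V _ (hw_proj k) (hw_proj_linear k).

Lemma perm_wt1 mu nu : perm_eq mu nu -> wt1 mu = wt1 nu.
Proof. by move=> h; apply/perm_sumn/perm_map. Qed.

Lemma hw_projE k i x : hw i x -> hw_proj k x = if i == k then x else 0.
Proof.
elim=> [_ ->|a y z _ hy _ hz|mu hmu].
- by rewrite raddf0; case: ifP.
- by rewrite (hw_proj_linear k) hy hz; case: ifP => _ //; rewrite scaler0 addr0.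
case: (hI_wordP mu) => [->|hs]; first by rewrite raddf0; case: ifP.
rewrite hI_word_sort /hw_proj basis_mapE // -hmu.
have hp : perm_eq (sort lex_le mu) mu by exact/permPl/perm_sort.
by rewrite (perm_wt1 hp).
Qed.

(* A differential operator as in [miura], for a list of the I_k. *)
Definition mpart (l : seq nat) : nat -> V :=
  foldr (fun i a => dop_mul S (hI i) a) (dop_one S) l.

Lemma hw_mpart l k : hw ((size l)%:Z - k%:Z) (mpart l k).
Proof.
elim: l k => [|i l IH] k /=.
  by rewrite /dop_one; case: k => [|k] /=; [exact: hw_vac|exact: hw0].
rewrite /dop_mul; apply: hwD; first apply: hwD.
- case: k => [|k]; first exact: hw0.
  by have -> : (size l).+1%:Z - k.+1%:Z = (size l)%:Z - k%:Z by [lia]; exact: IH.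
- have -> : (size l).+1%:Z - k%:Z = (size l)%:Z - k%:Z + 1 by lia.
  exact: hw_der.
- have -> : (size l).+1%:Z - k%:Z = 1 + ((size l)%:Z - k%:Z) - (-1) - 1 by lia.
  by apply: hw_prod; [exact: hw_hI|exact: IH].
Qed.

Lemma mpart_gt l k : (size l < k)%N -> mpart l k = 0.
Proof. by move=> h; apply: hw_lt0 (hw_mpart l k); lia. Qed.

Lemma mpart_size l : mpart l (size l) = vac S.
Proof.
elim: l => //= i l IH; rewrite /dop_mul IH mpart_gt //.
by rewrite raddf0 vprod0r !addr0.
Qed.

(* Unlike [heisU], which vanishes at 0, [bU] takes there the value 1, the coefficient of
   \partial_z^n. *)
Definition bU (k : nat) : V := if (k <= n)%N then mpart (iota 1 n) (n - k) else 0.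

Lemma bU0 : bU 0 = vac S.
Proof. by rewrite /bU subn0 -[X in mpart _ X](size_iota 1 n) mpart_size. Qed.

Lemma miuraE m : miura S (heisI H) n m = mpart (iota 1 n) m.
Proof.
rewrite /miura /mpart; have : {subset iota 1 n <= iota 1 n} by [].
elim: {1 3 4}(iota 1 n) m => //= i l IH m h.
have hi : hI i = heisI H i.
  have := h i (mem_head _ _); rewrite mem_iota /hI add1n ltnS => ->; done.
have {}IH m' := IH m' (fun j hj => h j (mem_behead (s := i :: l) hj)).
by rewrite /dop_mul hi !IH; case: m => // m; rewrite IH.
Qed.

Lemma heisU_bU k : heisU H k = if k == 0%N then 0 else bU k.
Proof. by rewrite /heisU /bU; case: k => //= k; rewrite miuraE. Qed.

Lemma hw_bU k : hw k%:Z (bU k).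
Proof.
rewrite /bU; case: leqP => h; last exact: hw0.
have := hw_mpart (iota 1 n) (n - k); rewrite size_iota.
by have -> : n%:Z - (n - k)%N%:Z = k%:Z by lia.
Qed.

End Heisenberg.

(** * Comparison of the ranks n and n + 1 *)

Section RankOne.
Variables (R : realType) (n : nat) (H : heisenberg R n) (H' : heisenberg R n.+1).
Local Notation A := (Chbar R).
Local Notation V := (heis H).
Local Notation S := (heisS H).
Local Notation V' := (heis H').
Local Notation S' := (heisS H').
Local Notation w := (nomon S (hI H)).
Local Notation w' := (nomon S' (hI H')).
Let hA := @natinv_Chbar R.
Implicit Types (x y : V) (t : V') (s p q : int) (mu nu : monomial).

Definition shiftm (mu : monomial) : monomial := [seq (a.1.+1, a.2) | a <- mu].
Definition unshiftm (mu : monomial) : monomial := [seq (a.1.-1, a.2) | a <- mu].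

Lemma shiftmK : cancel shiftm unshiftm.
Proof. by move=> mu; rewrite /unshiftm -map_comp map_id_in // => -[]. Qed.

Lemma shiftm_ordered mu : ordered n mu -> ordered n.+1 (shiftm mu).
Proof.
move=> /andP[h1 /allP h2]; apply/andP; split; last first.
  by apply/allP => a /mapP[b /h2 hb ->] /=; lia.
by rewrite sorted_map; move: h1; apply: sub_sorted => -[k m] [l m'].
Qed.

(** The embedding I_k -> I_(k+1). Shifting frees I_1, the generator of the leftmost Miura factor. *)
Definition hshift : V -> V' := basis_map (@hI_basis R n H) (fun mu => w' (shiftm mu)).

Lemma hshift_linear : linear hshift. Proof. exact: basis_map_linear. Qed.

HB.instance Definition _ := GRing.isLinear.Build A V V' _ hshift hshift_linear.

Let u' k : V' := if (1 <= k <= n)%N then hI H' k.+1 else 0.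

Lemma hshift_word mu : ordered n mu -> hshift (w mu) = w' (shiftm mu).
Proof. exact: basis_mapE. Qed.

Let hshift_u' mu : ordered n mu -> hshift (w mu) = nomon S' u' mu.
Proof.
move=> h; rewrite hshift_word // /shiftm -(nomon_reindex S' (hI H') succn).
apply: eq_nomon => a ha; move: h => /andP[_ /allP /(_ _ ha)].
by rewrite /u' /= => ->.
Qed.

Let hshift_red mu : sorted lex_le mu ->
  (forall a, a \in mu -> (hI H a.1, u' a.1) <> 0) -> ordered n mu.
Proof.
move=> h1 h2; rewrite /ordered h1 /=; apply/allP => a /h2.
by rewrite /hI /u'; case: ifP.
Qed.

Let uu k : (V * V')%type := (hI H k, u' k).

Let hshift_ope k l (s : nat) :
  fil (pair_structure S S') uu (fun z => z = 0) (degl k + degl l)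
    (vprod (pair_structure S S') s (uu k) (uu l)).
Proof.
have -> : vprod (pair_structure S S') s (uu k) (uu l)
  = if [&& k == l, (1 <= k <= n)%N & s == 1%N] then 'X *: vac (pair_structure S S') else 0.
  rewrite /= /pair_prod /= hI_ope /u'; case hk: (1 <= k <= n)%N; last first.
    by rewrite vprod0l andbF.
  case hl: (1 <= l <= n)%N; last first.
    by rewrite vprod0r; case: eqP => // e; rewrite e hl in hk.
  rewrite hI_ope eqSS; have -> : (0 < k.+1 <= n.+1)%N by lia.
  by case: ifP.
case: ifP => _; last exact: (spn0 _ (ideal0 _)).
apply: (spnZ (ideal0 _)); apply: (@spn_word _ _ _ _ _ _ [::]).
by have := degl_gt0 k; rewrite /deg /=; lia.
Qed.

Lemma hshift_vprod s x y : hshift (vprod S s x y) = vprod S' s (hshift x) (hshift y).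
Proof.
exact: (@hom_vprod _ _ _ S S' hA (hI H) u' (ordered n) (@hI_basis R n H) hshift
  hshift_u' hshift_red hshift_ope).
Qed.

Lemma hshift_vac : hshift (vac S) = vac S'.
Proof. exact: (@hshift_word [::]). Qed.

Lemma hshift_der x : hshift (vder S x) = vder S' (hshift x).
Proof. by rewrite !vderE hshift_vprod hshift_vac. Qed.

Lemma hshift_nomon u mu : hshift (nomon S u mu) = nomon S' (hshift \o u) mu.
Proof.
elim: mu => [|a mu IH] /=; first exact: hshift_vac.
rewrite hshift_vprod IH; congr (vprod _ _ _ _).
by elim: (a.2) => //= m <-; rewrite hshift_der.
Qed.

(* Not a homomorphism: the contraction of I_1 with itself contributes to [hunshift_vprod]. *)
Definition hunshift : V' -> V :=
  basis_map (@hI_basis R n.+1 H')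
    (fun mu => if has (fun a => a.1 == 1%N) mu then 0 else w (unshiftm mu)).

Lemma hunshift_linear : linear hunshift. Proof. exact: basis_map_linear. Qed.

HB.instance Definition _ := GRing.isLinear.Build A V' V _ hunshift hunshift_linear.

Lemma hshiftK x : hunshift (hshift x) = x.
Proof.
apply: (basis_ext (@hI_basis R n H) (g := hunshift \o hshift) (h := idfun)) x => mu hmu.
rewrite /= hshift_word // /hunshift basis_mapE ?shiftm_ordered // shiftmK ifN //.
apply/hasPn => a /mapP[b hb ->] /=.
by move: hmu => /andP[_ /allP /(_ _ hb)]; lia.
Qed.

Lemma hunshift_word1 mu a : a \in mu -> a.1 = 1%N -> hunshift (w' mu) = 0.
Proof.
move=> ha h1; case: (hI_wordP H' mu) => [->|hs]; first by rewrite raddf0.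
rewrite hI_word_sort /hunshift basis_mapE // ifT //.
by apply/hasP; exists a; rewrite ?mem_sort // h1.
Qed.

Local Notation J := (hI H' 1).

Lemma hunshift_neg s t : s < 0 -> hunshift (vprod S' s J t) = 0.
Proof.
move=> hs; have -> : s = - (absz (s + 1)%R).+1%:Z by lia.
move: (absz _) => m; have [c ->] := vprod_neg_scale S' hA J t m.
rewrite linearZ_LR /=; set f := vprod _ _ _.
suff -> : hunshift (f t) = 0 by rewrite scaler0.
apply: (basis_ext (@hI_basis R n.+1 H') (g := hunshift \o f) (h := \0)) t => mu hmu /=.
by apply: (@hunshift_word1 ((1%N, m) :: mu) (1%N, m)); rewrite ?mem_head.
Qed.

Lemma hI1_hshift (r : nat) x : vprod S' r J (hshift x) = 0.
Proof.
apply: (basis_ext (@hI_basis R n H) (g := vprod S' r J \o hshift) (h := \0)) x => mu hmu /=.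
rewrite hshift_word //.
have : all (fun a => a.1 != 1%N) (shiftm mu).
  apply/allP => a /mapP[b hb ->] /=; rewrite eqSS.
  by move: hmu => /andP[_ /allP /(_ _ hb)]; lia.
elim: (shiftm mu) => [|[k m] nu IH] /=; first by rewrite vprod_vacr_ge0.
move=> /andP[hk /IH {}IH]; rewrite vprod_iter_derl // vprodMzr.
by rewrite hI_comm_neq 1?eq_sym ?hk // IH vprod0r mul0rz.
Qed.

Lemma hI1_comm p q x t :
  vprod S' p J (vprod S' q (hshift x) t) = vprod S' q (hshift x) (vprod S' p J t).
Proof.
apply: subr0_eq; rewrite (@vprod_commutator _ _ S' hA _ _ _ _ _ 0) ?big_ord0 //.
by move=> i _; exact: hI1_hshift.
Qed.

(** In a mixed term I_1 has no partner and moves to the front, where [hunshift] kills it. In the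
    last term only the contraction of the two I_1 survives: it is the summand i = 1 of the iterate
    formula, whence the index s - 1 - 1. *)
Lemma hunshift_vprod s (a a1 b b1 : V) :
  hunshift (vprod S' s (hshift a + vprod S' (-1) J (hshift a1))
                       (hshift b + vprod S' (-1) J (hshift b1)))
  = vprod S s a b + 'X *: vprod S (s - 2) a1 b1.
Proof.
rewrite vprodDl !vprodDr -hshift_vprod -hI1_comm !raddfD /= hshiftK hunshift_neg // addr0.
congr (_ + _).
have [K [h1 h2]] := vprod_trunc2 S' J (hshift a1) (hshift b) (hshift b) s.
rewrite (vprod_iterate hA h1 h2) raddf_sum big1 ?add0r => [|i _]; last first.
  by rewrite raddfD /= hunshift_neg; [rewrite hI1_hshift vprod0r raddf0 addr0|lia].
have [K' [h1' h2']] := vprod_trunc2 S' J (hshift a1) (vprod S' (-1) J (hshift b1))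
  (vprod S' (-1) J (hshift b1)) s.
rewrite (@vprod_iterate _ _ _ hA _ _ _ _ K'.+2); last 2 first.
- by move=> i hi; apply: h1'; lia.
- by move=> i hi; apply: h2'; lia.
have JJ (i : nat) : vprod S' i J (vprod S' (-1) J (hshift b1))
    = if i == 1%N then 'X *: hshift b1 else 0.
  have := @hI_comm R n.+1 H' 1 1 i (-1) (hshift b1).
  rewrite hI1_hshift vprod0r subr0 eqxx /= => ->.
  have -> : (i%:Z + -1 == 0) = (i == 1%N) by lia.
  by case: eqP => // ->; rewrite mulr1z.
rewrite raddf_sum 2!big_ord_recl big1 => [|i _]; last first.
  rewrite !lift0 raddfD /= hunshift_neg ?JJ /=; last by lia.
  by rewrite vprod0r raddf0 addr0.
rewrite !raddfD /= !hunshift_neg // !JJ /= vprod0r raddf0 !add0r addr0.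
rewrite vprodZr linearZ_LR -hshift_vprod /= hshiftK.
by congr (_ *: vprod _ _ _ _); rewrite /bump /=; lia.
Qed.

Lemma hshift_mpart l m : {subset l <= iota 1 n} ->
  hshift (mpart H l m) = mpart H' (map succn l) m.
Proof.
elim: l m => [|i l IH] m h /=.
  by rewrite /dop_one; case: ifP => _; [exact: hshift_vac|exact: raddf0].
have hi : hshift (hI H i) = hI H' i.+1.
  have := h i (mem_head _ _); rewrite mem_iota add1n ltnS => hi.
  rewrite -[hI H i](vprod_vacr S) -[vprod _ _ _ _]/(w [:: (i, 0%N)]) hshift_word.
    exact: vprod_vacr.
  by rewrite /ordered /= hi.
have {}IH m' := IH m' (fun j hj => h j (mem_behead (s := i :: l) hj)).
rewrite /dop_mul !raddfD /= hshift_vprod hshift_der hi !IH.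
by case: m => [|m]; rewrite ?raddf0 ?IH.
Qed.

Lemma bU_succ k : (k.+1 <= n)%N ->
  bU H' k.+1 = hshift (bU H k.+1 + vder S (bU H k)) + vprod S' (-1) J (hshift (bU H k)).
Proof.
move=> h; rewrite /bU h (ltnW h) leqW //= /dop_mul subSS -(subnSK h).
have -> : iota 2 n = map succn (iota 1 n) by rewrite -(iotaDl 1 1 n).
by rewrite -!hshift_mpart // raddfD /= hshift_der.
Qed.

End RankOne.

(** * Sequences indexed by the rank *)

Section HeisenbergBound.
Variables (R : realType) (n : nat) (H : heisenberg R n).
Local Notation S := (heisS H).
Implicit Types (x y : heis H) (k l s : int).

(** A bound on the weight, unlike homogeneity, is stable under arbitrary sums. The order of the
    poles is then bounded through the weights alone, uniformly in the rank. *)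
Definition hle (k : int) : heis H -> Prop :=
  spn S (hI H) (fun x => x = 0) (fun mu => (wt1 mu)%:Z <= k).

Lemma hle_hw k l x : k <= l -> hw k x -> hle l x.
Proof. by move=> h; apply: spn_mono => mu ->. Qed.

Lemma hle_mono k l x : k <= l -> hle k x -> hle l x.
Proof. by move=> h; apply: spn_mono => mu h'; exact: le_trans h. Qed.

Lemma hle_prod k l s x y : hle k x -> hle l y -> hle (k + l - s - 1) (vprod S s x y).
Proof.
apply: (spn_prod (ideal0 S)) => mu nu hmu hnu.
apply: (@hle_hw ((wt1 mu)%:Z + (wt1 nu)%:Z - s - 1)); first by lia.
by apply: hw_prod; exact: spn_word.
Qed.

Lemma hle_lt0 k x : k < 0 -> hle k x -> x = 0.
Proof.
move=> hk; elim=> [//|a y z _ -> _ ->|mu]; first by rewrite scaler0 addr0.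
by move=> h; exfalso; lia.
Qed.

Lemma hle_prod0 k l s x y : hle k x -> hle l y -> k + l <= s -> vprod S s x y = 0.
Proof. by move=> hx hy hs; apply: (hle_lt0 _ (hle_prod s hx hy)); lia. Qed.

End HeisenbergBound.

(** * The vertex algebra of sequences of bounded weight *)

Section BoundedSequences.
Variables (R : realType) (rk : nat -> nat) (Hf : forall n, heisenberg R (rk n)).
Local Notation A := (Cnuhbar R).

(** [rk] will be the identity or the successor, so that ranks n and n + 1 meet at the same index
    n. *)
Definition hseq : Type := forall n, heis (Hf n).

HB.instance Definition _ := gen_eqMixin hseq.
HB.instance Definition _ := gen_choiceMixin hseq.

Definition hseq_zero : hseq := fun n => 0.
Definition hseq_opp (x : hseq) : hseq := fun n => - x n.
Definition hseq_add (x y : hseq) : hseq := fun n => x n + y n.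
(* nu acts on the n-th component as n. *)
Definition hseq_scale (a : A) (x : hseq) : hseq := fun n => a.[n%:R] *: x n.

Fact hseq_addA : associative hseq_add.
Proof. by move=> x y z; apply: functional_extensionality_dep => n; exact: addrA. Qed.
Fact hseq_addC : commutative hseq_add.
Proof. by move=> x y; apply: functional_extensionality_dep => n; exact: addrC. Qed.
Fact hseq_add0 : left_id hseq_zero hseq_add.
Proof. by move=> x; apply: functional_extensionality_dep => n; exact: add0r. Qed.
Fact hseq_addN : left_inverse hseq_zero hseq_opp hseq_add.
Proof. by move=> x; apply: functional_extensionality_dep => n; exact: addNr. Qed.

HB.instance Definition _ :=
  GRing.isZmodule.Build hseq hseq_addA hseq_addC hseq_add0 hseq_addN.

Fact hseq_scaleA a b x : hseq_scale a (hseq_scale b x) = hseq_scale (a * b) x.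
Proof.
by apply: functional_extensionality_dep => n; rewrite /hseq_scale scalerA hornerM.
Qed.
Fact hseq_scale1 : left_id 1 hseq_scale.
Proof.
by move=> x; apply: functional_extensionality_dep => n; rewrite /hseq_scale hornerC scale1r.
Qed.
Fact hseq_scaleDr : right_distributive hseq_scale +%R.
Proof. by move=> a x y; apply: functional_extensionality_dep => n; exact: scalerDr. Qed.
Fact hseq_scaleDl x : {morph hseq_scale^~ x : a b / a + b}.
Proof.
move=> a b; apply: functional_extensionality_dep => n.
by rewrite /hseq_scale hornerD; exact: scalerDl.
Qed.

HB.instance Definition _ := GRing.Zmodule_isLmodule.Build A hseq
  hseq_scaleA hseq_scale1 hseq_scaleDr hseq_scaleDl.

Definition bounded (x : hseq) : Prop := exists k : nat, forall n, hle k%:Z (x n).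

Definition bounded_pred : {pred hseq} := fun x => `[< bounded x >].

Fact bounded_submod : submod_closed bounded_pred.
Proof.
split; first by apply/asboolP; exists 0%N => n; exact: (spn0 _ (ideal0 _)).
move=> a x y /asboolP[k hx] /asboolP[l hy]; apply/asboolP; exists (maxn k l) => n.
apply: spn_lin; first by apply: hle_mono (hx n); lia.
by apply: hle_mono (hy n); lia.
Qed.

HB.instance Definition _ :=
  GRing.isSubmodClosed.Build A hseq bounded_pred bounded_submod.

Record bdseq := Bdseq { bseq_val : hseq; bseq_valP : bseq_val \in bounded_pred }.

HB.instance Definition _ := [isSub for bseq_val].
HB.instance Definition _ := [Choice of bdseq by <:].
HB.instance Definition _ := [SubChoice_isSubLmodule of bdseq by <:].

Definition bev (x : bdseq) (n : nat) : heis (Hf n) := bseq_val x n.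

Coercion bev : bdseq >-> Funclass.

Implicit Types (x y z t : bdseq) (s : int).

Lemma bseqP x : bounded (bseq_val x).
Proof. exact/asboolP/bseq_valP. Qed.

Definition mkbseq (f : hseq) (h : bounded f) : bdseq := Bdseq (asboolT h).

Lemma bseq_ext x y : (forall n, x n = y n) -> x = y.
Proof. by move=> h; apply: val_inj; exact: functional_extensionality_dep. Qed.

Lemma bseqDE x y n : (x + y) n = x n + y n. Proof. by []. Qed.
Lemma bseqNE x n : (- x) n = - x n. Proof. by []. Qed.
Lemma bseqBE x y n : (x - y) n = x n - y n. Proof. by []. Qed.
Lemma bseqZE (a : A) x n : (a *: x) n = a.[n%:R] *: x n. Proof. by []. Qed.

Lemma bseq_sumE I (r : seq I) P (F : I -> bdseq) n :
  (\sum_(i <- r | P i) F i) n = \sum_(i <- r | P i) (F i n).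
Proof. by elim/big_rec2: _ => // i y z _ <-. Qed.

Lemma bseqMzE x (m : int) n : (x *~ m) n = x n *~ m.
Proof.
have h (k : nat) : (x *+ k) n = x n *+ k by elim: k => // k IH; rewrite !mulrS -IH.
by case: m => m; rewrite ?NegzE ?mulrNz -?pmulrn ?bseqNE h.
Qed.

Fact bvac_bounded : bounded (fun n => vac (heisS (Hf n))).
Proof. by exists 0%N => n; exact: hle_hw (hw_vac _). Qed.

Fact bder_bounded x : bounded (fun n => vder (heisS (Hf n)) (x n)).
Proof.
have [k hk] := bseqP x; exists k.+1 => n; rewrite vderE.
have h0 : hle 0 (vac (heisS (Hf n))) by exact: hle_hw (hw_vac _).
by apply: hle_mono (hle_prod (-2) (hk n) h0); lia.
Qed.

Fact bprod_bounded s x y : bounded (fun n => vprod (heisS (Hf n)) s (x n) (y n)).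
Proof.
have [k hk] := bseqP x; have [l hl] := bseqP y; exists (k + l + absz s)%N => n.
by apply: hle_mono (hle_prod s (hk n) (hl n)); lia.
Qed.

Definition bvac := mkbseq bvac_bounded.
Definition bder x := mkbseq (bder_bounded x).
Definition bprod s x y := mkbseq (bprod_bounded s x y).

Fact bder_linear : linear bder.
Proof. by move=> a x y; apply: bseq_ext => n; exact: vder_linear. Qed.

Fact bprod_linearl s y : linear (fun x => bprod s x y).
Proof. by move=> a x x'; apply: bseq_ext => n; exact: (vprod_linearl (heisS (Hf n))). Qed.

Fact bprod_linearr s x : linear (bprod s x).
Proof. by move=> a y y'; apply: bseq_ext => n; exact: (vprod_linearr (heisS (Hf n))). Qed.

Lemma bprod_eq0 x y : exists N : nat, forall s : int, N%:Z <= s -> bprod s x y = 0.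
Proof.
have [k hk] := bseqP x; have [l hl] := bseqP y; exists (k + l)%N => s hs.
by apply: bseq_ext => n; apply: (hle_prod0 (hk n) (hl n)); lia.
Qed.

Fact bprod_field x y : exists N : nat, forall s : nat, (N <= s)%N -> bprod s x y = 0.
Proof. by have [N h] := bprod_eq0 x y; exists N => s hs; apply: h; lia. Qed.

Fact bprod_vacl s x : bprod s bvac x = if s == -1 then x else 0.
Proof. by apply: bseq_ext => n; rewrite /= vprod_vacl; case: ifP. Qed.

Fact bprod_vacr x : bprod (-1) x bvac = x.
Proof. by apply: bseq_ext => n; exact: vprod_vacr. Qed.

Fact bprod_vacr_ge0 (s : nat) x : bprod s x bvac = 0.
Proof. by apply: bseq_ext => n; exact: vprod_vacr_ge0. Qed.

Fact bder_vac : bder bvac = 0.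
Proof. by apply: bseq_ext => n; exact: vder_vac. Qed.

Fact bder_prod s x y : bder (bprod s x y) - bprod s x (bder y) = bprod (s - 1) x y *~ (- s).
Proof. by apply: bseq_ext => n; rewrite bseqMzE; exact: vder_prod. Qed.

Lemma horner_signbin (i m : nat) (a : Chbar R) :
  ((-1) ^+ i * m%:R : A).[a] = (-1) ^+ i * m%:R.
Proof. by rewrite hornerM horner_exp hornerN hornerC -polyC_natr hornerC. Qed.

(** The locality axiom of each component gives an exponent depending on n. The Borcherds identity
    shows that a bound on the order of the poles works as exponent, and such a bound is uniform in
    n. *)
Fact bprod_local x y : exists N : nat, forall (p q : int) t,
  \sum_(i < N.+1) ((-1) ^+ i * 'C(N, i)%:R) *:
     (bprod (p + N%:Z - i%:Z) x (bprod (q + i%:Z) y t)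
      - bprod (q + i%:Z) y (bprod (p + N%:Z - i%:Z) x t)) = 0.
Proof.
have [N h] := bprod_eq0 x y; exists N => p q t; apply: bseq_ext => n.
have hA := @natinv_Chbar R.
transitivity (iter N (@shiftB _) (vcomm (heisS (Hf n)) (x n) (y n) (t n)) p q).
  rewrite iter_vcomm bseq_sumE; apply: eq_bigr => i _.
  by rewrite bseqZE horner_signbin.
rewrite -jac_comm borcherds // /jac_lhs vsum0 // => i.
have -> : vprod (heisS (Hf n)) (N%:Z + i%:Z) (x n) (y n) = bprod (N%:Z + i%:Z) x y n by [].
by rewrite h ?vprod0l ?mul0rz //; lia.
Qed.

Definition bseq_structure : vertex_structure bdseq :=
  @VertexStructure A bdseq bvac bder bprod bder_linear bprod_linearl bprod_linearr
    bprod_field bprod_vacl bprod_vacr bprod_vacr_ge0 bder_vac bder_prod bprod_local.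

Lemma bseq_iter_der m x n :
  iter m (vder bseq_structure) x n = iter m (vder (heisS (Hf n))) (x n).
Proof. by elim: m => //= m <-. Qed.

Lemma bseq_nomon (u : nat -> bdseq) mu n :
  nomon bseq_structure u mu n = nomon (heisS (Hf n)) (fun k => u k n) mu.
Proof.
by elim: mu => //= a mu <-; rewrite -bseq_iter_der.
Qed.

Lemma bseq_lincomb (e : monomial -> bdseq) c n :
  lincomb e c n = specialize n c (fun mu => e mu n).
Proof. exact: bseq_sumE. Qed.

Definition ev_zero x := exists N : nat, forall n, (N <= n)%N -> x n = 0.

Lemma ev_zero_ideal : vertex_ideal bseq_structure ev_zero.
Proof.
split; first by exists 0%N.
- move=> a x y [N h] [N' h']; exists (maxn N N') => n; rewrite geq_max => /andP[/h hx /h' hy].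
  by rewrite bseqDE bseqZE hx hy scaler0 addr0.
- by move=> s x y [N h]; exists N => n /h hx; rewrite /= hx vprod0l.
- by move=> s x y [N h]; exists N => n /h hx; rewrite /= hx vprod0r.
Qed.

End BoundedSequences.

(** * Eventually polynomial functions and antidifferences *)

Section EventuallyPolynomial.
Variable B : comNzRingType.
Hypothesis hB : natinv B.
Implicit Types (f g : nat -> B) (P Q : {poly B}).

Definition evpoly f := exists P, exists N : nat, forall n, (N <= n)%N -> f n = P.[n%:R].

Lemma evpolyP P : evpoly (fun n => P.[n%:R]).
Proof. by exists P, 0%N. Qed.

Lemma evpoly0 : evpoly (fun=> 0).
Proof. by exists 0, 0%N => n _; rewrite horner0. Qed.

Lemma evpolyD f g : evpoly f -> evpoly g -> evpoly (fun n => f n + g n).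
Proof.
move=> [P [N h]] [Q [N' h']]; exists (P + Q), (maxn N N') => n.
by rewrite geq_max => /andP[/h -> /h' ->]; rewrite hornerD.
Qed.

Lemma evpolyN f : evpoly f -> evpoly (fun n => - f n).
Proof. by move=> [P [N h]]; exists (- P), N => n /h ->; rewrite hornerN. Qed.

Lemma evpolyM f g : evpoly f -> evpoly g -> evpoly (fun n => f n * g n).
Proof.
move=> [P [N h]] [Q [N' h']]; exists (P * Q), (maxn N N') => n.
by rewrite geq_max => /andP[/h -> /h' ->]; rewrite hornerM.
Qed.

Lemma evpoly_shift f : evpoly f -> evpoly (fun n => f n.+1).
Proof.
move=> [P [N h]]; exists (P \Po ('X + 1)), N => n hn.
by rewrite h 1?ltnW // horner_comp !hornerE natr1.
Qed.

Lemma evpoly_sum (I : eqType) (r : seq I) (F : I -> nat -> B) :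
  (forall i, i \in r -> evpoly (F i)) -> evpoly (fun n => \sum_(i <- r) F i n).
Proof.
elim: r => [|i r IH] h.
  by under eq_fun do rewrite big_nil; exact: evpoly0.
under eq_fun do rewrite big_cons; apply: evpolyD; first by apply: h; rewrite mem_head.
by apply: IH => j hj; apply: h; rewrite inE hj orbT.
Qed.

Lemma eq_evpoly f g N : (forall n, (N <= n)%N -> f n = g n) -> evpoly f -> evpoly g.
Proof.
move=> h [P [N' h']]; exists P, (maxn N N') => n.
by rewrite geq_max => /andP[hn hn']; rewrite -h // h'.
Qed.

(** The difference of n^(m+1) is (m+1) n^m plus lower powers. Antidifferences of the latter are
    subtracted, and m + 1 is inverted. *)
Lemma antidifference_exp m : exists Q, forall n, Q.[n.+1%:R] - Q.[n%:R] = n%:R ^+ m.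
Proof.
elim/ltn_ind: m => m IH.
have /choice[q hq] : forall i : 'I_m, exists Q, forall n, Q.[n.+1%:R] - Q.[n%:R] = n%:R ^+ i.
  by move=> i; exact: IH.
have [a ha] := hB m.
exists (a *: ('X^(m.+1) - \sum_(i < m) q i *+ 'C(m.+1, i))) => n.
have e : n.+1%:R ^+ m.+1 = \sum_(i < m.+2) n%:R ^+ i *+ 'C(m.+1, i) :> B.
  rewrite -natr1 addrC exprDn; apply: eq_bigr => i _.
  by rewrite expr1n mul1r.
rewrite !hornerZ -mulrBr !hornerD !hornerN !horner_sum !hornerXn subrACA -sumrB.
under [X in _ - X]eq_bigr do rewrite !hornerMn -mulrnBl hq.
rewrite e !big_ord_recr /= binn mulr1n addrK [_ + _ *+ 'C(m.+1, m)]addrC addrK binSn.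
by rewrite -[_ ^+ m *+ m.+1]mulr_natr mulrCA ha mulr1.
Qed.

Lemma antidifference P : exists Q, forall n, Q.[n.+1%:R] - Q.[n%:R] = P.[n%:R].
Proof.
have /choice[q hq] := antidifference_exp.
exists (\sum_(i < size P) P`_i *: q i) => n.
rewrite !horner_sum -sumrB horner_coef; apply: eq_bigr => i _.
by rewrite !hornerZ -mulrBr hq.
Qed.

Lemma evpoly_difference f : evpoly (fun n => f n.+1 - f n) -> evpoly f.
Proof.
move=> [P [N h]]; have [Q hQ] := antidifference P.
exists (Q + (f N - Q.[N%:R])%:P), N => n /subnK <-.
elim: (n - N)%N => [|m IH]; first by rewrite add0n hornerD hornerC addrC subrK.
move: IH; rewrite addSn !hornerD !hornerC => IH.
have /(congr1 (+%R^~ (f (m + N)%N))) := h (m + N)%N (leq_addl _ _).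
by rewrite -hQ /= subrK => ->; rewrite IH addrA subrK.
Qed.

End EventuallyPolynomial.

Section Evaluation.
Variable B : comNzRingType.
Local Notation M := {malg B[seq (nat * nat)]}.

Lemma mcoeff_sumU (r : seq (seq (nat * nat))) (f : seq (nat * nat) -> B) nu : uniq r ->
  (\sum_(mu <- r) << f mu *g mu >> : M)@_nu = if nu \in r then f nu else 0.
Proof.
move=> ur; rewrite raddf_sum /=.
under eq_bigr do rewrite mcoeffU.
case: ifP => h.
  rewrite (bigD1_seq nu) //= eqxx mulr1n big1 ?addr0 // => mu.
  by move=> /negPf ->.
rewrite big_seq big1 // => mu hmu; case: eqP => // e.
by rewrite e h in hmu.
Qed.

Lemma msupp_sumU (r : seq (seq (nat * nat))) (f : seq (nat * nat) -> B) nu : uniq r ->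
  nu \in msupp (\sum_(mu <- r) << f mu *g mu >> : M) -> nu \in r.
Proof. by move=> ur; rewrite -mcoeff_neq0 mcoeff_sumU //; case: ifP; rewrite ?eqxx. Qed.

Definition evalm (n : nat) (P : {malg {poly B}[seq (nat * nat)]}) : M :=
  \sum_(mu <- msupp P) << (P@_mu).[n%:R] *g mu >>.

Lemma mcoeff_evalm n P mu : (evalm n P)@_mu = (P@_mu).[n%:R].
Proof.
rewrite mcoeff_sumU ?fset_uniq //; case: ifP => // /negbT h.
by rewrite mcoeff_outdom // horner0.
Qed.

Lemma msupp_evalm n P mu : mu \in msupp (evalm n P) -> mu \in msupp P.
Proof. exact: msupp_sumU (fset_uniq _). Qed.

Lemma lincomb_sumU (V : lmodType B) (e : monomial -> V) (r : seq (seq (nat * nat)))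
    (f : seq (nat * nat) -> B) :
  lincomb e (\sum_(mu <- r) << f mu *g mu >>) = \sum_(mu <- r) f mu *: e mu.
Proof. by rewrite raddf_sum; apply: eq_bigr => mu _; exact: lincombU. Qed.

Lemma lincomb_evalm (V : lmodType B) (e : monomial -> V) n P :
  lincomb e (evalm n P) = \sum_(mu <- msupp P) (P@_mu).[n%:R] *: e mu.
Proof. exact: lincomb_sumU. Qed.

End Evaluation.

Section SpanCoefficients.
Variables (A : comNzRingType) (V : lmodType A) (S : vertex_structure V).
Variables (u : nat -> V) (Z : V -> Prop).
Hypothesis hZ : vertex_ideal S Z.

Lemma spn_lincombE (Q : monomial -> Prop) x : spn S u Z Q x ->
  exists c : {malg A[seq (nat * nat)]},
    (forall mu, mu \in msupp c -> Q mu) /\ Z (x - lincomb (nomon S u) c).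
Proof.
have [Z0 Zl _ _] := hZ.
elim=> [y hy|a y y' _ [c [hc hz]] _ [c' [hc' hz']]|mu hmu].
- by exists 0; rewrite msupp0 raddf0 subr0.
- exists (a *: c + c'); split.
    move=> mu /(fsubsetP (msuppD_le _ _)); rewrite in_fsetU => /orP[|]; last exact: hc'.
    by move=> /(fsubsetP (msuppZ_le _ _)); exact: hc.
  rewrite lincomb_linear.
  have -> : a *: y + y' - (a *: lincomb (nomon S u) c + lincomb (nomon S u) c')
    = a *: (y - lincomb (nomon S u) c) + (y' - lincomb (nomon S u) c').
    by rewrite scalerBr opprD addrACA.
  exact: Zl.
- exists << mu >>; split; first by move=> nu /(fsubsetP msuppU_le); rewrite in_fset1 => /eqP ->.
  by rewrite lincombU scale1r subrr.
Qed.

Lemma lincomb_spn (Q : monomial -> Prop) (c : {malg A[seq (nat * nat)]}) :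
  (forall mu, mu \in msupp c -> Q mu) -> spn S u Z Q (lincomb (nomon S u) c).
Proof.
move=> h; apply: (spn_sum hZ) => mu hmu.
by apply: (spnZ hZ); apply: spn_word; exact: h.
Qed.

End SpanCoefficients.

(** The conformal weight, U_k^(m) having weight k + m. *)
Definition wtU (mu : monomial) : nat := sumn [seq (a.1 + a.2)%N | a <- mu].

Definition pos_letters (mu : monomial) : bool := all (fun a => (0 < a.1)%N) mu.

Lemma deg_le_wtU mu : pos_letters mu -> (deg mu <= wtU mu)%N.
Proof.
elim: mu => // a mu IH /= /andP[ha /IH h]; rewrite deg_cons /wtU /= -/(wtU mu) /degl; lia.
Qed.

Lemma orderedE n mu : ordered n mu ->
  [/\ sorted lex_le mu, pos_letters mu & forall a, a \in mu -> (a.1 <= n)%N].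
Proof.
by move=> /andP[h1 /allP h2]; split=> //; [apply/allP => a /h2|move=> a /h2] => /andP[].
Qed.

Lemma letter_le_deg mu a : a \in mu -> (a.1 <= deg mu)%N.
Proof.
elim: mu => // b mu IH; rewrite inE deg_cons => /orP[/eqP ->|/IH h].
  exact: leq_trans (leq_maxl _ _) (leq_addr _ _).
exact: leq_trans h (leq_addl _ _).
Qed.

Lemma ordered_deg n mu : sorted lex_le mu -> pos_letters mu -> (deg mu <= n)%N -> ordered n mu.
Proof.
move=> h1 /allP h2 h3; rewrite /ordered h1; apply/allP => a ha.
by apply/andP; split; [exact: h2|exact: leq_trans (letter_le_deg ha) h3].
Qed.

Fixpoint all_words (e l : nat) : seq monomial :=
  if l is l'.+1 then
    [::] :: [seq a :: mu | a <- [seq (k, m) | k <- iota 0 e.+1, m <- iota 0 e.+1],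
                           mu <- all_words e l']
  else [:: [::]].

Lemma all_wordsP e l mu : (size mu <= l)%N ->
  (forall a, a \in mu -> (a.1 <= e)%N && (a.2 <= e)%N) -> mu \in all_words e l.
Proof.
elim: l mu => [|l IH] [|[k m] mu] // hs h.
rewrite inE; apply/orP; right.
apply: (allpairs_f (fun a nu => a :: nu) (s := [seq (k, m) | k <- iota 0 e.+1, m <- iota 0 e.+1])).
  have /andP[h1 h2] := h _ (mem_head _ _).
  by apply/allpairsP; exists (k, m); split=> //; rewrite mem_iota.
by apply: IH => // a ha; apply: h; rewrite inE ha orbT.
Qed.

(** Each positive letter adds at least 1 to the weight, so the length, the indices and the
    derivative orders are all at most e. The list does not depend on the rank. *)
Definition pbw_words (e : nat) : seq monomial :=
  undup [seq mu <- all_words e e | [&& sorted lex_le mu, pos_letters mu & wtU mu == e]].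

Lemma mem_pbw_words e mu :
  (mu \in pbw_words e) = [&& sorted lex_le mu, pos_letters mu & wtU mu == e].
Proof.
rewrite mem_undup mem_filter andbC andb_idl // => /and3P[_ hp /eqP he].
have hsz : (size mu <= wtU mu)%N.
  elim: mu hp {he} => // a mu IH /= /andP[ha /IH]; rewrite /wtU /=; lia.
have hl : forall a, a \in mu -> (a.1 + a.2 <= wtU mu)%N.
  move=> a {hp he hsz}; elim: mu => // b mu IH; rewrite inE => /orP[/eqP ->|/IH h].
    exact: leq_addr.
  exact: leq_trans h (leq_addl _ _).
rewrite he in hsz hl; apply: all_wordsP => // a /hl h.
by rewrite (leq_trans (leq_addr _ _) h) (leq_trans (leq_addl _ _) h).
Qed.

Lemma pbw_words_uniq e : uniq (pbw_words e).
Proof. exact: undup_uniq. Qed.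

Section SpanTransfer.
Variables (A : comNzRingType) (V V' : lmodType A).
Variables (S : vertex_structure V) (S' : vertex_structure V').
Variables (u : nat -> V) (u' : nat -> V') (Z : V -> Prop) (Z' : V' -> Prop).

Lemma spn_hom (Q Q' : monomial -> Prop) (f : V -> V') x : linear f ->
  (forall y, Z y -> spn S' u' Z' Q' (f y)) ->
  (forall mu, Q mu -> spn S' u' Z' Q' (f (nomon S u mu))) ->
  spn S u Z Q x -> spn S' u' Z' Q' (f x).
Proof.
move=> lf h0 h1; elim=> [y hy|a y y' _ hy _ hy'|mu hmu]; [exact: h0| |exact: h1].
by rewrite lf; exact: spn_lin.
Qed.

Hypothesis hA : natinv A.
Hypothesis hZ : vertex_ideal S Z.

(** Derivatives leave the indices alone, hence preserve both the degree and the presence of the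
    letter 0; [lfil_der] needs both. *)
Lemma spn_der_word mu :
  spn S u Z (fun nu => map fst nu = map fst mu) (vder S (nomon S u mu)).
Proof.
elim: mu => [|[k m] mu IH] /=; first by rewrite vder_vac; exact: (spn0 _ hZ).
rewrite vder_leibniz //; apply: spnD.
  exact: (@spn_word _ _ _ _ _ _ ((k, m.+1) :: mu)).
apply: spn_map IH => [y hy|nu hnu].
  by apply: spn_ideal; case: hZ => _ _ _; apply.
by apply: (@spn_word _ _ _ _ _ _ ((k, m) :: nu)); rewrite /= hnu.
Qed.

End SpanTransfer.

Lemma deg_fst mu nu : map fst mu = map fst nu -> deg mu = deg nu.
Proof.
by move=> h; rewrite /deg (map_comp degl fst mu) (map_comp degl fst nu) h.
Qed.

Lemma sorted_letter0 mu (a : nat * nat) : sorted lex_le mu -> a \in mu -> a.1 = 0%N ->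
  exists m nu, mu = (0%N, m) :: nu.
Proof.
case: mu => // -[k m] mu /=; move=> hp ha h0; exists m, mu.
have := order_path_min lex_le_trans hp => /allP hall.
move: ha; rewrite inE => /orP[/eqP e|/hall]; first by rewrite e in h0; rewrite -h0.
by rewrite /lex_le /= h0 => /orP[//|/andP[/eqP -> _]].
Qed.

Section HeisenbergBounds.
Variables (R : realType) (n : nat) (H : heisenberg R n) (H' : heisenberg R n.+1).

Lemma hle_hshift k (x : heis H) : hle k x -> hle k (hshift H' x).
Proof.
apply: (spn_hom (@hshift_linear R n H H')) => [y ->|mu hmu].
  by rewrite raddf0; exact: (spn0 _ (ideal0 _)).
case: (hI_wordP H mu) => [->|hs]; first by rewrite raddf0; exact: (spn0 _ (ideal0 _)).
rewrite hI_word_sort /= hshift_word //; apply: spn_word.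
have hp : perm_eq (sort lex_le mu) mu by exact/permPl/perm_sort.
by rewrite /wt1 /shiftm -map_comp -/(wt1 _) (perm_wt1 hp).
Qed.

Lemma hle_hunshift k (x : heis H') : hle k x -> hle k (hunshift H x).
Proof.
apply: (spn_hom (@hunshift_linear R n H H')) => [y ->|mu hmu].
  by rewrite raddf0; exact: (spn0 _ (ideal0 _)).
case: (hI_wordP H' mu) => [->|hs]; first by rewrite raddf0; exact: (spn0 _ (ideal0 _)).
rewrite hI_word_sort /= /hunshift basis_mapE //.
case: ifP => _; first exact: (spn0 _ (ideal0 _)).
apply: spn_word.
have hp : perm_eq (sort lex_le mu) mu by exact/permPl/perm_sort.
by rewrite /wt1 /unshiftm -map_comp -/(wt1 _) (perm_wt1 hp).
Qed.

Lemma hle_heisU k : hle k%:Z (heisU H k).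
Proof.
rewrite heisU_bU; case: eqP => [->|_]; first exact: (spn0 _ (ideal0 _)).
exact: hle_hw (hw_bU _ _).
Qed.

End HeisenbergBounds.

(** * Lifting and lowering sequences between consecutive ranks *)

Section Sequences.
Variables (R : realType) (H : forall n, heisenberg R n).
Local Notation A := (Cnuhbar R).
Local Notation H1 := (fun n => H n.+1).
Local Notation X0 := (@bdseq R (fun n => n) H).
Local Notation X1 := (@bdseq R succn H1).
Local Notation S0 := (@bseq_structure R (fun n => n) H).
Local Notation S1 := (@bseq_structure R succn H1).
Local Notation Z0 := (@ev_zero R (fun n => n) H).
Local Notation Z1 := (@ev_zero R succn H1).
Let hA := @natinv_Cnuhbar R.
Let iz0 := @ev_zero_ideal R (fun n => n) H.
Let iz1 := @ev_zero_ideal R succn H1.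
Implicit Types (mu nu : monomial) (k l d p q : nat) (s : int).

Fact seqU_bounded k : @bounded R (fun n => n) H (fun n => heisU (H n) k).
Proof. by exists k => n; exact: hle_heisU. Qed.
Fact seqU'_bounded k : @bounded R succn H1 (fun n => heisU (H n.+1) k).
Proof. by exists k => n; exact: hle_heisU. Qed.
Fact seqB_bounded k : @bounded R (fun n => n) H (fun n => bU (H n) k).
Proof. by exists k => n; exact: hle_hw (hw_bU _ _). Qed.
Fact seqJ_bounded : @bounded R succn H1 (fun n => hI (H n.+1) 1).
Proof. by exists 1%N => n; exact: hle_hw (hw_hI _ _). Qed.
Fact liftS_bounded (x : X0) : @bounded R succn H1 (fun n => hshift (H n.+1) (x n)).
Proof. by have [k h] := bseqP x; exists k => n; exact/hle_hshift/h. Qed.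
Fact lowerS_bounded (x : X1) : @bounded R (fun n => n) H (fun n => hunshift (H n) (x n)).
Proof. by have [k h] := bseqP x; exists k => n; exact/hle_hunshift/h. Qed.

Definition seqU k : X0 := mkbseq (seqU_bounded k).
Definition seqU' k : X1 := mkbseq (seqU'_bounded k).
Definition seqB k : X0 := mkbseq (seqB_bounded k).
Definition seqJ : X1 := mkbseq seqJ_bounded.
Definition liftS (x : X0) : X1 := mkbseq (liftS_bounded x).
Definition lowerS (x : X1) : X0 := mkbseq (lowerS_bounded x).

Lemma liftS_linear : linear liftS.
Proof. by move=> a x y; apply: bseq_ext => n; exact: hshift_linear. Qed.
Lemma lowerS_linear : linear lowerS.
Proof. by move=> a x y; apply: bseq_ext => n; exact: hunshift_linear. Qed.

HB.instance Definition _ := GRing.isLinear.Build A X0 X1 _ liftS liftS_linear.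
HB.instance Definition _ := GRing.isLinear.Build A X1 X0 _ lowerS lowerS_linear.

Lemma liftSK x : lowerS (liftS x) = x.
Proof. by apply: bseq_ext => n; exact: hshiftK. Qed.

Lemma liftS_ev x : Z0 x -> Z1 (liftS x).
Proof. by move=> [N h]; exists N => n /h hx; rewrite /bev /= -/(bev x n) hx raddf0. Qed.

Lemma lowerS_ev x : Z1 x -> Z0 (lowerS x).
Proof. by move=> [N h]; exists N => n /h hx; rewrite /bev /= -/(bev x n) hx raddf0. Qed.

Lemma liftS_nomon u mu : liftS (nomon S0 u mu) = nomon S1 (liftS \o u) mu.
Proof.
by apply: bseq_ext => n; rewrite bseq_nomon /bev /= -/(bev _ n) bseq_nomon hshift_nomon.
Qed.

Lemma liftS_vprod s x y : liftS (vprod S0 s x y) = vprod S1 s (liftS x) (liftS y).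
Proof. by apply: bseq_ext => n; exact: hshift_vprod. Qed.

Lemma seqU0 : seqU 0 = 0.
Proof. by apply: bseq_ext => n; rewrite /bev /= heisU_bU. Qed.

Lemma seqB_seqU k : (0 < k)%N -> seqB k = seqU k.
Proof. by case: k => // k _; apply: bseq_ext => n; rewrite /bev /= heisU_bU. Qed.

Lemma seqB0 : seqB 0 = vac S0.
Proof. by apply: bseq_ext => n; exact: bU0. Qed.

(* The letters of rank n + 1: I_1, and the U_k formed from I_2, ..., I_(n+1). *)
Definition seqT k : X1 := if k == 0%N then seqJ else liftS (seqU k).

(** U_0 = 1 is the empty word, of degree 0; the letter 0 would have degree 1 and another meaning. *)
Definition bword k : monomial := if k == 0%N then [::] else [:: (k, 0%N)].

Lemma deg_bword k : deg (bword k) = k.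
Proof. by case: k => // k; rewrite /deg /= /degl; lia. Qed.

Lemma seqB_bword k : seqB k = nomon S0 seqU (bword k).
Proof.
case: k => [|k]; first exact: seqB0.
by rewrite seqB_seqU // -[LHS](vprod_vacr S0).
Qed.

Lemma liftS_bword k : liftS (seqB k) = nomon S1 seqT (bword k).
Proof. by rewrite seqB_bword liftS_nomon; case: k. Qed.

Lemma lowerS_neg m y : lowerS (vprod S1 (-1) (iter m (vder S1) seqJ) y) = 0.
Proof.
rewrite vprod_iter_derl // raddfMz [X in X *~ _](_ : _ = 0) ?mul0rz //.
by apply: bseq_ext => n; apply: hunshift_neg; lia.
Qed.

Lemma liftS_word mu : pos_letters mu -> liftS (nomon S0 seqU mu) = nomon S1 seqT mu.
Proof.
move=> /allP h; rewrite liftS_nomon; apply: (@eq_nomon _ _ S1) => a /h ha.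
by move: ha; rewrite /seqT; case: (a.1).
Qed.

Lemma lowerS_word mu : pos_letters mu -> lowerS (nomon S1 seqT mu) = nomon S0 seqU mu.
Proof. by move=> h; rewrite -liftS_word // liftSK. Qed.

(** This is polynomiality in n: modulo [Z0], a single C[nu, hbar]-combination of words gives the
    product in all large ranks. *)
Definition poly_ope d := forall k l (s : nat), (degl k + degl l <= d)%N ->
  fil S0 seqU Z0 (degl k + degl l) (vprod S0 s (seqU k) (seqU l)).

Section Step.
Variable d : nat.
Hypothesis hd : poly_ope d.

Lemma reduced_pos mu : (forall a, a \in mu -> ~ Z0 (seqU a.1)) -> pos_letters mu.
Proof.
move=> h; apply/allP => -[k m] /h /=; case: k => // -[].
by exists 0%N => n _; rewrite seqU0.
Qed.

(** Passing to reduced words first is essential: the letter 0 is 0 in [seqU] but I_1 in [seqT]. *)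
Lemma liftS_fil p x : (p <= d.+1)%N -> fil S0 seqU Z0 p x -> fil S1 seqT Z1 p (liftS x).
Proof.
move=> hp /(fil_reduced hA iz0 hd hp); apply: (spn_hom liftS_linear) => [y h|mu [h1 h2]].
  exact/spn_ideal/liftS_ev.
by rewrite liftS_word; [exact: spn_word|apply: reduced_pos; case: h2].
Qed.

Lemma seqT_ope k l (s : nat) : (degl k + degl l <= d)%N ->
  fil S1 seqT Z1 (degl k + degl l) (vprod S1 s (seqT k) (seqT l)).
Proof.
have hdk := degl_gt0 k; have hdl := degl_gt0 l.
move=> h; rewrite /seqT; case: eqP => [_|_]; case: eqP => [_|_].
- have -> : vprod S1 s seqJ seqJ = if s == 1%N then ('X%:P : A) *: vac S1 else 0.
    apply: bseq_ext => n.
    transitivity (vprod (heisS (H n.+1)) s (hI (H n.+1) 1) (hI (H n.+1) 1)) => //.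
    rewrite hI_ope andTb; case: (s == 1%N) => //.
    by rewrite -[RHS]/(('X%:P : A).[n%:R] *: vac (heisS (H n.+1))) hornerC.
  case: ifP => _; last exact: (spn0 _ iz1).
  apply: (spnZ iz1); apply: (@spn_word _ _ S1 seqT Z1 _ [::]); rewrite /deg /=; lia.
- have -> : vprod S1 s seqJ (liftS (seqU l)) = 0; last exact: (spn0 _ iz1).
  by apply: bseq_ext => n; exact: hI1_hshift.
- have -> : vprod S1 s (liftS (seqU k)) seqJ = 0; last exact: (spn0 _ iz1).
  apply: bseq_ext => n; rewrite /bev /= -[hI _ _](vprod_vacr (heisS (H n.+1))).
  by rewrite -hI1_comm vprod_vacr_ge0 vprod0r.
- by rewrite -liftS_vprod; apply: liftS_fil; [lia|exact: hd].
Qed.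

Lemma lowerS_sorted mu : sorted lex_le mu -> ~~ pos_letters mu ->
  lowerS (nomon S1 seqT mu) = 0.
Proof.
move=> h1 /allPn[a ha]; rewrite -eqn0Ngt => /eqP h0.
by have [m [nu ->]] := sorted_letter0 h1 ha h0; exact: lowerS_neg.
Qed.

Lemma lowerS_fil p x : (p <= d.+1)%N -> fil S1 seqT Z1 p x -> fil S0 seqU Z0 p (lowerS x).
Proof.
move=> hp /(fil_reduced hA iz1 seqT_ope hp); apply: (spn_hom lowerS_linear) => [y h|mu [h1 [h2 _]]].
  exact/spn_ideal/lowerS_ev.
case: (boolP (pos_letters mu)) => h; first by rewrite lowerS_word //; exact: spn_word.
by rewrite lowerS_sorted //; exact: (spn0 _ iz0).
Qed.

(** The letter 0 is the smallest, so sorting brings I_1 to the front, where [lowerS] kills the word.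
    Sorting itself costs only lower degree. *)
Lemma lowerS_word0 mu : ~~ pos_letters mu -> (deg mu <= d)%N ->
  fil S0 seqU Z0 (deg mu) (lowerS (nomon S1 seqT mu)).
Proof.
move=> h1 h2; have hp : perm_eq mu (sort lex_le mu).
  by rewrite perm_sym; exact/permPl/perm_sort.
rewrite -[nomon S1 seqT mu](subrK (nomon S1 seqT (sort lex_le mu))) raddfD /=.
rewrite (lowerS_sorted (sort_sorted lex_le_total _)) ?addr0.
  by apply: lowerS_fil; [lia|exact: (fil_perm hA iz1 seqT_ope hp h2)].
by rewrite /pos_letters all_sort.
Qed.

(* The part of the filtration killed by [lowerS], up to lower degree. *)
Definition lfil p := spn S1 seqT Z1
  (fun nu => (deg nu < p)%N \/ (deg nu <= p)%N /\ ~~ pos_letters nu).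

Lemma fil_lfil p x : fil S1 seqT Z1 p x -> lfil p x.
Proof. by apply: spn_mono => mu h; left. Qed.

Lemma lfil_fil p x : lfil p x -> fil S1 seqT Z1 p.+1 x.
Proof. by apply: spn_mono => mu; lia. Qed.

Lemma lfil_der p x : lfil p x -> lfil p (vder S1 x).
Proof.
apply: spn_map => [y hy|mu hmu]; first by apply: spn_ideal; exact: (ideal_der iz1).
have := @spn_der_word A _ S1 seqT Z1 hA iz1 mu; apply: spn_mono => nu h.
have -> : deg nu = deg mu by exact: deg_fst.
suff -> : pos_letters nu = pos_letters mu by [].
rewrite /pos_letters -(all_map fst (fun k => 0 < k)%N) h.
by rewrite (all_map fst (fun k => 0 < k)%N).
Qed.

Lemma lfil_prod p q x y : (p + q <= d)%N -> lfil p x -> fil S1 seqT Z1 q.+1 y ->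
  lfil (p + q) (vprod S1 (-1) x y).
Proof.
move=> hpq; apply: (spn_prod iz1) => mu nu [hmu|[hmu h0]] hnu.
  apply: fil_lfil; have -> : (p + q)%N = (p + q.+1).-1 by lia.
  by apply: (fil_prod hA iz1 seqT_ope); [lia|exact: spn_word|exact: spn_word].
rewrite -[vprod _ _ _ _](subrK (nomon S1 seqT (mu ++ nu))); apply: spnD.
  apply: fil_lfil; apply: (@fil_mono _ _ _ _ _ (deg mu + deg nu)); first by lia.
  by apply: (fil_cat hA iz1 seqT_ope); lia.
apply: spn_word; right; rewrite deg_cat; split; first by lia.
by rewrite /pos_letters all_cat negb_and h0.
Qed.

Lemma seqU'_succ k : Z1 (seqU' k.+1
  - (liftS (seqU k.+1) + (liftS (vder S0 (seqB k)) + vprod S1 (-1) seqJ (liftS (seqB k))))).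
Proof.
(* [bU_succ] requires k + 1 <= n, so the relation holds only modulo eventually zero sequences. *)
exists k.+1 => n hn.
change (heisU (H n.+1) k.+1 - (hshift (H n.+1) (heisU (H n) k.+1) +
  (hshift (H n.+1) (vder (heisS (H n)) (bU (H n) k)) +
   vprod (heisS (H n.+1)) (-1) (hI (H n.+1) 1) (hshift (H n.+1) (bU (H n) k)))) = 0).
by rewrite !heisU_bU /= (bU_succ (H n) (H n.+1) hn) raddfD /= addrA subrr.
Qed.

(** The derivative of U_k has degree at most k, and I_1 U_k has degree k + 1 but contains the letter
    0. *)
Lemma seqU'_lfil k : (k.+1 <= d)%N -> lfil k.+1 (seqU' k.+1 - seqT k.+1).
Proof.
move=> hk; set r := liftS (vder S0 (seqB k)) + vprod S1 (-1) seqJ (liftS (seqB k)).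
have -> : seqU' k.+1 - seqT k.+1 = (seqU' k.+1 - (liftS (seqU k.+1) + r)) + r.
  have gen (U : zmodType) (x l t : U) : x - l = x - (l + t) + t.
    by rewrite opprD addrA subrK.
  exact: gen.
apply: spnD; first by apply: spn_ideal; exact: seqU'_succ.
apply: spnD.
  apply: fil_lfil; apply: liftS_fil; first by lia.
  apply: (fil_der hA iz0); rewrite seqB_bword; apply: spn_word.
  by rewrite deg_bword.
rewrite liftS_bword; apply: (@spn_word _ _ _ _ _ _ ((0%N, 0%N) :: bword k)); right.
by rewrite deg_cons deg_bword.
Qed.

Lemma word_lfil mu : pos_letters mu -> (deg mu <= d)%N ->
  lfil (deg mu) (nomon S1 seqU' mu - nomon S1 seqT mu).
Proof.
elim: mu => [|[k m] mu IH]; first by move=> _ _ /=; rewrite subrr; exact: (spn0 _ iz1).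
case: k => // k hpos; have {}hpos : pos_letters mu by [].
rewrite deg_cons /= => hdeg; have hk : degl k.+1 = k.+1 by rewrite /degl; lia.
rewrite hk in hdeg *.
have {}IH : lfil (deg mu) (nomon S1 seqU' mu - nomon S1 seqT mu) by apply: IH; lia.
set a := iter m _ (seqU' _); set b := iter m _ (seqT _).
have hab : lfil k.+1 (a - b).
  have -> : a - b = iter m (vder S1) (seqU' k.+1 - seqT k.+1).
    by rewrite /a /b; elim: (m) => // i IHi; rewrite !iterS -IHi raddfB.
  elim: (m) => [|i IHi]; first by apply: seqU'_lfil; lia.
  exact: lfil_der.
have -> : vprod S1 (-1) a (nomon S1 seqU' mu) - vprod S1 (-1) b (nomon S1 seqT mu)
   = vprod S1 (-1) (a - b) (nomon S1 seqU' mu)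
     + vprod S1 (-1) b (nomon S1 seqU' mu - nomon S1 seqT mu).
  by rewrite vprodBl vprodBr addrA subrK.
apply: spnD.
  apply: lfil_prod => //; rewrite -[nomon S1 seqU' mu](subrK (nomon S1 seqT mu)).
  by apply: spnD; [exact: lfil_fil|exact: fil_word].
apply: spn_map IH => [y hy|nu hnu]; first by apply: spn_ideal; case: iz1 => _ _ _; apply.
apply: (@spn_word _ _ _ _ _ _ ((k.+1, m) :: nu)).
rewrite deg_cons /= hk; case: hnu => [h|[h h0]]; [left|right]; first by lia.
by split; first lia.
Qed.

(** Passing from U to U' and lowering is thus unitriangular on words with respect to the degree,
    which makes the induction on coefficients in [step_fil_x] possible. *)
Lemma lowerS_word_fil mu : pos_letters mu -> (deg mu <= d)%N ->
  fil S0 seqU Z0 (deg mu) (lowerS (nomon S1 seqU' mu) - nomon S0 seqU mu).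
Proof.
move=> hpos hdeg; rewrite -(lowerS_word hpos) -raddfB /=.
apply: (spn_hom lowerS_linear) (word_lfil hpos hdeg) => [y h|nu [h|[h h0]]].
- exact/spn_ideal/lowerS_ev.
- by apply: (@lowerS_fil (deg mu)); [exact: leq_trans hdeg (leqnSn d)|exact: spn_word].
- by apply: (fil_mono h); apply: lowerS_word0 => //; exact: leq_trans h hdeg.
Qed.

End Step.
End Sequences.

Section Lukyanov.
Variables (R : realType) (n : nat) (H : heisenberg R n).
Local Notation V := (heis H).
Local Notation S := (heisS H).
Local Notation M := {malg (Chbar R)[seq (nat * nat)]}.
Local Notation e := (nomon S (heisU H)).
Implicit Types (c : M) (mu : monomial) (s : int).

Lemma Wmon_val mu : subva_val (Wmon H mu) = e mu.
Proof.
elim: mu => //= -[k m] mu <-; congr (vprod _ _ _ _).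
by elim: m => //= m <-.
Qed.

Lemma Wlincomb_val c : subva_val (lincomb (Wmon H) c) = lincomb e c.
Proof.
apply: (etrans (raddf_sum (val : {additive W H -> V}) _ _ _)); apply: eq_bigr => mu _.
by rewrite -Wmon_val; exact: (linearZ_LR (val : {linear W H -> V})).
Qed.

Hypothesis luk : is_basis (ordered n) (Wmon H).

Lemma lincombU_inj c c' : {subset msupp c <= ordered n} -> {subset msupp c' <= ordered n} ->
  lincomb e c = lincomb e c' -> c = c'.
Proof.
move=> hc hc'; rewrite -!Wlincomb_val => /val_inj h.
by rewrite -(bcoord_uniq luk hc h) (bcoord_uniq luk hc' erefl).
Qed.

Lemma hw_heisU k : hw k%:Z (heisU H k).
Proof. by rewrite heisU_bU; case: eqP => [->|_]; [exact: hw0|exact: hw_bU]. Qed.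

Lemma hw_word mu : hw (wtU mu)%:Z (e mu).
Proof.
have hD k m : hw (k + m)%N%:Z (iter m (vder S) (heisU H k)).
  elim: m => [|m IH]; first by rewrite addn0; exact: hw_heisU.
  by rewrite addnS -addn1 PoszD; exact: hw_der.
elim: mu => [|[k m] mu IH]; first exact: hw_vac.
have -> : (wtU ((k, m) :: mu))%:Z = (k + m)%N%:Z + (wtU mu)%:Z - (-1) - 1.
  by rewrite /wtU /=; lia.
exact: hw_prod.
Qed.

(** Existence of coordinates is Lukyanov's theorem. Projecting the expansion to the weight of the
    product and comparing coordinates excludes words of any other weight. *)
Lemma vprodU_coord k l s : exists c, [/\ {subset msupp c <= ordered n},
  forall mu, mu \in msupp c -> (wtU mu)%:Z = k%:Z + l%:Z - s - 1
  & vprod S s (heisU H k) (heisU H l) = lincomb e c].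
Proof.
set x := vprod _ _ _ _; set t := _ - 1.
have hx : hw t x.
  by apply: hw_prod; exact: hw_heisU.
pose c := bcoord luk (vprod (WS H) s (WU H k) (WU H l)).
have hc : {subset msupp c <= ordered n} by exact: bcoord_supp.
have xE : x = lincomb e c by rewrite -Wlincomb_val bcoordK.
exists c; split=> // mu hmu; apply/eqP; move: hmu.
pose r := [seq mu <- enum_fset (msupp c) | (wtU mu)%:Z == t].
have ur : uniq r by rewrite filter_uniq ?fset_uniq.
suff -> : c = \sum_(mu <- r) << c@_mu *g mu >>.
  by move=> /(msupp_sumU ur); rewrite mem_filter => /andP[].
apply: lincombU_inj => //.
  by move=> nu /(msupp_sumU ur); rewrite mem_filter => /andP[_ /hc].
rewrite -xE lincomb_sumU big_filter.
have := hw_projE t hx; rewrite eqxx {1}xE => <-.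
rewrite /lincomb raddf_sum [RHS]big_mkcond; apply: eq_bigr => nu _.
have sc a y : hw_proj t (a *: y) = a *: hw_proj t y by exact: linearZ_LR.
rewrite /= sc (hw_projE _ (hw_word nu)); case: ifP => _ //.
by rewrite scaler0.
Qed.

End Lukyanov.

(** * Polynomiality of the OPE coefficients *)

Section Polynomiality.
Variables (R : realType) (H : forall n, heisenberg R n).
Hypothesis luk : forall n, is_basis (ordered n) (Wmon (H n)).
Local Notation A := (Cnuhbar R).
Local Notation H1 := (fun n => H n.+1).
Local Notation X0 := (@bdseq R (fun n => n) H).
Local Notation S0 := (@bseq_structure R (fun n => n) H).
Local Notation S1 := (@bseq_structure R succn H1).
Local Notation Z0 := (@ev_zero R (fun n => n) H).
Local Notation sU := (seqU H).
Local Notation sU' := (seqU' H).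
Local Notation sB := (seqB H).
Local Notation M := {malg A[seq (nat * nat)]}.
Let hA := @natinv_Cnuhbar R.
Let iz0 := @ev_zero_ideal R (fun n => n) H.
Implicit Types (mu nu : monomial) (k l d p q n : nat).
Local Notation e n := (nomon (heisS (H n)) (heisU (H n))).

Lemma seqU_word n mu : nomon S0 sU mu n = e n mu.
Proof. exact: bseq_nomon. Qed.

Lemma seqU_lincomb n (P : M) : lincomb (nomon S0 sU) P n = lincomb (e n) (evalm n P).
Proof.
rewrite bseq_lincomb lincomb_evalm; apply: eq_bigr => mu _.
by rewrite seqU_word.
Qed.

Lemma fil_coord d p (x : X0) : poly_ope H d -> (p <= d.+1)%N -> fil S0 sU Z0 p x ->
  exists P : M,
    (forall mu, mu \in msupp P -> [/\ (deg mu < p)%N, sorted lex_le mu & pos_letters mu])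
    /\ exists N : nat, forall n, (N <= n)%N -> x n = lincomb (e n) (evalm n P).
Proof.
move=> hd hp /(fil_reduced hA iz0 hd hp) /(@spn_lincombE _ _ S0 _ _ iz0)[P [hP [N hN]]].
exists P; split.
  by move=> mu /hP[h1 [h2 h3]]; split=> //; exact: (@reduced_pos R H).
by exists N => n /hN; rewrite bseqBE seqU_lincomb => /subr0_eq.
Qed.

Section Step.
Variables (d i j s : nat).
Hypothesis hd : poly_ope H d.
Hypothesis hij : (i.+1 + j.+1 = d.+1)%N.
Hypothesis hs : (s < d.+1)%N.

Let a := sU i.+1 + vder S0 (sB i).
Let b := sU j.+1 + vder S0 (sB j).
Let x := vprod S0 s (sU i.+1) (sU j.+1).
(** What lowering U'_(i+1) (s) U'_(j+1) produces besides [x]. Its products have index sum at most d,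
    so they are already known to be polynomial. *)
Let g := (vprod S0 s a b - x) + ('X%:P : A) *: vprod S0 (s%:Z - 2) (sB i) (sB j).

Lemma step_fil_g : fil S0 sU Z0 d.+1 g.
Proof.
have fB k : fil S0 sU Z0 k.+1 (sB k).
  by rewrite seqB_bword; apply: spn_word; rewrite deg_bword.
have fU k : fil S0 sU Z0 k.+2 (sU k.+1) by rewrite -seqB_seqU.
have fdB k : fil S0 sU Z0 k.+1 (vder S0 (sB k)) by apply: (fil_der hA iz0).
apply: spnD; last first.
  apply: (spnZ iz0); apply: (@fil_mono _ _ _ _ _ (i.+1 + j.+1).-1); first by lia.
  by apply: (fil_prod hA iz0 hd); [lia|exact: fB|exact: fB].
have -> : vprod S0 s a b - x = vprod S0 s (sU i.+1) (vder S0 (sB j))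
   + vprod S0 s (vder S0 (sB i)) b.
  by rewrite /a vprodDl {1}/b vprodDr -/x addrAC [x + _]addrC addrK.
apply: spnD.
  apply: (@fil_mono _ _ _ _ _ (i.+2 + j.+1).-1); first by lia.
  by apply: (fil_prod hA iz0 hd); [lia|exact: fU|exact: fdB].
rewrite vprodDr; apply: spnD.
  apply: (@fil_mono _ _ _ _ _ (i.+1 + j.+2).-1); first by lia.
  by apply: (fil_prod hA iz0 hd); [lia|exact: fdB|exact: fU].
apply: (@fil_mono _ _ _ _ _ (i.+1 + j.+1).-1); first by lia.
by apply: (fil_prod hA iz0 hd); [lia|exact: fdB|exact: fdB].
Qed.

Lemma step_lower n : (d.+1 <= n)%N ->
  hunshift (H n) (x n.+1) = x n + g n.
Proof.
move=> hn.
have e1 k : (k.+1 <= n)%N -> heisU (H n.+1) k.+1 =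
    hshift (H n.+1) (heisU (H n) k.+1 + vder (heisS (H n)) (bU (H n) k))
    + vprod (heisS (H n.+1)) (-1) (hI (H n.+1) 1) (hshift (H n.+1) (bU (H n) k)).
  by move=> hk; rewrite !heisU_bU /= (bU_succ (H n) (H n.+1) hk).
transitivity (hunshift (H n) (vprod (heisS (H n.+1)) s
    (heisU (H n.+1) i.+1) (heisU (H n.+1) j.+1))); first by [].
rewrite !e1; [|lia|lia]; rewrite hunshift_vprod.
rewrite /g bseqDE bseqBE addrA [x n + _]addrC subrK; congr (_ + _).
by rewrite bseqZE hornerC.
Qed.

Lemma step_fil_x : fil S0 sU Z0 d.+1 x.
Proof.
(* The weight of the product is (i+1) + (j+1) - s - 1 = d - s. Hence one finite list [F] contains
   the words that occur in any rank. *)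
pose w0 := (d - s)%N; pose F := pbw_words w0.
have hF mu : mu \in F -> [/\ sorted lex_le mu, pos_letters mu, wtU mu = w0 & (deg mu <= d)%N].
  rewrite mem_pbw_words => /and3P[h1 h2 /eqP h3]; split=> //.
  by have := deg_le_wtU h2; rewrite h3 /w0; lia.
have /choice[C hC] : forall n, exists c : {malg (Chbar R)[seq (nat * nat)]},
    [/\ {subset msupp c <= ordered n}, forall mu, mu \in msupp c -> mu \in F
      & x n = lincomb (e n) c].
  move=> n; have [c [h1 h2 h3]] := vprodU_coord (@luk n) i.+1 j.+1 s.
  exists c; split=> // mu hmu; rewrite mem_pbw_words.
  have [-> -> _] := orderedE (h1 _ hmu).
  by apply/eqP; have := h2 _ hmu; rewrite /w0; lia.
have [Pg [hPg [Ng hNg]]] := fil_coord hd (leqnn _) step_fil_g.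
have /choice[Q hQ] : forall mu, exists P : M, mu \in F ->
    (forall nu, nu \in msupp P -> [/\ (deg nu < deg mu)%N, sorted lex_le nu & pos_letters nu])
    /\ exists N : nat, forall n, (N <= n)%N ->
      hunshift (H n) (e n.+1 mu) = e n mu + lincomb (e n) (evalm n P).
  move=> mu; case: (boolP (mu \in F)) => hmu; last by exists 0.
  have [_ hpos _ hdeg] := hF _ hmu.
  have [P [hP [N hN]]] := fil_coord hd (leq_trans hdeg (leqnSn d)) (lowerS_word_fil hd hpos hdeg).
  exists P => _; split=> //; exists N => n /hN.
  rewrite bseqBE seqU_word => /eqP; rewrite subr_eq addrC => /eqP <-.
  by have <- : nomon S1 sU' mu n = e n.+1 mu by exact: (@bseq_nomon R succn H1).
have /choice[NQ hNQ] : forall mu, exists N : nat, mu \in F -> forall n, (N <= n)%N ->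
      hunshift (H n) (e n.+1 mu) = e n mu + lincomb (e n) (evalm n (Q mu)).
  move=> mu; case: (boolP (mu \in F)) => hmu; last by exists 0%N.
  by have [_ [N hN]] := hQ mu hmu; exists N => _.
(* Beyond d + 1 [step_lower] applies and all words of degree at most d are ordered; the other two
   bounds come from the expansions of [g] and of the lowered words. *)
pose N0 := maxn d.+1 (maxn Ng (\max_(mu <- F) NQ mu)).
(* The lowered [x n.+1] is expanded twice, as [x n + g n] and word by word. Independence of the
   ordered words in rank n allows the coefficients of [la] to be compared. *)
have coefE n la : (N0 <= n)%N -> la \in F ->
    (C n.+1)@_la - (C n)@_la = (Pg@_la).[n%:R] - \sum_(mu <- F) (C n.+1)@_mu * ((Q mu)@_la).[n%:R].
  rewrite /N0 !geq_max => /and3P[hn1 hn2 hn3] hla.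
  have hNQn mu : mu \in F -> (NQ mu <= n)%N.
    by move=> hmu; apply: leq_trans hn3; apply: leq_bigmax_seq.
  have hord mu : sorted lex_le mu -> pos_letters mu -> (deg mu <= d)%N -> ordered n mu.
    by move=> h1 h2 h3; apply: ordered_deg => //; lia.
  pose c1 := C n + evalm n Pg.
  pose c2 := \sum_(mu <- F) (C n.+1)@_mu *: (<< mu >> + evalm n (Q mu)).
  have E : c1 = c2.
    apply: (lincombU_inj (@luk n)).
    - move=> mu /(fsubsetP (msuppD_le _ _)); rewrite in_fsetU => /orP[|/msupp_evalm].
        by have [h _ _] := hC n; exact: h.
      by move=> /hPg[h1 h2 h3]; apply: hord => //; lia.
    - move=> mu; rewrite -mcoeff_neq0 raddf_sum /=; apply: contraR => hmu.
      rewrite big_seq big1 // => nu hnu; rewrite mcoeffZ mcoeffD mcoeff_evalm mcoeffU.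
      have [h1 h2 _ h3] := hF _ hnu.
      case: eqP => [E|_]; first by case/negP: hmu; rewrite -E; exact: hord.
      have [h4 _] := hQ nu hnu.
      case: (boolP (mu \in msupp (Q nu))) => hmQ.
        by have [h5 h6 h7] := h4 _ hmQ; case/negP: hmu; apply: hord => //; lia.
      by rewrite mulr0n (mcoeff_outdom hmQ) horner0 addr0 mulr0.
    - rewrite /c1 raddfD /= -hNg //; have [_ _ <-] := hC n.
      rewrite -step_lower //; have [_ hsup ->] := hC n.+1.
      have -> : C n.+1 = \sum_(mu <- F) << (C n.+1)@_mu *g mu >>.
        apply/malgP => mu; rewrite mcoeff_sumU ?pbw_words_uniq //.
        case: ifP => // /negbT h; apply: mcoeff_outdom.
        by apply: contra h; exact: hsup.
      rewrite lincomb_sumU !raddf_sum big_seq [RHS]big_seq; apply: eq_bigr => mu hmu /=.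
      rewrite [LHS]linearZ_LR [RHS]linearZ_LR /= hNQ ?hNQn //; congr (_ *: _).
      by rewrite -[<< mu >>]scale1r lincomb_linear lincombU !scale1r.
  have := congr1 (mcoeff la) E; rewrite /c1 /c2 mcoeffD mcoeff_evalm raddf_sum /=.
  under eq_bigr do rewrite mcoeffZ mcoeffD mulrDr mcoeff_evalm.
  rewrite big_split /=.
  have -> : \sum_(mu <- F) (C n.+1)@_mu * (<< mu >> : {malg (Chbar R)[seq (nat * nat)]})@_la
      = (C n.+1)@_la.
    rewrite (bigD1_seq la) ?pbw_words_uniq //= mcoeffUU mulr1 big1 ?addr0 // => mu hmu.
    by rewrite mcoeffU (negPf hmu) mulr0.
  move=> h; apply/eqP; rewrite subr_eq addrAC -subr_eq opprK; apply/eqP.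
  by rewrite -h addrC.
(* Downward induction on the degree: only words of degree larger than that of [la]
   occur in the sum of [coefE]. *)
have evC m la : la \in F -> (w0 - deg la < m)%N -> evpoly (fun n => (C n)@_la).
  elim: m la => // m IH la hla hm.
  apply: (evpoly_difference (@natinv_Chbar R)).
  apply: (@eq_evpoly _ _ _ N0 (fun n hn => esym (coefE n la hn hla))).
  apply: evpolyD; first exact: evpolyP.
  apply: evpolyN; apply: evpoly_sum => mu hmu.
  have [hQ1 _] := hQ mu hmu; have [_ hpos hw _] := hF _ hmu.
  case: (boolP (la \in msupp (Q mu))) => hlQ; last first.
    apply: (@eq_evpoly _ (fun=> 0) _ 0%N); last exact: evpoly0.
    by move=> n _; rewrite (mcoeff_outdom hlQ) horner0 mulr0.
  apply: evpolyM; last exact: evpolyP.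
  apply: (@evpoly_shift _ (fun n => (C n)@_mu)); apply: IH => //.
  have [hlt _ _] := hQ1 _ hlQ; have := deg_le_wtU hpos; rewrite hw; lia.
have /choice[p hp] : forall la, exists P : {poly Chbar R}, exists N : nat, la \in F ->
    forall n, (N <= n)%N -> (C n)@_la = P.[n%:R].
  move=> la; case: (boolP (la \in F)) => hla; last by exists 0, 0%N.
  by have [P [N h]] := evC _ la hla (ltnSn _); exists P, N.
have {hp}/choice[N hN] := hp.
have -> : x = (x - \sum_(mu <- F) p mu *: nomon S0 sU mu) + \sum_(mu <- F) p mu *: nomon S0 sU mu.
  by rewrite subrK.
apply: spnD; last first.
  apply: (spn_sum iz0) => mu /hF[_ _ _ hdeg]; apply: (spnZ iz0); exact: spn_word.
apply: spn_ideal; exists (\max_(mu <- F) N mu) => n hn.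
rewrite bseqBE bseq_sumE; have [_ hsup ->] := hC n.
have -> : C n = \sum_(mu <- F) << (C n)@_mu *g mu >>.
  apply/malgP => mu; rewrite mcoeff_sumU ?pbw_words_uniq //.
  case: ifP => // /negbT h; apply: mcoeff_outdom.
  by apply: contra h; exact: hsup.
rewrite lincomb_sumU -sumrB big_seq big1 // => mu hmu.
rewrite bseqZE seqU_word (hN mu hmu) ?subrr //.
by apply: leq_trans hn; apply: leq_bigmax_seq.
Qed.

End Step.

Lemma poly_ope_all d : poly_ope H d.
Proof.
elim: d => [|d IH] k l s; first by have := degl_gt0 k; lia.
move=> h; case: (leqP (degl k + degl l) d) => h'; first exact: IH.
case: k h h' => [|i] h h'; first by rewrite seqU0 vprod0l; exact: (spn0 _ iz0).
case: l h h' => [|j] h h'; first by rewrite seqU0 vprod0r; exact: (spn0 _ iz0).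
have hi : degl i.+1 = i.+1 by rewrite /degl; lia.
have hj : degl j.+1 = j.+1 by rewrite /degl; lia.
rewrite hi hj in h h' *.
have hij : (i.+1 + j.+1 = d.+1)%N by lia.
rewrite hij; case: (ltnP s d.+1) => hs; first exact: step_fil_x.
have -> : vprod S0 s (sU i.+1) (sU j.+1) = 0; last exact: (spn0 _ iz0).
apply: bseq_ext => n.
by apply: (hle_prod0 (hle_heisU (H n) i.+1) (hle_heisU (H n) j.+1)); lia.
Qed.

End Polynomiality.

(** * The limit *)

Section Transport.
Variables (A : comNzRingType) (X V : lmodType A) (S : vertex_structure X).
Variable Z : X -> Prop.
Hypothesis hZ : vertex_ideal S Z.
Variable f : {linear V -> X}.
Hypothesis f_inj : forall v, Z (f v) -> v = 0.
Hypothesis f_vac : exists v, f v = vac S.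
Hypothesis f_prod : forall s v w, exists t, Z (f t - vprod S s (f v) (f w)).

Implicit Types (x y z : X) (v w t : V) (s : int).

(** Each axiom is checked in X up to this congruence, after applying [f]; [f_inj] then turns it into
    an equality in V. *)
Let eqZ x y := Z (x - y).

Let Z0 : Z 0. Proof. by case: hZ. Qed.
Let ZD x y : Z x -> Z y -> Z (x + y).
Proof. by case: hZ => _ h _ _ hx hy; rewrite -[x]scale1r; exact: h. Qed.
Let ZZ a x : Z x -> Z (a *: x).
Proof. by case: hZ => h0 h _ _ hx; rewrite -[_ *: _]addr0; exact: h. Qed.
Let ZN x : Z x -> Z (- x).
Proof. by move=> h; rewrite -scaleN1r; exact: ZZ. Qed.

Let eqZ_refl x : eqZ x x. Proof. by rewrite /eqZ subrr. Qed.
Let eqZ_sym x y : eqZ x y -> eqZ y x.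
Proof. by move=> /ZN; rewrite opprB. Qed.
Let eqZ_trans x y z : eqZ x y -> eqZ y z -> eqZ x z.
Proof. by move=> h h'; have := ZD h h'; rewrite addrA subrK. Qed.
Let eqZD x x' y y' : eqZ x x' -> eqZ y y' -> eqZ (x + y) (x' + y').
Proof. by move=> h h'; rewrite /eqZ opprD addrACA; exact: ZD. Qed.
Let eqZN x x' : eqZ x x' -> eqZ (- x) (- x').
Proof. by move=> h; rewrite /eqZ -opprD; exact: ZN. Qed.
Let eqZZ a x x' : eqZ x x' -> eqZ (a *: x) (a *: x').
Proof. by move=> h; rewrite /eqZ -scalerBr; exact: ZZ. Qed.
Let eqZMz x x' (n : int) : eqZ x x' -> eqZ (x *~ n) (x' *~ n).
Proof. by move=> h; rewrite -!scaler_int; exact: eqZZ. Qed.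
Let eqZ_sum (n : nat) (F G : 'I_n -> X) : (forall i, eqZ (F i) (G i)) ->
  eqZ (\sum_(i < n) F i) (\sum_(i < n) G i).
Proof. by move=> h; elim/big_rec2: _ => // i x y _; exact: eqZD. Qed.
Let eqZ_prod s x x' y y' : eqZ x x' -> eqZ y y' -> eqZ (vprod S s x y) (vprod S s x' y').
Proof.
move=> h h'; case: hZ => _ _ hl hr.
apply: (@eqZ_trans _ (vprod S s x' y)).
  by rewrite /eqZ -vprodBl; exact: hl.
by rewrite /eqZ -vprodBr; exact: hr.
Qed.
Let eqZ_inj v w : eqZ (f v) (f w) -> v = w.
Proof. by rewrite /eqZ -raddfB => /f_inj /subr0_eq. Qed.

Definition tvac : V := projT1 (cid f_vac).
Definition tprod s v w : V := projT1 (cid (f_prod s v w)).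
Definition tder v : V := tprod (-2) v tvac.

Let tvacE : f tvac = vac S. Proof. by rewrite /tvac; case: cid. Qed.
Let tprodE s v w : eqZ (f (tprod s v w)) (vprod S s (f v) (f w)).
Proof. by rewrite /tprod; case: cid. Qed.
Let tprodE' s v w x y : eqZ (f v) x -> eqZ (f w) y -> eqZ (f (tprod s v w)) (vprod S s x y).
Proof. by move=> hx hy; apply: eqZ_trans (tprodE _ _ _) _; exact: eqZ_prod. Qed.
Let tderE v : eqZ (f (tder v)) (vder S (f v)).
Proof. by rewrite vderE -tvacE; exact: tprodE. Qed.

Fact tprod_linearl s w : linear (fun v => tprod s v w).
Proof.
move=> a v v'; apply: eqZ_inj; apply: eqZ_trans (tprodE _ _ _) _.
rewrite !linearP vprodDl vprodZl; apply: eqZ_sym; apply: eqZD; last exact: tprodE.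
by apply: eqZZ; exact: tprodE.
Qed.

Fact tprod_linearr s v : linear (tprod s v).
Proof.
move=> a w w'; apply: eqZ_inj; apply: eqZ_trans (tprodE _ _ _) _.
rewrite !linearP; apply: eqZ_sym; apply: eqZD; last exact: tprodE.
by apply: eqZZ; exact: tprodE.
Qed.

Fact tder_linear : linear tder.
Proof. exact: tprod_linearl. Qed.

Fact tprod_field v w : exists N : nat, forall s : nat, (N <= s)%N -> tprod s v w = 0.
Proof.
have [N h] := vprod_field S (f v) (f w); exists N => s hs; apply: eqZ_inj.
by rewrite raddf0 -(h s hs); exact: tprodE.
Qed.

Fact tprod_vacl s v : tprod s tvac v = if s == -1 then v else 0.
Proof.
apply: eqZ_inj; apply: eqZ_trans (tprodE _ _ _) _.
by rewrite tvacE vprod_vacl; case: ifP => _; rewrite ?raddf0; exact: eqZ_refl.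
Qed.

Fact tprod_vacr v : tprod (-1) v tvac = v.
Proof.
apply: eqZ_inj; apply: eqZ_trans (tprodE _ _ _) _.
by rewrite tvacE vprod_vacr; exact: eqZ_refl.
Qed.

Fact tprod_vacr_ge0 (s : nat) v : tprod s v tvac = 0.
Proof.
apply: eqZ_inj; apply: eqZ_trans (tprodE _ _ _) _.
by rewrite tvacE vprod_vacr_ge0 raddf0; exact: eqZ_refl.
Qed.

Fact tder_vac : tder tvac = 0.
Proof.
apply: eqZ_inj; apply: eqZ_trans (tderE _) _.
by rewrite tvacE vder_vac raddf0; exact: eqZ_refl.
Qed.

Fact tder_prod s v w : tder (tprod s v w) - tprod s v (tder w) = tprod (s - 1) v w *~ (- s).
Proof.
apply: eqZ_inj; rewrite raddfB raddfMz /=.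
apply: (@eqZ_trans _ (vder S (vprod S s (f v) (f w)) - vprod S s (f v) (vder S (f w)))).
  apply: eqZD; last by apply: eqZN; apply: tprodE' => //; exact: tderE.
  apply: eqZ_trans (tderE _) _; rewrite !vderE; apply: eqZ_prod => //; exact: tprodE.
by rewrite vder_prod; apply/eqZMz/eqZ_sym/tprodE.
Qed.

Fact tprod_local v w : exists N : nat, forall (p q : int) t,
  \sum_(i < N.+1) ((-1) ^+ i * 'C(N, i)%:R) *:
     (tprod (p + N%:Z - i%:Z) v (tprod (q + i%:Z) w t)
      - tprod (q + i%:Z) w (tprod (p + N%:Z - i%:Z) v t)) = 0.
Proof.
have [N h] := vprod_local S (f v) (f w); exists N => p q t; apply: eqZ_inj.
rewrite raddf0 -(h p q (f t)) raddf_sum; apply: eqZ_sum => i.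
rewrite [X in eqZ X _](linearZ_LR f) raddfB; apply: eqZZ; apply: eqZD; last apply: eqZN.
  by apply: tprodE' => //; exact: tprodE.
by apply: tprodE' => //; exact: tprodE.
Qed.

Definition transport_structure : vertex_structure V :=
  @VertexStructure A V tvac tder tprod tder_linear tprod_linearl tprod_linearr
    tprod_field tprod_vacl tprod_vacr tprod_vacr_ge0 tder_vac tder_prod tprod_local.

Lemma transport_prod s v w :
  Z (f (vprod transport_structure s v w) - vprod S s (f v) (f w)).
Proof. exact: tprodE. Qed.

Lemma transport_nomon (u : nat -> V) (mu : monomial) :
  Z (f (nomon transport_structure u mu) - nomon S (f \o u) mu).
Proof.
elim: mu => [|a mu IH] /=; first by rewrite tvacE subrr.
apply: tprodE' => //; elim: (a.2) => [|m IHm] //=.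
by apply: eqZ_trans (tderE _) _; rewrite !vderE; exact: eqZ_prod.
Qed.

End Transport.

Lemma natinv_natr_neq0 (B : comNzRingType) (m : nat) : natinv B -> m.+1%:R != 0 :> B.
Proof.
move=> h; have [a ha] := h m; apply/eqP => e.
by move: ha; rewrite e mulr0 => /esym/eqP; rewrite oner_eq0.
Qed.

(** [natinv] makes the natural numbers distinct in B, so P would have more roots than its degree
    allows. *)
Lemma poly_ev_eq0 (B : idomainType) (P : {poly B}) (N : nat) : natinv B ->
  (forall n, (N <= n)%N -> P.[n%:R] = 0) -> P = 0.
Proof.
move=> hB h; apply/eqP/negPn/negP => hP.
pose rs : seq B := [seq (N + i)%:R | i <- iota 0 (size P)].
have hr : all (root P) rs.
  by apply/allP => _ /mapP[i _ ->]; apply/rootP; apply: h; exact: leq_addr.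
have hu : uniq rs.
  rewrite map_inj_in_uniq ?iota_uniq // => i k _ _ /eqP.
  wlog le : i k / (i <= k)%N => [hw|].
    by case: (leqP i k) => [|/ltnW] hle e; [|symmetry]; apply: hw => //; rewrite eq_sym.
  rewrite eq_sym -subr_eq0 -natrB ?leq_add2l // subnDl.
  case e : (k - i)%N => [|m]; first by move=> _; lia.
  by rewrite (negPf (natinv_natr_neq0 m hB)).
by have := max_poly_roots hP hr hu; rewrite size_map size_iota ltnn.
Qed.

(** Ordered in some rank: the index set of the limit basis. *)
Definition pbw (mu : monomial) : bool := sorted lex_le mu && pos_letters mu.

Lemma pbw_ordered mu n : pbw mu -> (deg mu <= n)%N -> ordered n mu.
Proof. by move=> /andP[h1 h2]; exact: ordered_deg. Qed.

Lemma ordered_pbw mu n : ordered n mu -> pbw mu.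
Proof. by move=> /orderedE[h1 h2 _]; apply/andP. Qed.

Section BasisCriterion.
Variables (A : comNzRingType) (V : lmodType A) (Q : pred monomial) (e : monomial -> V).
Local Notation M := {malg A[seq (nat * nat)]}.

(** For modules known only through a universal property: the support of K v need not lie in Q, but
    [e] vanishes outside Q, so that part can be cut off. *)
Lemma is_basis_inverse (K : {linear V -> M}) :
  (forall mu, Q mu -> K (e mu) = << mu >>) -> (forall mu, ~~ Q mu -> e mu = 0) ->
  (forall v, v = lincomb e (K v)) -> is_basis Q e.
Proof.
move=> hK h0 hv v.
pose r := [seq mu <- enum_fset (msupp (K v)) | Q mu].
have ur : uniq r by rewrite filter_uniq ?fset_uniq.
have hs : {subset msupp (\sum_(mu <- r) << (K v)@_mu *g mu >>) <= Q}.
  by move=> mu /(msupp_sumU ur); rewrite mem_filter => /andP[].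
have hr : lincomb e (\sum_(mu <- r) << (K v)@_mu *g mu >>) = v.
  rewrite [RHS](hv v) lincomb_sumU big_filter /lincomb big_mkcond.
  by apply: eq_bigr => mu _; case: ifP => // /negbT /h0 ->; rewrite scaler0.
exists (\sum_(mu <- r) << (K v)@_mu *g mu >>); split; first by [].
suff inj c : {subset msupp c <= Q} -> K (lincomb e c) = c.
  by move=> c [hc hvc]; rewrite -[LHS](inj _ hs) -[RHS](inj _ hc) -hvc hr.
move=> hc; rewrite {2}[c]monalgE /lincomb raddf_sum big_seq [RHS]big_seq.
apply: eq_bigr => mu hmu; rewrite [LHS](linearZ_LR K) /= hK; last exact: hc.
apply/malgP => nu.
by rewrite mcoeffZ !mcoeffU; case: eqP; rewrite ?mulr1n ?mulr0n ?mulr1 ?mulr0.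
Qed.

End BasisCriterion.

(** * The basis of the limit and of its scalar extension *)

Section LimitModules.
Variables (R : realType) (H : forall n, heisenberg R n).
Hypothesis luk : forall n, is_basis (ordered n) (Wmon (H n)).
Variable phi : forall m n, {linear W (H m) -> W (H n)}.
Hypothesis hphi : transition_maps phi.
Variables (L : lmodType (Chbar R)) (io : forall n, {linear W (H n) -> L}).
Hypothesis hL : direct_limit phi io.
Variables (V : lmodType (Cnuhbar R)) (j : L -> V).
Hypothesis hV : scalar_extension j.
Implicit Types (mu nu : monomial) (m n : nat).
Local Notation M := {malg (Chbar R)[seq (nat * nat)]}.
Local Notation MA := {malg (Cnuhbar R)[seq (nat * nat)]}.

(** Every index in a word is at most its degree, so rank [deg mu] is large enough for the word to be
    ordered. *)
Definition limL mu : L := io (deg mu) (Wmon (H (deg mu)) mu).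

Lemma io_word n mu : ordered n mu -> io n (Wmon (H n) mu) = limL mu.
Proof.
have [hc _] := hL; move=> h; rewrite /limL; set m := deg mu; pose N := maxn m n.
have hm : ordered m mu by apply: pbw_ordered (ordered_pbw h) _.
rewrite -(hc m N) ?leq_maxl // -(hc n N) ?leq_maxr //.
by rewrite !hphi ?leq_maxl ?leq_maxr.
Qed.

(** The coordinate maps of all ranks form a cocone, which yields h. The composite
    [lincomb limL \o h] and the identity both factor [io] through L, so they agree by uniqueness. *)
Lemma coordL : exists h : {linear L -> M},
  [/\ forall mu, pbw mu -> h (limL mu) = << mu >>, forall x, x = lincomb limL (h x)
    & forall x mu, mu \in msupp (h x) -> pbw mu].
Proof.
have [hc hu] := hL.
pose co n : {linear W (H n) -> M} := bcoord (@luk n).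
have coE n mu : ordered n mu -> co n (Wmon (H n) mu) = << mu >>.
  by move=> hmu; exact: bcoord_basis.
have hcc : cocone phi co.
  move=> m n le w.
  apply: (basis_ext (@luk m) (g := co n \o phi m n) (h := co m)) w => mu hmu.
  transitivity (co n (Wmon (H n) mu)); first by congr (co n _); exact: hphi.
  by rewrite !coE //; exact: ordered_le le hmu.
have [h [h1 _]] := hu M co hcc.
have hw mu : pbw mu -> h (limL mu) = << mu >>.
  by move=> hmu; rewrite /limL h1 coE //; exact: pbw_ordered.
have [h0 [_ h2]] := hu L io hc.
have hx x : x = lincomb limL (h x).
  have e1 : lincomb limL \o h =1 h0.
    apply: h2 => n w; rewrite /= h1.
    apply: (basis_ext (@luk n) (g := lincomb limL \o co n) (h := io n)) w => mu hmu.
    transitivity (lincomb limL << mu >>); first by congr (lincomb _ _); exact: coE.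
    by rewrite lincombU scale1r io_word.
  have e2 : idfun =1 h0 by apply: (h2 idfun).
  by rewrite -[LHS]/(idfun x) e2 -e1.
exists h; split=> // x nu; rewrite -mcoeff_neq0; apply: contraR => hnu.
rewrite [x]hx /lincomb !raddf_sum /= big1 // => mu _.
rewrite linearZ_LR mcoeffZ /limL h1 /=.
rewrite [X in _ * X]mcoeff_outdom ?mulr0 //.
by apply: contra hnu => /bcoord_supp /ordered_pbw.
Qed.

Definition limV mu : V := if pbw mu then j (limL mu) else 0.

Lemma jE : [/\ j 0 = 0, forall x y, j (x + y) = j x + j y & forall a x, j (a *: x) = a%:P *: j x].
Proof.
have [lj _] := hV.
have j0 : j 0 = 0.
  by have := lj (-1) 0 0; rewrite scaler0 addr0 polyCN polyC1 scaleN1r addNr.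
split=> // [x y|a x]; first by have := lj 1 x y; rewrite polyC1 !scale1r.
by have := lj a x 0; rewrite j0 !addr0.
Qed.

Lemma j_word n mu : ordered n mu -> j (io n (Wmon (H n) mu)) = limV mu.
Proof. by move=> h; rewrite io_word // /limV (ordered_pbw h). Qed.

Lemma limV_basis : is_basis pbw limV.
Proof.
have [j0 jD jZ] := jE; have [lj hu] := hV; have [h [hw hx hs]] := coordL.
pose g (x : L) : MA := \sum_(mu <- msupp (h x)) << ((h x)@_mu)%:P *g mu >>.
have gE x mu : (g x)@_mu = ((h x)@_mu)%:P.
  rewrite mcoeff_sumU ?fset_uniq //; case: ifP => // /negbT hmu.
  by rewrite mcoeff_outdom // polyC0.
have lg : Chbar_linear g.
  move=> a x y; apply/malgP => mu.
  transitivity ((a * (h x)@_mu + (h y)@_mu)%:P).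
    by rewrite gE; congr (_%:P); rewrite (linearP h) mcoeffD mcoeffZ.
  by rewrite polyCD polyCM -!gE mcoeffD mcoeffZ.
have [K [hK _]] := hu MA g lg.
have [h0 [_ h2]] := hu V j lj.
refine (@is_basis_inverse _ _ pbw limV K _ _ _).
- move=> mu hmu; rewrite /limV hmu -[K _]/((K \o j) (limL mu)) hK.
  apply/malgP => nu; rewrite gE hw // !mcoeffU.
  by case: eqP; rewrite ?mulr1n ?mulr0n ?polyC1 ?polyC0.
- by move=> mu /negPf hmu; rewrite /limV hmu.
move=> v.
have e1 : (lincomb limV \o K) \o j =1 j.
  move=> x; rewrite /= -[K (j x)]/((K \o j) x) hK /g lincomb_sumU.
  transitivity (j (lincomb limL (h x))); last by rewrite -hx.
  rewrite /lincomb (big_morph j jD j0) big_seq [RHS]big_seq; apply: eq_bigr => mu hmu.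
  by rewrite jZ /limV (hs _ _ hmu).
have e2 : idfun \o j =1 j by [].
rewrite -[LHS]/((idfun : {linear V -> V}) v) (h2 idfun e2) -(h2 (lincomb limV \o K) e1).
by [].
Qed.

End LimitModules.

(** * Construction of the structure on the limit *)

Section Structure.
Variables (R : realType) (H : forall n, heisenberg R n).
Hypothesis luk : forall n, is_basis (ordered n) (Wmon (H n)).
Variables (V : lmodType (Cnuhbar R)) (b : monomial -> V).
Hypothesis hb : is_basis pbw b.
Local Notation A := (Cnuhbar R).
Local Notation M := {malg A[seq (nat * nat)]}.
Local Notation X0 := (@bdseq R (fun n => n) H).
Local Notation S0 := (@bseq_structure R (fun n => n) H).
Local Notation Z0 := (@ev_zero R (fun n => n) H).
Local Notation sU := (seqU H).
Let hA := @natinv_Cnuhbar R.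
Let iz0 := @ev_zero_ideal R (fun n => n) H.
Implicit Types (mu nu : monomial) (k l d p q n : nat) (v w : V).

(** In rank n: set nu = n in the coordinates and read each word in the U_k of that rank. *)
Definition lift v : X0 := lincomb (nomon S0 sU) (bcoord hb v).

Lemma lift_linear : linear lift.
Proof. by move=> a v w; rewrite /lift bcoord_linear lincomb_linear. Qed.

HB.instance Definition _ := GRing.isLinear.Build A V X0 _ lift lift_linear.

Lemma lift_lincomb (P : M) : {subset msupp P <= pbw} ->
  lift (lincomb b P) = lincomb (nomon S0 sU) P.
Proof. by move=> hP; rewrite /lift (bcoord_uniq hb hP erefl). Qed.

Lemma lift_basis mu : pbw mu -> lift (b mu) = nomon S0 sU mu.
Proof. by move=> h; rewrite /lift bcoord_basis // lincombU scale1r. Qed.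

Lemma supp_deg (P : M) : exists d, forall mu, mu \in msupp P -> (deg mu <= d)%N.
Proof.
by exists (\max_(mu <- enum_fset (msupp P)) deg mu)%N => mu hmu; apply: leq_bigmax_seq.
Qed.

(** In large rank all words involved are ordered, hence independent. Each coefficient polynomial
    therefore vanishes at all large n and is 0. *)
Lemma lift_inj v : Z0 (lift v) -> v = 0.
Proof.
move=> [N hN]; set P := bcoord hb v.
have [d hd] := supp_deg P.
have hev n : (maxn N d <= n)%N -> evalm n P = 0.
  rewrite geq_max => /andP[/hN h1 h2].
  apply: (lincombU_inj (@luk n)).
  - move=> mu /msupp_evalm hmu; apply: pbw_ordered; first exact: (bcoord_supp hmu).
    exact: leq_trans (hd _ hmu) h2.
  - by move=> mu; rewrite msupp0.
  - by rewrite -seqU_lincomb -/(lift v) h1 raddf0.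
have P0 : P = 0.
  apply/malgP => mu; rewrite mcoeff0.
  apply: (@poly_ev_eq0 _ _ (maxn N d) (@natinv_Chbar R)) => n /hev h.
  by rewrite -mcoeff_evalm h mcoeff0.
by rewrite -[v](bcoordK hb) -/P P0 raddf0.
Qed.

Lemma lift_fil v : exists p, fil S0 sU Z0 p (lift v).
Proof.
have [d hd] := supp_deg (bcoord hb v); exists d.+1.
by apply: (lincomb_spn _ iz0) => mu /hd.
Qed.

(** Polynomiality enters here: straightening in [fil_coord] uses [poly_ope_all], and it makes the
    image of [lift] closed under products modulo [Z0]. *)
Lemma fil_lift p x : fil S0 sU Z0 p x -> exists v, Z0 (lift v - x).
Proof.
move=> hx; have [P [hP [N hN]]] := fil_coord (@poly_ope_all R H luk p) (leqnSn p) hx.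
have hp : {subset msupp P <= pbw}.
  by move=> mu /hP[_ h1 h2]; rewrite unfold_in /pbw h1 h2.
exists (lincomb b P); rewrite lift_lincomb //; exists N => n hn.
by rewrite bseqBE seqU_lincomb hN // subrr.
Qed.

Lemma lift_vac : exists v, lift v = vac S0.
Proof. by exists (b [::]); rewrite lift_basis. Qed.

Lemma lift_prod (s : int) v w : exists t, Z0 (lift t - vprod S0 s (lift v) (lift w)).
Proof.
have [p hp] := lift_fil v; have [q hq] := lift_fil w.
apply: (@fil_lift (p + q).-1).
apply: (fil_prod hA iz0 (@poly_ope_all R H luk (p + q)%N)) hp hq.
exact: leq_trans (leqnSn _) (leqnSn _).
Qed.

Definition limit_structure : vertex_structure V :=
  transport_structure iz0 lift_inj lift_vac lift_prod.

Lemma lift_eq v w : Z0 (lift v - lift w) -> v = w.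
Proof. by rewrite -raddfB => /lift_inj /subr0_eq. Qed.

Variable u : nat -> V.
Hypothesis hu : forall k, lift (u k) = sU k.

Lemma limit_nomon mu : pbw mu -> nomon limit_structure u mu = b mu.
Proof.
move=> h; apply: lift_eq; rewrite (lift_basis h).
have := transport_nomon iz0 lift_inj lift_vac lift_prod u mu.
by rewrite (@eq_nomon _ _ S0 (lift \o u) sU) // => a _; exact: hu.
Qed.

Lemma limit_ope k l (s : nat) (P : M) (N : nat) : {subset msupp P <= pbw} ->
  (forall n, (N < n)%N -> vprod S0 s (sU k) (sU l) n
     = lincomb (nomon (heisS (H n)) (heisU (H n))) (evalm n P)) ->
  vprod limit_structure s (u k) (u l) = lincomb (nomon limit_structure u) P.
Proof.
move=> hP hN; rewrite (eq_lincomb (e' := b)); last by move=> mu /hP /limit_nomon.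
apply: lift_eq; rewrite lift_lincomb //.
have : Z0 (lift (vprod limit_structure s (u k) (u l)) - vprod S0 s (lift (u k)) (lift (u l))).
  exact: (transport_prod iz0 lift_inj lift_vac lift_prod s (u k) (u l)).
rewrite !hu; set y := vprod S0 _ _ _ => h.
rewrite -[lift _](subrK y) -addrA; have [Z00 Zl _ _] := iz0.
rewrite -[_ - y]scale1r; apply: Zl => //.
by exists N.+1 => n hn; rewrite bseqBE seqU_lincomb hN // subrr.
Qed.

End Structure.

Section Uniqueness.
Variables (A : comNzRingType) (V : lmodType A) (S S' : vertex_structure V).
Hypothesis hA : natinv A.
Variables (u : nat -> V) (b : monomial -> V).
Hypothesis hb : is_basis pbw b.
Hypothesis u0 : u 0 = 0.
Hypothesis hS : forall mu, pbw mu -> nomon S u mu = b mu.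
Hypothesis hS' : forall mu, pbw mu -> nomon S' u mu = b mu.
Variable P : nat -> nat -> nat -> {malg A[seq (nat * nat)]}.
Hypothesis hP : forall k l s mu, mu \in msupp (P k.+1 l.+1 s) -> (deg mu < k.+1 + l.+1)%N.
Hypothesis hope : forall k l (s : nat),
  vprod S s (u k.+1) (u l.+1) = lincomb (nomon S u) (P k.+1 l.+1 s).
Hypothesis hope' : forall k l (s : nat),
  vprod S' s (u k.+1) (u l.+1) = lincomb (nomon S' u) (P k.+1 l.+1 s).

Lemma pair_lincomb (e e' : monomial -> V) c :
  ((lincomb e c, lincomb e' c) : (V * V)%type) = lincomb (fun mu => (e mu, e' mu)) c.
Proof. by rewrite /lincomb; elim/big_rec3: _ => // mu x y z _ <-. Qed.

Lemma structure_uniq : same_structure S S'.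
Proof.
have e0 : vac S = vac S' by rewrite -[LHS]/(nomon S u [::]) hS // -(hS' (mu := [::])).
have bS : is_basis pbw (nomon S u).
  by apply: (eq_is_basis _ hb) => mu hmu; rewrite hS.
have hv s x y : vprod S s x y = vprod S' s x y.
  (* The identity of V is shown to be a homomorphism from [S] to [S']; the bound [hP] puts the OPEs
     of the pairs into the filtration. *)
  apply: (@hom_vprod _ _ _ S S' hA u u pbw bS idfun) => [mu h|mu h h'|k l {}s].
  - by rewrite /= hS // hS'.
  - rewrite /pbw h; apply/allP => -[k m] /h' /=; case: k => // -[].
    by rewrite u0.
  case: k => [|k]; first by rewrite /= /pair_prod /= u0 !vprod0l; exact: (spn0 _ (ideal0 _)).
  case: l => [|l]; first by rewrite /= /pair_prod /= u0 !vprod0r; exact: (spn0 _ (ideal0 _)).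
  rewrite /= /pair_prod /= hope hope' pair_lincomb.
  have -> : (fun mu => (nomon S u mu, nomon S' u mu))
      = nomon (pair_structure S S') (fun k => (u k, u k)).
    by apply: funext => mu; rewrite pair_nomon.
  apply: (lincomb_spn _ (ideal0 _)) => mu /hP h.
  by apply: leq_trans h _; rewrite /degl; lia.
by split=> // x; rewrite !vderE hv e0.
Qed.

End Uniqueness.

Section OpeCoefficients.
Variables (R : realType) (H : forall n, heisenberg R n).
Hypothesis luk : forall n, is_basis (ordered n) (Wmon (H n)).
Local Notation A := (Cnuhbar R).
Local Notation M := {malg A[seq (nat * nat)]}.

Lemma ope_polynomials : exists (N : nat -> nat -> nat) (P : nat -> nat -> nat -> M),
  (forall k l s mu, mu \in msupp (P k.+1 l.+1 s) -> pbw mu /\ (deg mu < k.+1 + l.+1)%N) /\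
  (forall k l, (k.+1 + l.+1 <= N k.+1 l.+1)%N) /\
  (forall k l (s : nat) n, (N k.+1 l.+1 < n)%N ->
     vprod (heisS (H n)) s (heisU (H n) k.+1) (heisU (H n) l.+1)
     = lincomb (nomon (heisS (H n)) (heisU (H n))) (evalm n (P k.+1 l.+1 s))).
Proof.
have dl k : degl k.+1 = k.+1 by rewrite /degl; lia.
have /choice[F hF] : forall kls : nat * nat * nat, exists PN : M * nat,
    (forall mu, mu \in msupp PN.1 -> pbw mu /\ (deg mu < kls.1.1.+1 + kls.1.2.+1)%N) /\
    forall n, (PN.2 <= n)%N ->
      vprod (heisS (H n)) kls.2 (heisU (H n) kls.1.1.+1) (heisU (H n) kls.1.2.+1)
      = lincomb (nomon (heisS (H n)) (heisU (H n))) (evalm n PN.1).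
  move=> [[k l] s] /=; have := @poly_ope_all R H luk _ _ _ s (leqnn (degl k.+1 + degl l.+1)).
  move=> /(fil_coord (@poly_ope_all R H luk _) (leqnSn _)) [P [hP [N hN]]].
  exists (P, N); split=> [mu /hP[h1 h2 h3]|n /hN //].
  by rewrite /pbw h2 h3; split=> //; rewrite !dl in h1.
(* The bound must not depend on s. For s >= k + l the product vanishes by weight, so finitely many s
   remain for the maximum; the term k + l makes all words ordered. *)
pose P k l s := if (s < k + l)%N then (F (k.-1, l.-1, s)).1 else 0.
pose N k l := maxn (k + l) (\max_(s <- iota 0 (k + l)) (F (k.-1, l.-1, s)).2).
exists N, P; split; last split.
- move=> k l s mu; rewrite /P; case: ifP => _; last by rewrite msupp0.
  by have [h _] := hF (k, l, s); exact: h.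
- by move=> k l; exact: leq_maxl.
move=> k l s n; rewrite /N gtn_max /P => /andP[h1 h2]; case: ltnP => hs.
  have [_ h] := hF (k, l, s); apply: h.
  apply: leq_trans (ltnW h2).
  apply: (@leq_bigmax_seq _ (iota 0 (k.+1 + l.+1)) xpredT (fun s => (F (k, l, s)).2)) => //.
  by rewrite mem_iota.
rewrite (hle_prod0 (hle_heisU (H n) k.+1) (hle_heisU (H n) l.+1)); last by lia.
have -> : evalm n (0 : M) = 0 by apply/malgP => mu; rewrite mcoeff_evalm !mcoeff0 horner0.
by rewrite raddf0.
Qed.

End OpeCoefficients.

Theorem mainTheorem2 (R : realType) (H : forall n, heisenberg R n)
    (Lukyanov : forall n, is_basis (ordered n) (Wmon (H n)))
    (phi : forall m n, {linear W (H m) -> W (H n)})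
    (hphi : transition_maps phi)
    (L : lmodType (Chbar R)) (iota : forall n, {linear W (H n) -> L})
    (hL : direct_limit phi iota)
    (V : lmodType (Cnuhbar R)) (j : L -> V)
    (hV : scalar_extension j) :
  let U (k : nat) : V := j (iota k (WU (H k) k)) in
  exists (N : nat -> nat -> nat)
         (P : nat -> nat -> nat -> {malg (Cnuhbar R)[seq (nat * nat)]}),
    (forall i i' : nat, (1 <= i)%N -> (1 <= i')%N ->
       forall n : nat, (N i i' < n)%N -> forall s : nat,
         {subset msupp (P i i' s) <= ordered n} /\
         vprod (WS (H n)) s (WU (H n) i) (WU (H n) i')
           = specialize n (P i i' s) (Wmon (H n)))
    /\
    (let is_limit_structure (S : vertex_structure V) : Prop :=
       (forall i i' : nat, (1 <= i)%N -> (1 <= i')%N -> forall s : nat,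
          vprod S s (U i) (U i') = lincomb (nomon S U) (P i i' s)) /\
       (forall n mu, ordered n mu -> nomon S U mu = j (iota n (Wmon (H n) mu))) in
     exists S : vertex_structure V, is_limit_structure S /\
       (forall S' : vertex_structure V,
          is_limit_structure S' -> same_structure S S')).
Proof.
move=> U; have [N [P [hP [hN hope]]]] := ope_polynomials Lukyanov.
exists N, P; split.
  move=> [|i] // [|i'] // _ _ n hn s; split.
    move=> mu /hP[h1 h2]; apply: pbw_ordered => //.
    by have := hN i i'; lia.
  apply: val_inj; rewrite /= hope // -(@Wlincomb_val R n (H n)).
  by congr subva_val; rewrite lincomb_evalm.
have hb := limV_basis Lukyanov hphi hL hV.
have hjw n mu : ordered n mu -> j (iota n (Wmon (H n) mu)) = limV iota j mu.
  exact: (j_word hphi hL).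
have U0 : U 0 = 0.
  have [j0 _ _] := jE hV; rewrite /U; have -> : WU (H 0) 0 = 0 by exact: val_inj.
  by rewrite raddf0.
have UE k : (0 < k)%N -> U k = limV iota j [:: (k, 0%N)].
  move=> hk; rewrite -(hjw k); last by rewrite /ordered /= leqnn hk.
  rewrite /U; congr (j (iota k _)); apply: esym.
  exact: (vprod_vacr (WS (H k)) (WU (H k) k)).
have hu k : lift H hb (U k) = seqU H k.
  case: k => [|k]; first by rewrite U0 raddf0 seqU0.
  by rewrite UE // lift_basis // -[RHS](vprod_vacr (@bseq_structure R (fun n => n) H)).
pose S := limit_structure Lukyanov hb.
have hS mu : pbw mu -> nomon S U mu = limV iota j mu by exact: limit_nomon.
have opeS k l (s : nat) : vprod S s (U k.+1) (U l.+1) = lincomb (nomon S U) (P k.+1 l.+1 s).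
  apply: (@limit_ope R H Lukyanov V (limV iota j) hb U hu k.+1 l.+1 s _ (N k.+1 l.+1)).
    by move=> mu /hP[].
  by move=> n hn; exact: hope.
exists S; split.
  split=> [[|i] // [|i'] //|n mu hmu].
  by rewrite hjw // hS // (ordered_pbw hmu).
move=> S' [h1 h2].
apply: (@structure_uniq _ V S S' (@natinv_Cnuhbar R) U _ hb U0 hS _ P).
- move=> mu hmu; rewrite (h2 (deg mu)) ?hjw //; exact: pbw_ordered.
- by move=> k l s mu /hP[].
- exact: opeS.
- by move=> k l s; exact: h1.
Qed.
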